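(* Let $0<\alpha<n$, $1\le p<n/\alpha$, $1/q=1/p-\alpha/n$, with $1\le s<p$ if $1<p<n/\alpha$ and $s=1$ if $p=1$. Let $w_1,w_2$ be weights on $\mathbb{R}^n$ with $(w_1^s,w_2^s)\in A_{p/s,q/s}$ and $w_2^s\in A_{p/s,q/s}$. Let $1<p_0<\infty$, $T>0$, $\psi:\mathbb{R}^n\times\mathbb{R}^+\to\mathbb{R}^+$, and let $w$ be a weight on $\mathbb{R}^n$. Let $L$ be a linear operator on $L^2(\mathbb{R}^n)$ generating an analytic semigroup $\exp(-tL)$ whose kernel $p_t(x,y)$ satisfies $|p_t(x,y)|\le C t^{-n/2}\exp\left(-c\frac{|x-y|^2}t\right)$ for $x,y\in\mathbb{R}^n$, $t>0$, and let $L^{-\alpha/2}(f)(x)=\frac1{\Gamma(\alpha/2)}\int_0^\infty\exp(-tL)(f)(x)\frac{dt}{t^{-\alpha/2+1}}$. Let $\psi_1,\psi_2$ be positive functions on $\mathbb{R}^n\times\mathbb{R}^+$. (1) Suppose $$\sup_{(a,r)\in\mathbb{R}^n\times\mathbb{R}^+}\frac1{\psi_2(a,r)}\int_r^\infty\frac{\inf_{t\le l<\infty}\psi_1(a,l)\,w_1^p(B(a,l))^{1/p}}{w_2^q(B(a,t))^{1/q}}\frac{dt}t<\infty .$$ If $1<p<n/\alpha$ and $L^{-\alpha/2}$ is bounded from $L^{p,w_1^p}$ to $L^{q,w_2^q}$, then $L^{-\alpha/2}$ is bounded from $\mathcal{M}_\psi^{p_0,w}(0,T,\mathcal{M}^{p,w_1^p}_{\psi_1})$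 to $\mathcal{M}_\psi^{p_0,w}(0,T,\mathcal{M}^{q,w_2^q}_{\psi_2})$; if $p=1$ and $L^{-\alpha/2}$ is bounded from $L^{1,w_1}$ to $WL^{q,w_2^q}$, then $L^{-\alpha/2}$ is bounded from $\mathcal{M}_\psi^{p_0,w}(0,T,\mathcal{M}^{1,w_1}_{\psi_1})$ to $\mathcal{M}_\psi^{p_0,w}(0,T,W\mathcal{M}^{q,w_2^q}_{\psi_2})$. (2) Suppose $1<p<n/\alpha$, $w_1\in A_\infty$ and $$\sup_{(a,r)\in\mathbb{R}^n\times\mathbb{R}^+}\frac1{\psi_2(a,r)}\int_r^\infty\left(1+\ln\frac tr\right)\frac{\inf_{t\le l<\infty}\psi_1(a,l)\,w_1^p(B(a,l))^{1/p}}{w_2^q(B(a,t))^{1/q}}\frac{dt}t<\infty .$$ If $b\in BMO$ and $[b,L^{-\alpha/2}]$ is bounded from $L^{p,w_1^p}$ to $L^{q,w_2^q}$, then $[b,L^{-\alpha/2}]$ is bounded from $\mathcal{M}_\psi^{p_0,w}(0,T,\mathcal{M}^{p,w_1^p}_{\psi_1})$ to $\mathcal{M}_\psi^{p_0,w}(0,T,\mathcal{M}^{q,w_2^q}_{\psi_2})$.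
   Context: Notation: $\mathbb{R}^+=(0,\infty)$; $B(a,r)$ is the open ball in $\mathbb{R}^n$. A weight is a nonnegative locally integrable function on $\mathbb{R}^n$ with values in $(0,\infty)$ a.e.; $w(E)=\int_E w(x)\,dx$ and $w^p(E)=\int_E w(x)^p\,dx$. Weight classes: for $1<p<q<\infty$ and $1/p+1/p'=1$, $(w_1,w_2)\in A_{p,q}$ if there is $C>0$ with $\left(\frac1{|B|}\int_B w_2^q\right)^{1/q}\left(\frac1{|B|}\int_B w_1^{-p'}\right)^{1/p'}\le C$ for all balls $B$; for $p=1<q$, $(w_1,w_2)\in A_{1,q}$ if $\left(\frac1{|B|}\int_B w_2^q\right)^{1/q}\|w_1^{-1}\|_{L^\infty(B)}\le C$ for all balls $B$; $w\in A_{p,q}$ means $(w,w)\in A_{p,q}$. $A_\infty=\bigcup_{p\ge1}A_p$ with $A_p$ the usual Muckenhoupt classes. Spaces: $\|f\|_{L^{p,w}(E)}=\left(\int_E|f|^pw\right)^{1/p}$ and $\|f\|_{WL^{p,w}(E)}=\sup_{\gamma>0}\gamma\,w(\{x\in E:|f(x)|>\gamma\})^{1/p}$; $L^{p,w}$, $WL^{p,w}$ denote the case $E=\mathbb{R}^n$. For positive $\psi$ on $\mathbb{R}^n\times\mathbb{R}^+$, $\mathcal{M}^{p,w}_\psi$ and $W\mathcal{M}^{p,w}_\psi$ consist of the measurable $f$ for which respectively $\|f\|_{\mathcal{M}^{p,w}_\psi}=\sup_{a,r}\frac{1}{\psi(a,r)}w(B(a,r))^{-1/p}\|f\|_{L^{p,w}(B(a,r))}$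 and $\|f\|_{W\mathcal{M}^{p,w}_\psi}=\sup_{a,r}\frac{1}{\psi(a,r)}w(B(a,r))^{-1/p}\|f\|_{WL^{p,w}(B(a,r))}$ is finite. For $X$ one of these spaces, $\mathcal{M}^{p_0,w}_\psi(0,T,X)$ is the set of functions $f$ on $\mathbb{R}^n\times(0,T)$ with $$\|f\|_{\mathcal{M}^{p_0,w}_\psi(0,T,X)}=\sup_{a\in\mathbb{R}^n,\,r>0,\,t_0\in(0,T)}\frac1{\psi(a,r)}\frac1{w(B(a,r))^{1/p_0}}\left(\int_{(0,T)\cap(t_0-r,t_0+r)}\|f(\cdot,t)\|_X^{p_0}\,dt\right)^{1/p_0}<\infty .$$ Operators act on functions of $(x,t)$ by acting on $f(\cdot,t)$ for each $t$. $[b,N](f)=bN(f)-N(bf)$; $BMO$ has seminorm $\|b\|_*=\sup_B\frac1{|B|}\int_B|b-b_B|$, $b_B=\frac1{|B|}\int_Bb$. An operator $N$ is bounded from $X$ to $Y$ if $\|Nf\|_Y\le C\|f\|_X$ for all $f\in X$; for a commutator $[b,N]$ the constant is required to have the form $C\|b\|_*$. *)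

(* Defs.v *)
From HB Require Import structures.
From mathcomp Require Import all_boot all_order all_algebra.
From mathcomp Require Import all_classical all_reals all_analysis.
From mathcomp Require Import ess_sup_inf complex.

Set Implicit Arguments.
Unset Strict Implicit.
Unset Printing Implicit Defensive.
Import Order.TTheory GRing.Theory Num.Theory.
Import numFieldNormedType.Exports.
Local Open Scope classical_set_scope.
Local Open Scope ring_scope.

(* R^n is n.-tuple R with its product sigma-algebra; Lebesgue measure on it is
   the iterated product of the one-dimensional measure. *)
Section euclidean_space.
Context {R : realType}.

Definition tcons n (u : R * n.-tuple R) : n.+1.-tuple R :=
  [tuple of u.1 :: u.2].

Definition tuncons n (x : n.+1.-tuple R) : R * n.-tuple R :=
  (thead x, [tuple of behead x]).

Lemma tconsK n : cancel (@tcons n) (@tuncons n).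
Proof.
by move=> [a x]; rewrite /tuncons /= theadE; congr pair; apply: val_inj.
Qed.

Lemma measurable_tcons n : measurable_fun setT (@tcons n).
Proof.
exact: (@measurable_cons _ _ _ _ _ _ _ measurable_fst measurable_snd).
Qed.

Lemma measurable_tuncons n : measurable_fun setT (@tuncons n).
Proof.
apply/measurable_fun_pair; first exact: measurable_tnth.
exact: measurable_behead.
Qed.

Section lebS.
Variables (n : nat) (m : {sigma_finite_measure set (n.-tuple R) -> \bar R}).
Local Open Scope ereal_scope.

Definition lebS : set (n.+1.-tuple R) -> \bar R :=
  pushforward (lebesgue_measure \x m) (@tcons n).

Let measurable_preimage A :
  measurable A -> measurable (@tcons n @^-1` A).
Proof. by move=> mA; rewrite -[X in measurable X]setTI; exact: measurable_tcons. Qed.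

Let lebS0 : lebS set0 = 0.
Proof. by rewrite /lebS /pushforward preimage_set0 measure0. Qed.

Let lebS_ge0 A : 0 <= lebS A. Proof. by rewrite /lebS /pushforward. Qed.

Let lebS_sigma_additive : semi_sigma_additive lebS.
Proof.
move=> F mF tF mUF; rewrite /lebS /pushforward preimage_bigcup.
apply: measure_semi_sigma_additive.
- by move=> k; exact: measurable_preimage.
- apply/trivIsetP => /= i j _ _ ij; rewrite -preimage_setI.
  by move/trivIsetP : tF => /(_ _ _ _ _ ij) ->//; rewrite preimage_set0.
- by rewrite -preimage_bigcup; exact: measurable_preimage.
Qed.

HB.instance Definition _ := isMeasure.Build _ _ _ lebS
  lebS0 lebS_ge0 lebS_sigma_additive.

Let lebS_sigma_finite : sigma_finite setT lebS.
Proof.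
have /sigma_finiteP[F [UF ndF mF]] := sigma_finiteT (@lebesgue_measure R).
have /sigma_finiteP[G [UG ndG mG]] := sigma_finiteT m.
exists (fun k => @tuncons n @^-1` (F k `*` G k)).
  apply/esym; rewrite -subTset => x _.
  have [i _ Fi] : (\bigcup_i F i) (thead x) by rewrite -UF.
  have [j _ Gj] : (\bigcup_j G j) [tuple of behead x] by rewrite -UG.
  exists (maxn i j) => //; split => /=.
    by move: Fi; exact/subsetPset/ndF/leq_maxl.
  by move: Gj; exact/subsetPset/ndG/leq_maxr.
move=> k; have [mFk Fk] := mF k; have [mGk Gk] := mG k; split.
  rewrite -[X in measurable X]setTI; apply: measurable_tuncons => //.
  exact: measurableX.
rewrite /lebS /pushforward (_ : _ @^-1` _ = F k `*` G k); last first.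
  by rewrite -comp_preimage (_ : _ \o _ = id)//; apply/funext => u; exact: tconsK.
by rewrite product_measure1E// lte_mul_pinfty// ge0_fin_numE.
Qed.

HB.instance Definition _ := Measure_isSigmaFinite.Build _ _ _ lebS
  lebS_sigma_finite.

End lebS.

Fixpoint leb (n : nat) : {sigma_finite_measure set (n.-tuple R) -> \bar R} :=
  match n with
  | 0 => @dirac _ _ ([tuple] : 0.-tuple R) R
  | k.+1 => lebS (leb k)
  end.

Lemma lebSE n (A : set R) (B : set (n.-tuple R)) :
  measurable A -> measurable B ->
  (leb n.+1 (@tuncons n @^-1` (A `*` B)) = lebesgue_measure A * leb n B)%E.
Proof.
move=> mA mB; transitivity ((lebesgue_measure \x leb n)%E (A `*` B)).
  congr ((lebesgue_measure \x leb n)%E _).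
  by rewrite -comp_preimage (_ : _ \o _ = id)//; apply/funext => u; exact: tconsK.
exact: (@product_measure1E _ _ (measurableTypeR R) _ R lebesgue_measure (leb n)
  A B mA mB).
Qed.

End euclidean_space.

Local Notation normc := ComplexField.Normc.normc.

Section complex_functions.
Context d (X : measurableType d) {R : realType}.

Definition cmeasurable (D : set X) (f : X -> R[i]) :=
  measurable_fun D (fun x => complex.Re (f x)) /\
  measurable_fun D (fun x => complex.Im (f x)).

Definition cintegral (mu : {measure set X -> \bar R}) (D : set X)
    (f : X -> R[i]) : R[i] :=
  Complex (\int[mu]_(x in D) complex.Re (f x)) (\int[mu]_(x in D) complex.Im (f x)).

End complex_functions.

(* A space of functions: its functions are the f with fmeas f and
   fnorm f < +oo. *)
Record fspace (R : realType) (F : Type) := FSpace {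
  fmeas : set F;
  fnorm : F -> \bar R }.

Definition in_fspace (R : realType) (F : Type) (X : fspace R F) (f : F) :=
  fmeas X f /\ (fnorm X f < +oo)%E.

Definition bounded_by (R : realType) (F : Type) (K : R) (X Y : fspace R F)
    (N : F -> F) :=
  forall f, in_fspace X f ->
    in_fspace Y (N f) /\ (fnorm Y (N f) <= K%:E * fnorm X f)%E.

Definition bounded_op (R : realType) (F : Type) (X Y : fspace R F)
    (N : F -> F) :=
  exists2 K : R, 0 < K & bounded_by K X Y N.

Section harmonic_analysis.
Context {R : realType} (n : nat).
Local Notation Rn := (n.-tuple R).
Local Notation Fn := (Rn -> R[i]).
Local Notation mu := (@leb R n).
Implicit Types (f g : Fn) (w : Rn -> R) (a x y : Rn) (r t p q : R).

Definition eucl_dist x y : R := Num.sqrt (\sum_(i < n) (tnth x i - tnth y i) ^+ 2).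

Definition eball a r : set Rn := [set x | eucl_dist a x < r].

Definition wpow w p : Rn -> R := fun x => w x `^ p.

Section weights.
Local Open Scope ereal_scope.

Definition is_weight w :=
  [/\ measurable_fun setT w, (forall x, 0 <= w x)%R,
      (forall a r, (0 < r)%R -> \int[mu]_(x in eball a r) (w x)%:E < +oo) &
      {ae mu, forall x, (0 < w x)%R}].

Definition wmeas w (E : set Rn) : \bar R := \int[mu]_(x in E) (w x)%:E.

Definition avg (E : set Rn) (g : Rn -> R) : \bar R :=
  (mu E)^-1 * \int[mu]_(x in E) (g x)%:E.

Definition Linfty (E : set Rn) (g : Rn -> R) : \bar R :=
  ess_sup mu ((fun x => `|g x|%:E) \_ E).

(* p' with 1/p + 1/p' = 1 *)
Definition conj_exp p : R := ((1 - p^-1)^-1)%R.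

(* meant for 1 <= p < q *)
Definition Apq p q (w1 w2 : Rn -> R) :=
  exists C : R, forall a r, (0 < r)%R ->
    avg (eball a r) (wpow w2 q) `^ q^-1 *
    (if p == 1%R then Linfty (eball a r) (fun x => (w1 x)^-1)%R
     else avg (eball a r) (wpow w1 (- conj_exp p)) `^ (conj_exp p)^-1) <= C%:E.

(* Muckenhoupt classes, meant for 1 <= p *)
Definition Ap p w :=
  exists C : R, forall a r, (0 < r)%R ->
    avg (eball a r) w *
    (if p == 1%R then Linfty (eball a r) (fun x => (w x)^-1)%R
     else avg (eball a r) (wpow w (1 - conj_exp p)) `^ (p - 1)) <= C%:E.

Definition Ainfty w := exists2 p : R, (1 <= p)%R & Ap p w.

End weights.

Section spaces.
Local Open Scope ereal_scope.

Definition Lp_norm p w (E : set Rn) f : \bar R :=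
  (\int[mu]_(x in E) (normc (f x) `^ p * w x)%:E) `^ p^-1.

Definition WLp_norm p w (E : set Rn) f : \bar R :=
  ereal_sup [set gamma%:E * wmeas w (E `&` [set x | (gamma < normc (f x))%R]) `^ p^-1
            | gamma in [set gamma : R | (0 < gamma)%R]].

Definition Lp p w : fspace R Fn := FSpace (cmeasurable setT) (Lp_norm p w setT).

Definition WLp p w : fspace R Fn := FSpace (cmeasurable setT) (WLp_norm p w setT).

Definition sup_balls (F : Rn -> R -> \bar R) : \bar R :=
  ereal_sup [set F u.1 u.2 | u in [set u : Rn * R | (0 < u.2)%R]].

Definition Morrey p w (psi : Rn -> R -> R) : fspace R Fn :=
  FSpace (cmeasurable setT)
    (fun f => sup_balls (fun a r => (psi a r)^-1%:E *
       (wmeas w (eball a r) `^ p^-1)^-1 * Lp_norm p w (eball a r) f)).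

Definition WMorrey p w (psi : Rn -> R -> R) : fspace R Fn :=
  FSpace (cmeasurable setT)
    (fun f => sup_balls (fun a r => (psi a r)^-1%:E *
       (wmeas w (eball a r) `^ p^-1)^-1 * WLp_norm p w (eball a r) f)).

(* u x t stands for u(x, t); only the values for 0 < t < T matter. The integral
   in t is that of a nonnegative function: it is a supremum over the simple
   functions below it, defined and monotone without measurability in t. *)
Definition time_Morrey p0 w (psi : Rn -> R -> R) (T : R) (X : fspace R Fn) :
    fspace R (Rn -> R -> R[i]) :=
  FSpace (fun u => forall t, t \in `]0%R, T[ -> fmeas X (u ^~ t))
    (fun u => sup_balls (fun a r => ereal_sup [set (psi a r)^-1%:E *
       (wmeas w (eball a r) `^ p0^-1)^-1 *
       (\int[lebesgue_measure]_(t in `]0%R, T[ `&` `](t0 - r)%R, (t0 + r)%R[)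
          fnorm X (u ^~ t) `^ p0) `^ p0^-1 | t0 in `]0%R, T[])).

Definition act_slices (N : Fn -> Fn) (u : Rn -> R -> R[i]) : Rn -> R -> R[i] :=
  fun x t => N (u ^~ t) x.

(* inf_(t <= l < oo) psi1(a, l) w1^p(B(a, l))^(1/p) / w2^q(B(a, t))^(1/q) *)
Definition inf_ratio p q (w1 w2 : Rn -> R) (psi1 : Rn -> R -> R) a t : \bar R :=
  ereal_inf [set (psi1 a l)%:E * wmeas (wpow w1 p) (eball a l) `^ p^-1
            | l in `[t, +oo[ ]
  / wmeas (wpow w2 q) (eball a t) `^ q^-1.

End spaces.

Section bmo.
Local Open Scope ereal_scope.

Definition cavg (E : set Rn) f : R[i] :=
  (((fine (mu E))^-1)%:C%C * cintegral mu E f)%R.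

Definition bmo_seminorm (b : Fn) : \bar R :=
  sup_balls (fun a r => avg (eball a r)
    (fun x => normc (b x - cavg (eball a r) b)%R)).

Definition BMO (b : Fn) :=
  [/\ cmeasurable setT b,
      (forall a r, (0 < r)%R -> \int[mu]_(x in eball a r) (normc (b x))%:E < +oo) &
      bmo_seminorm b < +oo].

Definition commutator (b : Fn) (N : Fn -> Fn) : Fn -> Fn :=
  fun f x => (b x * N f x - N (fun y => b y * f y) x)%R.

End bmo.

(* Operators on L^2 are functions on representatives; equalities in L^2 are
   equalities almost everywhere. *)
Section semigroups.
Local Notation L2 := (in_fspace (Lp 2 (cst 1))).
Local Notation norm2 := (fnorm (Lp 2 (cst 1))).
Local Notation "f =ae g" := {ae mu, forall x, f x = g x} (at level 70).

Definition L2_linear_operator (D : set Fn) (L : Fn -> Fn) :=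
  [/\ D `<=` L2 /\ D (cst 0),
      (forall f, D f -> L2 (L f)),
      (forall f g, D f -> L2 g -> f =ae g -> D g /\ L f =ae L g),
      (forall f g, D f -> D g ->
         D (f \+ g) /\ L (f \+ g) =ae (L f \+ L g)) &
      (forall (c : R[i]) f, D f ->
         D (fun x => c * f x) /\ L (fun x => c * f x) =ae (fun x => c * L f x))].

Definition L2_bounded_operator (S : Fn -> Fn) :=
  L2_linear_operator L2 S /\
  exists K : R, forall f, L2 f -> (norm2 (S f) <= K%:E * norm2 f)%E.

(* {z : z <> 0, |arg z| < theta} *)
Definition sector (theta : R) : set R[i] :=
  [set z | exists rho phi : R, [/\ 0 < rho, `|phi| < theta &
     z = Complex (rho * cos phi) (rho * sin phi)]].

(* z |-> S z is holomorphic in operator norm on the sector *)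
Definition analytic_semigroup (theta : R) (S : R[i] -> Fn -> Fn) :=
  [/\ (forall z, z = 0 \/ sector theta z -> L2_bounded_operator (S z)),
      (forall f, L2 f -> S 0 f =ae f),
      (forall z1 z2 f, sector theta z1 -> sector theta z2 -> L2 f ->
         S (z1 + z2) f =ae S z1 (S z2 f)),
      (forall z, sector theta z -> exists2 S' : Fn -> Fn,
         L2_bounded_operator S' &
         forall e : R, 0 < e -> exists2 delta : R, 0 < delta &
         forall h : R[i], h != 0 -> normc h < delta -> forall f, L2 f ->
           (norm2 (fun x => h^-1 * (S (z + h) f x - S z f x) - S' f x)%R
            <= e%:E * norm2 f)%E) &
      (forall theta' f, 0 < theta' < theta -> L2 f ->
         forall e : R, 0 < e -> exists2 delta : R, 0 < delta &
         forall z, sector theta' z -> normc z < delta ->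
           (norm2 (fun x => S z f x - f x)%R <= e%:E)%E)].

(* the semigroup t |-> S t is exp(- t L): its infinitesimal generator is - L,
   with domain D *)
Definition semigroup_of (D : set Fn) (L : Fn -> Fn) (S : R[i] -> Fn -> Fn) :=
  forall f g, L2 f -> L2 g ->
    (D f /\ L f =ae g) <->
    (forall e : R, 0 < e -> exists2 delta : R, 0 < delta &
     forall t, 0 < t < delta ->
       (norm2 (fun x => (t^-1)%:C%C * (S t%:C%C f x - f x) + g x)%R <= e%:E)%E).

Definition generates_analytic_semigroup (D : set Fn) (L : Fn -> Fn)
    (S : R[i] -> Fn -> Fn) :=
  [/\ L2_linear_operator D L, semigroup_of D L S &
      exists2 theta : R, 0 < theta <= pi / 2 & analytic_semigroup theta S].

Definition kernel_op (k : Rn -> Rn -> R[i]) (f : Fn) : Fn :=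
  fun x => cintegral mu setT (fun y => k x y * f y).

(* the joint measurability is what gives a meaning to the integrals in t of
   the kernel *)
Definition semigroup_kernel (S : R[i] -> Fn -> Fn) (P : R -> Rn -> Rn -> R[i]) :=
  cmeasurable [set u : R * (Rn * Rn) | 0 < u.1]
    (fun u : R * (Rn * Rn) => P u.1 u.2.1 u.2.2) /\
  forall t f, 0 < t -> L2 f -> S t%:C%C f =ae kernel_op (P t) f.

Definition gaussian_bound (P : R -> Rn -> Rn -> R[i]) :=
  exists C c : R, [/\ 0 < C, 0 < c & forall t x y, 0 < t ->
    normc (P t x y) <=
      C * t `^ (- (n%:R / 2)) * expR (- (c * eucl_dist x y ^+ 2 / t))].

End semigroups.

Definition Gamma (z : R) : R :=
  \int[lebesgue_measure]_(t in `]0, +oo[) (t `^ (z - 1) * expR (- t)).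

(* L^(-alpha/2), with exp(-tL) acting through its kernel P t, which makes sense
   beyond L^2 *)
Definition fractional_power (alpha : R) (P : R -> Rn -> Rn -> R[i]) (f : Fn) : Fn :=
  fun x => ((Gamma (alpha / 2))^-1)%:C%C *
    cintegral lebesgue_measure `]0, +oo[
      (fun t => kernel_op (P t) f x * ((t `^ (- (alpha / 2) + 1))^-1)%:C%C).

End harmonic_analysis.

(* Main.v *)
Require Import Defs.
From mathcomp Require Import all_boot all_order all_algebra.
From mathcomp Require Import all_classical all_reals all_analysis.
From mathcomp Require Import complex ess_sup_inf measurable_realfun ring lra.

(** The estimate is proved on one time slice, with constants that do not depend
on the slice; it then passes to the norms in time because the integral of a
nonnegative function is monotone (bounded_by_time_Morrey).

Let N be L^(-alpha/2). Integrating the Gaussian bound in time shows that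
|N f(x)| is at most a constant times the Riesz potential of |f|, the integral
of |f(y)| |x - y|^(alpha - n). On a ball B = B(a, r), cut f into f1, its
restriction to B(a, 2 r), and f2 = f - f1. The norm of N f1 on B is controlled
by the assumed weighted L^p bound. For x in B, the potential of f2 is at most
  sum_k (2^k r)^(alpha - n) int_(B(a, 2^k r)) |f|
(fractional_power_split), and by Hoelder the A_(p,q) condition turns the k-th
term into F_k / U_k, where F_k is the norm of f in L^p(w1^p) on B(a, 2^k r) and
U_k = w2^q(B(a, 2^k r))^(1/q) (dual_bound, L1_ball_le). As F is nondecreasing
in the radius and is dominated by the Morrey norm times
psi1 w1^p(B(a, l))^(1/p), and as w2^q is doubling because w2 is in A_(p,q), the
sum over k is at most a constant times the integral in the hypothesis on psi1
and psi2 (tail_series). This bounds N f2 on B by a multiple of psi2(a, r), and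
gives the first part (slice_strong, slice_weak).

For the commutator and any constant c,
  [b, N] f = [b, N] f1 + (b - c) N f2 - N ((b - c) f2)
on B. Taking for c an average of b near B, one needs the moments of b - c for
the densities w2^q and w2^(-p'). The product of suitable powers of the masses
of a cube for these two densities is comparable to a power of its volume, and
the product of the same powers of the densities is 1; so a set that fills at
most half of a cube misses a fixed proportion of its mass (weak_Ainfty). With
this, an induction on dyadic generations gives the John-Nirenberg inequality
for both densities, first for the dyadic averages of b and then, by martingale
convergence and the lemma of Fatou, for b (tree_exp_le, dyadic_avg_cvg_ae,
john_nirenberg). Dyadic differentiation of the two-weight A_(p,q) condition
also gives w2 <= K w1 almost everywhere, which brings the norms back to w1
(weights_le). Averages of b over concentric balls of radii r and 2^k r differ
by at most a multiple of k times the BMO seminorm; this is the factor k + 1 in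
the series for (b - c) f2, and the logarithm in the hypothesis absorbs it
(bmo_bounds, slice_commutator). *)

Set Implicit Arguments.
Unset Strict Implicit.
Unset Printing Implicit Defensive.
Import Order.TTheory GRing.Theory Num.Theory.
Import numFieldNormedType.Exports.
Local Open Scope classical_set_scope.
Local Open Scope ring_scope.
Import HBSimple.

Local Notation normc := ComplexField.Normc.normc.

(** * From slices in time to the Morrey norm in time *)

Section lower_integral.
Context d (T : measurableType d) (R : realType) (mu : {measure set T -> \bar R}).
Local Open Scope ereal_scope.
Implicit Types (D : set T) (f g : T -> \bar R).

Import HBNNSimple.

(** The integral of a nonnegative function is a supremum over simple functions
below it, so monotonicity requires no measurability. This matters in the time
variable, where the norm of a slice need not be measurable. *)
Lemma le_integral_ge0 D f g : (forall x, D x -> 0 <= f x) ->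
  (forall x, D x -> f x <= g x) -> \int[mu]_(x in D) f x <= \int[mu]_(x in D) g x.
Proof.
move=> f0 fg; rewrite !ge0_integralE//; last by move=> x Dx; exact: le_trans (f0 x Dx) (fg x Dx).
apply: ereal_sup_le => _ [h /= hf <-]; exists h => // x.
apply: le_trans (hf x) _; rewrite /patch; case: ifPn => // /set_mem; exact: fg.
Qed.

Lemma le_integralZl_ge0 D f (k : R) : (0 < k)%R -> (forall x, D x -> 0 <= f x) ->
  \int[mu]_(x in D) (k%:E * f x) <= k%:E * \int[mu]_(x in D) f x.
Proof.
move=> k0 f0; rewrite !ge0_integralE//; last first.
  by move=> x Dx; rewrite mule_ge0 ?f0// lee_fin ltW.
apply: ge_ereal_sup => _ [h /= hf <-].
have k'0 : (0 <= k^-1)%R by rewrite invr_ge0 ltW.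
rewrite -lee_pdivrMl//.
apply: ereal_sup_ubound; exists (scale_nnsfun h k'0) => /=.
  move=> x; have := hf x; rewrite /patch; case: ifPn => // _ h1.
    by rewrite EFinM lee_pdivrMl.
  have -> : h x = 0%R by apply/eqP; rewrite eq_le -lee_fin h1/=; exact: fun_ge0.
  by rewrite mulr0.
rewrite sintegralrM//.
Qed.

End lower_integral.

(** The bounds obtained on slices hold for all larger constants; the limit
constant may be 0, as for the commutator with a constant function. *)
Lemma lee_mul_limit (R : realType) (x y : \bar R) (K : R) :
  (0 <= K)%R -> (0 <= y < +oo)%E -> (forall K', (K < K')%R -> (x <= K'%:E * y)%E) ->
  (x <= K%:E * y)%E.
Proof.
move=> K0; case: y => [y /andP[y0 _] h| /andP[_]|/andP[]]; rewrite ?ltxx//.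
apply/lee_addgt0Pr => e e0.
rewrite lee_fin in y0.
have y1 : (0 < y + 1)%R by rewrite ltr_wpDl.
apply: (le_trans (h (K + e / (y + 1))%R _)); first by rewrite ltrDl divr_gt0.
rewrite -!EFinM -EFinD lee_fin mulrDl lerD2l mulrAC ler_pdivrMr// ler_pM2l// lerDl//.
Qed.

Lemma lee_poweR (R : realType) (r : R) (x y : \bar R) :
  (0 <= r)%R -> (0 <= x)%E -> (x <= y)%E -> (x `^ r <= y `^ r)%E.
Proof.
move=> r0 x0 xy; apply: (gt0_ler_poweR r0 _ _ xy); rewrite in_itv/= leey andbT//.
exact: le_trans xy.
Qed.

Section time_lift.
Context {R : realType} (n : nat).
Local Notation Rn := (n.-tuple R).
Local Notation Fn := (Rn -> R[i]).
Local Open Scope ereal_scope.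

(** A constant K > K0 is positive, hence can be carried through the power, the
lower integral in time and the suprema even when the norms of some slices are
infinite; K then tends to K0, once the norm in time is known to be finite. *)
Lemma bounded_by_time_Morrey (p0 : R) (w : Rn -> R) (psi : Rn -> R -> R) (T : R)
    (X Y : fspace R Fn) (N : Fn -> Fn) (K0 : R) :
  (0 < p0)%R -> (0 <= K0)%R -> (forall a r, (0 < r)%R -> (0 < psi a r)%R) ->
  (0 < T)%R ->
  (forall f, 0 <= fnorm X f) -> (forall f, 0 <= fnorm Y f) ->
  (forall f, fmeas X f -> fmeas Y (N f)) ->
  (forall f K, fmeas X f -> (K0 < K)%R -> fnorm Y (N f) <= K%:E * fnorm X f) ->
  bounded_by K0 (time_Morrey p0 w psi T X) (time_Morrey p0 w psi T Y)
    (act_slices N).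
Proof.
move=> p00 K00 psi0 T0 X0 Y0 mN bN u [mu_ ufin].
have main K : (K0 < K)%R -> fnorm (time_Morrey p0 w psi T Y) (act_slices N u) <=
    K%:E * fnorm (time_Morrey p0 w psi T X) u.
  move=> K0K; have Kgt0 : (0 < K)%R by exact: le_lt_trans K0K.
  apply: ge_ereal_sup => _ [[a r] /= r0 <-].
  apply: ge_ereal_sup => _ [t0 t0T <-].
  set c : \bar R := _ * _^-1.
  have c0 : 0 <= c.
    by rewrite mule_ge0 ?inve_ge0 ?poweR_ge0// lee_fin invr_ge0 ltW// psi0.
  set J := `]0%R, T[ `&` _.
  apply: (@le_trans _ _ (K%:E * (c *
     (\int[lebesgue_measure]_(t in J) fnorm X (u ^~ t) `^ p0) `^ p0^-1))); last first.
    rewrite lee_pmul2l//; apply: le_ereal_sup_tmp; eexists; first by exists (a, r).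
    by apply: ereal_sup_ubound; exists t0.
  rewrite muleCA; apply: lee_wpmul2l => //.
  have -> : K%:E = (K `^ p0)%:E `^ p0^-1.
    by rewrite poweR_EFin -powRrM mulfV ?gt_eqF// powRr1// ltW.
  have I0 : 0 <= \int[lebesgue_measure]_(t in J) fnorm X (u ^~ t) `^ p0.
    by apply: integral_ge0 => t _; exact: poweR_ge0.
  rewrite -poweRM// ?lee_fin ?powR_ge0//.
  have Kp : (0 < K `^ p0)%R by exact: powR_gt0.
  have le1 : \int[lebesgue_measure]_(t in J) fnorm Y (act_slices N u ^~ t) `^ p0 <=
      (K `^ p0)%:E * \int[lebesgue_measure]_(t in J) fnorm X (u ^~ t) `^ p0.
    apply: le_trans (le_integralZl_ge0 _ Kp _); last by move=> t _; exact: poweR_ge0.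
    apply: le_integral_ge0 => t; first by move=> _; exact: poweR_ge0.
    move=> [tT _]; rewrite -poweR_EFin -poweRM// ?lee_fin ?(ltW Kgt0)//.
    have h := bN _ _ (mu_ t tT) K0K.
    by apply: lee_poweR => //; exact: (ltW p00).
  apply: lee_poweR => //; first by rewrite invr_ge0 ltW.
  by apply: integral_ge0 => t _; exact: poweR_ge0.
have norm0 : 0 <= fnorm (time_Morrey p0 w psi T X) u.
  apply: le_ereal_sup_tmp; eexists; first by exists ([tuple of nseq n 0%R], 1%R) => //=.
  apply: le_ereal_sup_tmp; eexists.
    by exists (T / 2)%R => //=; rewrite in_itv/= divr_gt0//= ltr_pdivrMr// ltr_pMr// ltr1n.
  by rewrite !mule_ge0// ?inve_ge0 ?poweR_ge0// lee_fin invr_ge0 ltW// psi0.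
have bd : fnorm (time_Morrey p0 w psi T Y) (act_slices N u) <=
    K0%:E * fnorm (time_Morrey p0 w psi T X) u.
  by apply: lee_mul_limit => //; rewrite norm0.
split; last exact: bd.
split; first by move=> t tT; apply: mN; exact: mu_.
apply: le_lt_trans bd _; rewrite lte_mul_pinfty// ?ltry// ge0_fin_numE//.
Qed.

End time_lift.

(** * Hoelder and Jensen inequalities with real powers *)

Section hoelder_power_form.
Context d (T : measurableType d) (R : realType) (mu : {measure set T -> \bar R}).
Local Open Scope ereal_scope.
Implicit Types (E : set T) (f g : T -> R).

Lemma measurable_comp_powR (D : set T) f (a : R) :
  measurable_fun D f -> measurable_fun D (fun x => f x `^ a)%R.
Proof. by move=> mf; apply: (measurableT_comp (measurable_powR a) mf). Qed.

Let integral_powR_indic E f (a : R) : measurable E -> (forall x, (0 <= f x)%R) ->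
  (0 < a)%R ->
  \int[mu]_x (`|(f x `^ a * \1_E x)%R%:E| `^ a^-1) = \int[mu]_(x in E) (f x)%:E.
Proof.
move=> mE f0 a0; rewrite [RHS]integral_mkcond; apply: eq_integral => x _.
rewrite patchE indicE; case: (x \in E); rewrite ?mulr1 ?mulr0.
  rewrite abse_EFin ger0_norm ?powR_ge0// poweR_EFin -powRrM.
  by rewrite divff ?gt_eqF// powRr1.
by rewrite abse_EFin normr0 poweR_EFin powR0// invr_eq0 gt_eqF.
Qed.

(** Hoelder with exponents a and b that sum to 1, applied to f^a and g^b: the
form in which products of powers of masses of sets appear below. *)
Lemma hoelder_powR E f g (a b : R) : measurable E ->
  measurable_fun setT f -> measurable_fun setT g ->
  (forall x, 0 <= f x)%R -> (forall x, 0 <= g x)%R ->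
  (0 < a)%R -> (0 < b)%R -> (a + b = 1)%R ->
  \int[mu]_(x in E) (f x `^ a * g x `^ b)%:E <=
  (\int[mu]_(x in E) (f x)%:E) `^ a * (\int[mu]_(x in E) (g x)%:E) `^ b.
Proof.
move=> mE mf mg f0 g0 a0 b0 ab.
have mF (h : T -> R) (c : R) : measurable_fun setT h -> measurable_fun setT (fun x => h x `^ c * \1_E x)%R.
  by move=> mh; apply: measurable_funM; [exact: measurable_comp_powR|exact: measurable_indic].
have := @hoelder _ _ _ mu (fun x => f x `^ a * \1_E x)%R (fun x => g x `^ b * \1_E x)%R
  a^-1 b^-1 (mF _ _ mf) (mF _ _ mg).
rewrite !invr_gt0 !invrK => /(_ a0 b0 ab).
rewrite Lnorm1 unlock !invrK.
rewrite (integral_powR_indic mE f0 a0) (integral_powR_indic mE g0 b0); apply: le_trans.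
rewrite integral_mkcond le_eqVlt; apply/orP; left; apply/eqP.
apply: eq_integral => x _; rewrite patchE /= indicE; case: (x \in E).
  by rewrite !mulr1 ger0_norm// mulr_ge0// powR_ge0.
by rewrite !mulr0 normr0.
Qed.

Lemma jensen_powR E f (a : R) : measurable E ->
  measurable_fun setT f -> (forall x, 0 <= f x)%R -> (0 < a <= 1)%R ->
  \int[mu]_(x in E) (f x `^ a)%:E <= (\int[mu]_(x in E) (f x)%:E) `^ a * mu E `^ (1 - a).
Proof.
move=> mE mf f0 /andP[a0]; rewrite le_eqVlt => /predU1P[->|a1].
  rewrite subrr poweRe0 mule1 poweRe1; last by apply: integral_ge0 => x _; rewrite lee_fin.
  by under eq_integral do rewrite powRr1//.
have := @hoelder_powR E f (cst 1%R) a (1 - a)%R mE mf (measurable_cst _) f0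
  (fun=> ler01) a0.
rewrite subr_gt0 a1 => /(_ isT); rewrite addrC subrK => /(_ erefl).
under eq_integral do rewrite powR1 mulr1.
by rewrite (integral_cst _ mE 1%E) mul1e.
Qed.

End hoelder_power_form.

(** * Cubes and balls *)

Section cubes_and_balls.
Context {R : realType}.

Definition cube n (o : n.-tuple R) (l : R) : set (n.-tuple R) :=
  [set x | forall i, tnth o i <= tnth x i < tnth o i + l].

Lemma measurable_cube n (o : n.-tuple R) l : measurable (cube o l).
Proof.
rewrite (_ : cube o l = \bigcap_(i in [set: 'I_n])
    ((fun x => tnth x i) @^-1` `[tnth o i, tnth o i + l[)); last first.
  apply/seteqP; split => [x xo i _|x xo i]; first by rewrite /= in_itv/= xo.
  by have := xo i I; rewrite /= in_itv/=.
apply: fin_bigcap_measurable => // i _.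
rewrite -[X in measurable X]setTI; exact: measurable_tnth.
Qed.

Lemma leb_cube n (o : n.-tuple R) l : 0 <= l -> leb n (cube o l) = (l ^+ n)%:E.
Proof.
move=> l0; elim: n o => [|n IH] o.
  by rewrite /= diracE (_ : _ \in _)// inE => -[].
rewrite (_ : cube o l = @tuncons R n @^-1`
    (`[thead o, thead o + l[ `*` cube [tuple of behead o] l)); last first.
  apply/seteqP; split => x.
    move=> xo; split => /=; first by rewrite in_itv/= xo.
    by move=> i; rewrite !tnth_behead xo.
  move=> [/=]; rewrite in_itv/= => x0 xb i.
  have [j ->|->] := unliftP ord0 i; last exact: x0.
  have := xb j; rewrite !tnth_behead (_ : inord j.+1 = lift ord0 j)//.
  by apply: val_inj; rewrite /= inordK// ltnS.
rewrite lebSE//; last exact: measurable_cube.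
rewrite IH lebesgue_measure_itv/= lte_fin ltrDl.
case: ltP => l0'.
  by rewrite -EFinB -EFinM exprS addrAC subrr add0r.
by rewrite mul0e exprS (_ : l = 0) ?mul0r//; apply/eqP; rewrite eq_le l0' l0.
Qed.

Variable n : nat.
Local Notation Rn := (n.-tuple R).
Local Notation mu := (@leb R n).
Implicit Types (x y a o : Rn) (r l : R).

Lemma eucl_dist_ge0 x y : 0 <= eucl_dist x y.
Proof. exact: sqrtr_ge0. Qed.

Lemma eucl_dist_sqr x y :
  eucl_dist x y ^+ 2 = \sum_(i < n) (tnth x i - tnth y i) ^+ 2.
Proof. by rewrite sqr_sqrtr// sumr_ge0// => i _; exact: sqr_ge0. Qed.

Lemma eucl_distC x y : eucl_dist x y = eucl_dist y x.
Proof. by congr Num.sqrt; apply: eq_bigr => i _; rewrite -sqrrN opprB. Qed.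

(** A substitute for the triangle inequality that follows coordinate by
coordinate from (s + t)^2 <= 2 s^2 + 2 t^2; only the order of magnitude of
distances matters. *)
Lemma eucl_dist_quasi a x y :
  eucl_dist a y ^+ 2 <= 2 * eucl_dist a x ^+ 2 + 2 * eucl_dist x y ^+ 2.
Proof.
rewrite !eucl_dist_sqr !mulr_sumr -big_split/=; apply: ler_sum => i _.
set u := tnth a i; set v := tnth x i; set z := tnth y i.
have := sqr_ge0 (u - v - (v - z)); lra.
Qed.

Lemma coord_le_eucl_dist x y i : `|tnth x i - tnth y i| <= eucl_dist x y.
Proof.
rewrite -sqrtr_sqr ler_sqrt; last by rewrite sumr_ge0// => j _; exact: sqr_ge0.
rewrite (bigD1 i)//= lerDl sumr_ge0// => j _; exact: sqr_ge0.
Qed.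

(** The factor n + 1 instead of the square root of n keeps the inequality strict
and also covers n = 0. *)
Lemma eucl_dist_lt x y l : 0 < l ->
  (forall i, `|tnth x i - tnth y i| <= l) -> eucl_dist x y < n.+1%:R * l.
Proof.
move=> l0 xy; rewrite -(@ltr_pXn2r _ 2)// ?nnegrE ?eucl_dist_ge0//; last first.
  by rewrite mulr_ge0// ltW.
rewrite eucl_dist_sqr; apply: (@le_lt_trans _ _ (\sum_(i < n) l ^+ 2)).
  apply: ler_sum => i _; rewrite -real_normK ?num_real//.
  by rewrite ler_pXn2r// ?nnegrE ltW.
rewrite sumr_const card_ord exprMn -[X in X < _]mulr_natl ltr_pM2r ?exprn_gt0//.
by rewrite -natrX ltr_nat; apply: (@leq_trans n.+1) => //; rewrite -[X in (X <= _)%N]expn1 leq_pexp2l.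
Qed.

Lemma measurable_eucl_dist2 :
  measurable_fun setT (fun u : Rn * Rn => eucl_dist u.1 u.2).
Proof.
rewrite /eucl_dist.
apply: (@measurableT_comp _ _ _ _ _ _ (@Num.sqrt R)).
  by apply: continuous_measurable_fun; exact: sqrt_continuous.
apply: measurable_sum => i; apply: measurable_funX; apply: measurable_funB.
  exact: (measurableT_comp (measurable_tnth i) measurable_fst).
exact: (measurableT_comp (measurable_tnth i) measurable_snd).
Qed.

Lemma measurable_eucl_dist x : measurable_fun setT (eucl_dist x).
Proof.
have := measurableT_comp measurable_eucl_dist2
  (@measurable_pair1 _ _ Rn Rn x).
exact.
Qed.

Lemma measurable_eball a r : measurable (eball a r).
Proof.
rewrite (_ : eball a r = eucl_dist a @^-1` `]-oo, r[); last first.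
  by apply/seteqP; split => x /=; rewrite in_itv.
rewrite -[X in measurable X]setTI; exact: measurable_eucl_dist.
Qed.

Lemma eball_sub_cube a r :
  eball a r `<=` cube [tuple of map (fun u => u - r) a] (2 * r).
Proof.
move=> x /= ax i; rewrite tnth_map.
have := le_lt_trans (coord_le_eucl_dist a x i) ax.
rewrite ltr_norml => /andP[]; lra.
Qed.

Lemma cube_sub_eball o l : 0 < l -> cube o l `<=` eball o (n.+1%:R * l).
Proof.
move=> l0 x xo; apply: eucl_dist_lt => // i.
have /andP[] := xo i; rewrite ler_norml; lra.
Qed.

Lemma inner_cube_sub_eball a r : 0 < r ->
  cube [tuple of map (fun u => u - r / n.+1%:R) a] (2 * (r / n.+1%:R)) `<=` eball a r.
Proof.
move=> r0 x xa; rewrite /eball/= -[ltRHS](@divfK _ n.+1%:R)// mulrC.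
have h0 : 0 < r / n.+1%:R by rewrite divr_gt0.
set h := r / _ in h0 xa *.
apply: eucl_dist_lt => // i.
have := xa i; rewrite tnth_map => /andP[]; rewrite ler_norml; lra.
Qed.

Lemma leb_eball_le a r : 0 < r -> (mu (eball a r) <= ((2 * r) ^+ n)%:E)%E.
Proof.
move=> r0; rewrite -(leb_cube [tuple of map (fun u => u - r) a]); last by rewrite mulr_ge0// ltW.
apply: le_measure; rewrite ?inE; [exact: measurable_eball|exact: measurable_cube|].
exact: eball_sub_cube.
Qed.

Lemma leb_eball_ge a r : 0 < r ->
  (((2 * (r / n.+1%:R)) ^+ n)%:E <= mu (eball a r))%E.
Proof.
move=> r0; rewrite -(leb_cube [tuple of map (fun u => u - r / n.+1%:R) a]); last first.
  by rewrite mulr_ge0// divr_ge0// ltW.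
apply: le_measure; rewrite ?inE; [exact: measurable_cube|exact: measurable_eball|].
exact: inner_cube_sub_eball.
Qed.

Lemma leb_eball_gt0 a r : 0 < r -> (0 < mu (eball a r))%E.
Proof.
move=> r0; apply: lt_le_trans (leb_eball_ge a r0).
by rewrite lte_fin exprn_gt0// mulr_gt0// divr_gt0.
Qed.

Lemma leb_eball_fin a r : 0 < r -> mu (eball a r) \is a fin_num.
Proof.
by move=> r0; rewrite ge0_fin_numE// (le_lt_trans (leb_eball_le a r0))// ltry.
Qed.

Lemma sub_eball a r r' : r <= r' -> eball a r `<=` eball a r'.
Proof. by move=> rr x /= h; exact: lt_le_trans rr. Qed.

End cubes_and_balls.

(** * Dyadic decompositions of sums and integrals *)

Section dyadic_sums.
Context {R : realType}.
Implicit Types (X t s : R).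

Lemma geometric_eseries (c x : R) : 0 <= c -> 0 <= x < 1 ->
  (\sum_(0 <= k <oo) (c * x ^+ k)%:E = (c / (1 - x))%:E)%E.
Proof.
move=> c0 /andP[x0 x1].
have := @cvg_geometric_series R c x; rewrite ger0_norm// => /(_ x1) h.
apply/cvg_lim => //.
rewrite (_ : (fun _ => _) = (fun k => (series (geometric c x) k)%:E)); last first.
  by apply/funext => k; rewrite /series/= sumEFin.
by apply: cvg_EFin => //; exact: nearW.
Qed.

Lemma dyadic_above X t : 0 < X -> X <= t ->
  exists k : nat, X * 2 ^+ k <= t < X * 2 ^+ k.+1.
Proof.
move=> X0 Xt; pose m := Num.truncn (t / X).
have tX1 : 1 <= t / X by rewrite ler_pdivlMr// mul1r.
have /andP[mt tm] : m%:R <= t / X < m.+1%:R by apply: truncn_itv; exact: le_trans tX1.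
have m0 : (0 < m)%N by rewrite /m truncn_gt0.
exists (trunc_log 2 m).
have /andP[] := trunc_log_bounds (isT : (1 < 2)%N) m0; set k := trunc_log 2 m => km mk.
rewrite mulrC -ler_pdivlMr// (mulrC X) -ltr_pdivrMr//; apply/andP; split.
  by apply: le_trans mt; rewrite -natrX ler_nat.
by apply: lt_le_trans tm _; rewrite -natrX ler_nat.
Qed.

Lemma dyadic_below X t : 0 < t -> t <= X ->
  exists k : nat, X / 2 ^+ k.+1 <= t <= X / 2 ^+ k.
Proof.
move=> t0 tX; have [k /andP[k1 k2]] := dyadic_above t0 tX; exists k.
by rewrite ler_pdivrMr ?exprn_gt0// ler_pdivlMr ?exprn_gt0// k1 (ltW k2).
Qed.

(** From z <= exp z at z = s y / m, raised to the power m. *)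
Lemma powR_le_expR (m s y : R) : 0 < m -> 0 < s -> 0 <= y ->
  y `^ m <= (m / s) `^ m * expR (s * y).
Proof.
move=> m0 s0 y0.
have -> : y = (m / s) * (s * y / m) by field; rewrite !gt_eqF.
set z := s * y / m.
have z0 : 0 <= z by rewrite divr_ge0 ?mulr_ge0// ltW.
rewrite powRM//; last by rewrite divr_ge0// ltW.
rewrite ler_wpM2l ?powR_ge0//.
have -> : s * (m / s * z) = z * m by field; rewrite gt_eqF.
rewrite expRM.
apply: ge0_ler_powR; rewrite ?nnegrE ?expR_ge0// ?ltW//.
by apply: lt_le_trans (expR_ge1Dx _); rewrite ltrDr.
Qed.

Lemma lt1_two_powRN s : 0 < s -> 0 <= (2 : R) `^ (- s) < 1.
Proof.
move=> s0; rewrite powR_ge0/= powRN invf_lt1 ?powR_gt0//.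
by rewrite /powR pnatr_eq0/= expR_gt1 mulr_gt0// ln_gt0// ltr1n.
Qed.

Lemma powR_two_expn s (k : nat) : (2 ^+ k) `^ s = (2 `^ s) ^+ k :> R.
Proof.
by rewrite -powR_mulrn// -powRrM mulrC powRrM powR_mulrn// powR_ge0.
Qed.

Section cover.
Context d (T : measurableType d) (mu : {measure set T -> \bar R}).
Local Open Scope ereal_scope.

(** Covering the domain by countably many pieces on each of which f is at most a
constant times g replaces f by the step function of these constants; this
serves for the estimates on dyadic shells. *)
Lemma integral_cover_le (D : set T) (E : nat -> set T) (m : nat -> R)
    (f g : T -> \bar R) :
  measurable D -> (forall k, measurable (E k)) -> measurable_fun D g ->
  (forall x, D x -> 0 <= g x) -> (forall x, D x -> 0 <= f x) ->
  (forall k, (0 <= m k)%R) ->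
  (forall x, D x -> exists2 k, E k x & f x <= (m k)%:E * g x) ->
  \int[mu]_(x in D) f x <= \sum_(0 <= k <oo) ((m k)%:E * \int[mu]_(x in D `&` E k) g x).
Proof.
move=> mD mE mg g0 f0 m0 fE.
have gE0 k x : D x -> 0 <= (g \_ (E k)) x.
  by move=> Dx; rewrite patchE; case: ifPn => // _; exact: g0.
have mgE k : measurable_fun D (g \_ (E k)).
  by apply/measurable_restrict => //; apply: measurable_funS mg.
apply: (@le_trans _ _ (\int[mu]_(x in D) \sum_(0 <= k <oo) ((m k)%:E * (g \_ (E k)) x))).
  apply: le_integral_ge0 => // x Dx; have [k Ek fk] := fE x Dx.
  apply: (le_trans fk).
  have h0 i : (0 <= i)%N -> xpredT i -> 0 <= (m i)%:E * (g \_ (E i)) x.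
    by move=> _ _; rewrite mule_ge0 ?lee_fin// gE0.
  apply: le_trans (nneseries_lim_ge k.+1 h0).
  rewrite big_nat_recr//= patchE mem_set// leeDr//.
  by apply: sume_ge0 => i _; exact: h0.
rewrite integral_nneseries//; last 2 first.
- by move=> k; exact: measurable_funeM.
- by move=> k x Dx; rewrite mule_ge0 ?lee_fin// gE0.
apply: lee_nneseries => k _.
  by rewrite integral_ge0// => x Dx; rewrite mule_ge0 ?lee_fin// gE0.
rewrite integral_mkcondr.
by move: (@ge0_integralZl_EFin _ _ _ mu D mD _ (fun x Dx => gE0 k x Dx) (mgE k) _ (m0 k)) => ->.
Qed.

Lemma integral_cover_le_cst (D : set T) (E : nat -> set T) (m L : nat -> R)
    (f : T -> \bar R) :
  measurable D -> (forall k, measurable (E k)) ->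
  (forall x, D x -> 0 <= f x) -> (forall k, (0 <= m k)%R) ->
  (forall k, mu (E k) <= (L k)%:E) ->
  (forall x, D x -> exists2 k, E k x & f x <= (m k)%:E) ->
  \int[mu]_(x in D) f x <= \sum_(0 <= k <oo) (m k * L k)%:E.
Proof.
move=> mD mE f0 m0 EL fE.
apply: le_trans (@integral_cover_le D E m f (cst 1) mD mE _ _ f0 m0 _) _ => //.
- by move=> x Dx; have [k Ek fk] := fE x Dx; exists k => //; rewrite mule1.
- apply: lee_nneseries => k _.
    by rewrite mule_ge0 ?lee_fin// integral_ge0.
  rewrite EFinM lee_wpmul2l ?lee_fin//.
  rewrite (integral_cst _ (measurableI _ _ mD (mE k)) 1) mul1e.
  apply: le_trans (EL k); apply: le_measure; [rewrite inE; exact: measurableI|rewrite inE; exact: mE|].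
  exact: subIsetr.
Qed.

End cover.

Local Notation leb1 := (@lebesgue_measure R).

(** The power is almost constant on the dyadic intervals above X, whose
contributions form a geometric series. *)
Lemma integral_powR_above (s X : R) : 0 < s -> 0 < X ->
  (\int[leb1]_(t in `[X, +oo[) (t `^ (- s - 1))%:E
     <= (X `^ (- s) / (1 - 2 `^ (- s)))%:E)%E.
Proof.
move=> s0 X0; have X2 k : 0 < X * 2 ^+ k by rewrite mulr_gt0// exprn_gt0.
apply: le_trans (@integral_cover_le_cst _ _ leb1 _
  (fun k => `[X * 2 ^+ k, X * 2 ^+ k.+1[%classic)
  (fun k => (X * 2 ^+ k) `^ (- s - 1)) (fun k => X * 2 ^+ k) _ _ _ _ _ _ _) _.
- exact: measurable_itv.
- by move=> k; exact: measurable_itv.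
- by move=> x _; rewrite lee_fin powR_ge0.
- by move=> k; exact: powR_ge0.
- move=> k; rewrite [X in (X <= _)%E]lebesgue_measure_itv/=; case: ifP => _.
    by rewrite -EFinB lee_fin exprSr mulr_natr mulr2n mulrDr addrK.
  by rewrite lee_fin ltW.
- move=> t /=; rewrite in_itv/= andbT => Xt; have [k Hk] := dyadic_above X0 Xt.
  exists k; first by rewrite /= in_itv.
  rewrite lee_fin -opprD !powRN lef_pV2 ?posrE ?powR_gt0//; last first.
    exact: lt_le_trans Xt.
  apply: ge0_ler_powR; rewrite ?nnegrE ?addr_ge0 ?(ltW s0)//.
  - exact: ltW.
  - by rewrite ltW// (lt_le_trans X0).
  - by case/andP: Hk.
rewrite (eq_eseriesr (g := fun k => (X `^ (- s) * (2 `^ (- s)) ^+ k)%:E)); last first.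
  move=> k _; congr EFin; rewrite -powR_two_expn -powRM ?exprn_ge0 ?(ltW X0)//.
  rewrite -[in X in _ * X](powRr1 (ltW (X2 k))) -powRD; last first.
    by rewrite (gt_eqF (X2 k)) implybT.
  by rewrite subrK.
by rewrite geometric_eseries ?lt1_two_powRN// powR_ge0.
Qed.

Lemma integral_powR_below (s X : R) : 0 < s -> 0 < X ->
  (\int[leb1]_(t in `]0%R, X]) (t `^ (s - 1))%:E
     <= (2 * X `^ s / (1 - 2 `^ (- s)))%:E)%E.
Proof.
move=> s0 X0; have X2 k : 0 < X / 2 ^+ k by rewrite divr_gt0// exprn_gt0.
apply: le_trans (@integral_cover_le_cst _ _ leb1 _
  (fun k => `[X / 2 ^+ k.+1, X / 2 ^+ k]%classic)
  (fun k => (X / 2 ^+ k) `^ s / (X / 2 ^+ k.+1)) (fun k => X / 2 ^+ k) _ _ _ _ _ _ _) _.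
- exact: measurable_itv.
- by move=> k; exact: measurable_itv.
- by move=> x _; rewrite lee_fin powR_ge0.
- by move=> k; rewrite divr_ge0 ?powR_ge0// ltW.
- move=> k; rewrite [X in (X <= _)%E]lebesgue_measure_itv/=; case: ifP => _.
    by rewrite -EFinB lee_fin gerBl ltW.
  by rewrite lee_fin ltW.
- move=> t /=; rewrite in_itv/= => /andP[t0 tX]; have [k Hk] := dyadic_below t0 tX.
  exists k; first by rewrite /= in_itv.
  case/andP: Hk => k1 k2.
  rewrite lee_fin powRD ?(gt_eqF t0) ?implybT// powR_inv1 ?(ltW t0)//.
  apply: ler_pM; rewrite ?powR_ge0 ?invr_ge0 ?(ltW t0)//.
    by apply: ge0_ler_powR; rewrite ?nnegrE ?(ltW t0) ?(ltW s0) ?(ltW (X2 _)).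
  by rewrite lef_pV2 ?posrE.
rewrite (eq_eseriesr (g := fun k => (2 * X `^ s * (2 `^ (- s)) ^+ k)%:E)); last first.
  move=> k _; congr EFin; rewrite exprS.
  have -> : (2 `^ (- s)) ^+ k = (2 ^+ k) `^ (- s) by rewrite powR_two_expn.
  rewrite powRM ?invr_ge0 ?exprn_ge0 ?(ltW X0)//.
  have -> : (2 ^+ k)^-1 `^ s = (2 ^+ k) `^ (- s) :> R.
    by rewrite -powR_inv1 ?exprn_ge0// -powRrM mulN1r.
  have h : 2 ^+ k != 0 :> R by rewrite expf_neq0.
  by field; rewrite h gt_eqF.
by rewrite geometric_eseries ?lt1_two_powRN// mulr_ge0 ?powR_ge0.
Qed.

End dyadic_sums.

(** * Time integrals of the heat kernel and the Riesz kernel *)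

Section heat_kernel.
Context {R : realType}.
Local Notation leb1 := (@lebesgue_measure R).

(** With X = |x - y|^2, nu = n/2 and b = alpha/2, this is the Gaussian bound
times the weight t^(b - 1) of the time integral that defines the fractional
power. *)
Definition heat (nu b c t X : R) : R :=
  t `^ (- nu) * expR (- (c * X * t `^ (- 1))) * t `^ (b - 1).

Lemma heat_ge0 nu b c t X : 0 <= heat nu b c t X.
Proof. by rewrite !mulr_ge0 ?powR_ge0 ?expR_ge0. Qed.

Lemma heat_le_below nu b c t X : 0 < nu -> 0 < c -> 0 < X -> 0 < t ->
  heat nu b c t X <= (nu / c) `^ nu * X `^ (- nu) * t `^ (b - 1).
Proof.
move=> nu0 c0 X0 t0; rewrite ler_wpM2r ?powR_ge0//.
have y0 : 0 < X * t `^ (- 1) by rewrite mulr_gt0 ?powR_gt0.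
have := powR_le_expR nu0 c0 (ltW y0).
rewrite (powRM nu (ltW X0) (powR_ge0 _ _)) -powRrM mulN1r mulrA => h.
rewrite expRN ler_pdivrMr ?expR_gt0// mulrAC [X `^ (- nu)]powRN ler_pdivlMr ?powR_gt0//.
by rewrite mulrC.
Qed.

Lemma heat_le_above nu b c t X : 0 < c -> 0 < X -> 0 < t ->
  heat nu b c t X <= t `^ (- (nu - b) - 1).
Proof.
move=> c0 X0 t0; apply: (@le_trans _ _ (t `^ (- nu) * t `^ (b - 1))).
  rewrite ler_wpM2r ?powR_ge0// ler_piMr ?powR_ge0// -expR0 ler_expR.
  by rewrite oppr_le0 !mulr_ge0 ?powR_ge0// ltW.
by rewrite -powRD ?(gt_eqF t0) ?implybT// opprB addrA (addrC b).
Qed.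

(** Scaling predicts the power of X: for t <= X the exponential is at most a
constant times (t / X)^nu, and for t >= X it is at most 1; both remaining
integrals of powers of t are of order X^(b - nu). *)
Lemma integral_heat_le (nu b c : R) : 0 < b < nu -> 0 < c -> exists2 C : R, 0 < C &
  forall X, 0 < X ->
  (\int[leb1]_(t in `]0%R, +oo[) (heat nu b c t X)%:E <= (C * X `^ (b - nu))%:E)%E.
Proof.
move=> /andP[b0 bnu] c0; have nu0 : 0 < nu by exact: lt_trans bnu.
have sg s : 0 < s -> 0 < (1 - 2 `^ (- s))^-1 :> R.
  by move=> /lt1_two_powRN/andP[_ ?]; rewrite invr_gt0 subr_gt0.
have nb0 : 0 < nu - b by rewrite subr_gt0.
exists ((nu / c) `^ nu * (2 / (1 - 2 `^ (- b))) + (1 - 2 `^ (- (nu - b)))^-1).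
  by rewrite addr_gt0 ?mulr_gt0 ?powR_gt0 ?divr_gt0 ?sg.
move=> X X0; set K := (nu / c) `^ nu * X `^ (- nu).
have K0 : 0 <= K by rewrite mulr_ge0 ?powR_ge0.
pose g1 := ((fun t : R => (t `^ (b - 1))%:E) \_ `]0%R, X])%E.
pose g2 := ((fun t : R => (t `^ (- (nu - b) - 1))%:E) \_ `[X, +oo[)%E.
have mpow (a : R) (D : set R) : measurable_fun D (fun t : R => (t `^ a)%:E).
  by apply: measurable_funTS; apply/measurable_EFinP; exact: measurable_powR.
have g10 t : (0 <= g1 t)%E.
  by rewrite /g1 patchE; case: ifP => // _; rewrite lee_fin powR_ge0.
have g20 t : (0 <= g2 t)%E.
  by rewrite /g2 patchE; case: ifP => // _; rewrite lee_fin powR_ge0.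
have mg1 : measurable_fun [set: R] g1.
  by apply/(measurable_restrictT _ _).1 => //; exact: mpow.
have mg2 : measurable_fun [set: R] g2.
  by apply/(measurable_restrictT _ _).1 => //; exact: mpow.
have mD : measurable (`]0, +oo[%classic : set R) by exact: measurable_itv.
apply: (@le_trans _ _ (\int[leb1]_(t in `]0%R, +oo[) (K%:E * g1 t + g2 t))%E).
  apply: le_integral_ge0 => t; first by rewrite lee_fin heat_ge0.
  rewrite /= in_itv/= andbT => t0; have [tX|tX] := leP t X.
    apply: le_trans (leeDl _ (g20 _)).
    rewrite /g1 patchE mem_set; last by rewrite /= in_itv/= t0.
    by rewrite -EFinM lee_fin; exact: heat_le_below.
  apply: le_trans (leeDr _ _); last by rewrite mule_ge0 ?lee_fin.
  rewrite /g2 patchE mem_set; last by rewrite /= in_itv/= ltW.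
  by rewrite lee_fin; exact: heat_le_above.
rewrite ge0_integralD//; last 3 first.
- by move=> t _; rewrite mule_ge0 ?lee_fin.
- by apply: measurable_funeM; exact: measurable_funTS.
- exact: measurable_funTS.
rewrite ge0_integralZl_EFin//; last exact: measurable_funTS.
have i1 : (\int[leb1]_(t in `]0%R, +oo[) g1 t <=
     (2 * X `^ b / (1 - 2 `^ (- b)))%:E)%E.
  rewrite /g1 -integral_mkcondr setIidr; first exact: integral_powR_below.
  by move=> t /=; rewrite !in_itv/= => /andP[->].
have i2 : (\int[leb1]_(t in `]0%R, +oo[) g2 t <=
     (X `^ (- (nu - b)) / (1 - 2 `^ (- (nu - b))))%:E)%E.
  rewrite /g2 -integral_mkcondr setIidr; first exact: integral_powR_above.
  by move=> t /=; rewrite !in_itv/= !andbT; exact: lt_le_trans.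
apply: (@le_trans _ _ (K%:E * (2 * X `^ b / (1 - 2 `^ (- b)))%:E +
   (X `^ (- (nu - b)) / (1 - 2 `^ (- (nu - b))))%:E)%E).
  by apply: leeD => //; apply: lee_wpmul2l => //; rewrite lee_fin.
rewrite -EFinM -EFinD lee_fin /K le_eqVlt; apply/orP; left; apply/eqP.
have XE : X `^ (b - nu) = X `^ (- nu) * X `^ b.
  by rewrite -powRD ?(gt_eqF X0) ?implybT// addrC.
have -> : X `^ (- (nu - b)) = X `^ (b - nu) by rewrite opprB.
rewrite mulrDl XE; ring.
Qed.

End heat_kernel.

Section riesz_near.
Context {R : realType} (n : nat).
Local Notation Rn := (n.-tuple R).
Local Notation mu := (@leb R n).

(** Since s > 0, the shells where the distance is about r / 2^k contribute
(r / 2^k)^s each. The centre is removed because a negative power takes an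
arbitrary value at 0. *)
Lemma integral_riesz_near (s : R) : 0 < s < n%:R -> exists2 C : R, 0 < C &
  forall (y : Rn) (r : R), 0 < r ->
  (\int[mu]_(x in eball y r `\` [set x | eucl_dist y x = 0%R])
     ((eucl_dist y x) `^ (s - n%:R)%R)%:E <= (C * r `^ s)%:E)%E.
Proof.
move=> /andP[s0 sn].
have nn : (0 < n)%N by rewrite -(@ltr_nat R); exact: lt_trans sn.
exists (2 `^ (n%:R - s) * 4 ^+ n / (1 - 2 `^ (- s))).
  have /andP[_ h] := lt1_two_powRN s0.
  by rewrite divr_gt0 ?subr_gt0// mulr_gt0 ?powR_gt0 ?exprn_gt0.
move=> y r r0; have r2 k : 0 < r / 2 ^+ k by rewrite divr_gt0// exprn_gt0.
have m0 : measurable [set x : Rn | eucl_dist y x = 0].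
  rewrite (_ : [set x | _] = eucl_dist y @^-1` [set 0]); last by [].
  by rewrite -[X in measurable X]setTI; apply: measurable_eucl_dist.
apply: le_trans (@integral_cover_le_cst _ _ _ mu _
  (fun k => eball y (2 * (r / 2 ^+ k)))
  (fun k => (r / 2 ^+ k.+1) `^ (s - n%:R)) (fun k => (4 * (r / 2 ^+ k)) ^+ n) _ _ _ _ _ _ _) _.
- by apply: measurableD => //; exact: measurable_eball.
- by move=> k; exact: measurable_eball.
- by move=> x _; rewrite lee_fin powR_ge0.
- by move=> k; exact: powR_ge0.
- move=> k; apply: le_trans (leb_eball_le _ _) _; first by rewrite mulr_gt0.
  by rewrite lee_fin mulrA -natrM.
- move=> x [/= xr /eqP x0].
  have d0 : 0 < eucl_dist y x by rewrite lt_neqAle eq_sym x0 eucl_dist_ge0.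
  have [k /andP[k1 k2]] := dyadic_below d0 (ltW xr); exists k.
    by rewrite /eball/= (le_lt_trans k2)// ltr_pMl// ltr1n.
  rewrite lee_fin -(opprB n%:R) !powRN lef_pV2 ?posrE ?powR_gt0//.
  by apply: ge0_ler_powR; rewrite ?nnegrE ?subr_ge0 ?eucl_dist_ge0 ?(ltW (r2 _)) ?(ltW sn).
rewrite (eq_eseriesr (g := fun k => (2 `^ (n%:R - s) * 4 ^+ n * r `^ s * (2 `^ (- s)) ^+ k)%:E)); last first.
  move=> k _; congr EFin; rewrite -powR_two_expn exprMn.
  have -> : r / 2 ^+ k.+1 = (r / 2 ^+ k) * 2^-1 by rewrite exprS invfM mulrA mulrAC.
  set u := r / 2 ^+ k; have u0 : 0 < u by exact: r2.
  rewrite powRM ?(ltW u0)//.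
  have -> : (2^-1 : R) `^ (s - n%:R) = 2 `^ (n%:R - s).
    by rewrite -powR_inv1// -powRrM mulN1r opprB.
  have -> : u ^+ n = u `^ n%:R by rewrite powR_mulrn// ltW.
  have uE : r `^ s * (2 ^+ k) `^ (- s) = u `^ (s - n%:R) * u `^ n%:R.
    rewrite -powRD ?subrK// ?(gt_eqF u0) ?implybT//.
    rewrite /u powRM ?invr_ge0 ?exprn_ge0 ?(ltW r0)//; congr (_ * _).
    by rewrite -powR_inv1 ?exprn_ge0// -powRrM mulN1r.
  rewrite -[RHS]mulrA uE; ring.
rewrite geometric_eseries ?lt1_two_powRN//; last by rewrite !mulr_ge0 ?powR_ge0 ?exprn_ge0.
by rewrite lee_fin mulrAC.
Qed.

Lemma leb_dist0 (y : Rn) : (0 < n)%N -> mu [set x | eucl_dist y x = 0] = 0%E.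
Proof.
move=> n0; apply/eqP; rewrite eq_le measure_ge0 andbT.
have m0 : measurable [set x : Rn | eucl_dist y x = 0].
  rewrite (_ : [set x | _] = eucl_dist y @^-1` [set 0]); last by [].
  by rewrite -[X in measurable X]setTI; apply: measurable_eucl_dist.
apply/lee_addgt0Pr => e e0; rewrite add0e.
pose r := Num.min 1 e / 2.
have r0 : 0 < r by rewrite divr_gt0// lt_min ltr01.
apply: (@le_trans _ _ (mu (eball y r))).
  apply: le_measure; [by rewrite inE|by rewrite inE; exact: measurable_eball|].
  by move=> x; rewrite /eball/= => ->.
apply: le_trans (leb_eball_le y r0) _; rewrite lee_fin /r mulrCA mulfV// mulr1.
apply: (@le_trans _ _ (Num.min 1 e ^+ 1)); last by rewrite expr1 ge_min lexx orbT.
by apply: ler_wiXn2l; rewrite // ?ge_min ?lexx// le_min ler01 ltW.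
Qed.

End riesz_near.

(** * Real-valued integrals with parameters *)

Section Rintegral_facts.
Context d1 d2 (T1 : measurableType d1) (T2 : measurableType d2) (R : realType).

Lemma scale_sube (c : R) (A B : \bar R) : 0 <= c -> (0 <= A)%E -> (0 <= B)%E ->
  (c%:E * A - c%:E * B = c%:E * (A - B))%E.
Proof.
rewrite le_eqVlt => /predU1P[<-|c0]; first by rewrite !mul0e sube0.
case: A => [A| |]//; case: B => [B| |]// _ _; rewrite -?EFinM -?EFinB -?EFinM.
- by rewrite mulrBr.
- by rewrite !gt0_muley ?lte_fin//= gt0_muleNy ?lte_fin.
- by rewrite !gt0_muley ?lte_fin.
- by rewrite !gt0_muley ?lte_fin//= gt0_muleNy ?lte_fin.
Qed.

Lemma Rintegral_scale (m : {measure set T1 -> \bar R}) (g : T1 -> R) (c : R) :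
  measurable_fun setT g -> 0 <= c ->
  \int[m]_x (g x * c) = (\int[m]_x g x) * c.
Proof.
move=> mg c0; rewrite /Rintegral.
have mge : measurable_fun setT (EFin \o g) by exact/measurable_EFinP.
have -> : (\int[m]_x (g x * c)%:E = c%:E * \int[m]_x (g x)%:E)%E.
  have h : (fun x => (g x * c)%:E) = (fun x => c%:E * (EFin \o g) x)%E.
    by apply/funext => x; rewrite /= -EFinM mulrC.
  rewrite h integralE [X in _ = (_ * X)%E]integralE.
  rewrite ge0_funeposM// ge0_funenegM//.
  rewrite !ge0_integralZl_EFin//; last 2 first.
    exact: measurable_funeneg.
    exact: measurable_funepos.
  move: (\int[m]_x _)%E (integral_ge0 m (fun x (_ : setT x) => funepos_ge0 (EFin \o g) x)) => A A0.
  move: (\int[m]_x _)%E (integral_ge0 m (fun x (_ : setT x) => funeneg_ge0 (EFin \o g) x)) => B B0.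
  exact: scale_sube.
case: (\int[m]_x (g x)%:E)%E => [u| |]; first by rewrite -EFinM /= mulrC.
- move: c0; rewrite le_eqVlt => /predU1P[<-|c0]; first by rewrite mul0e mulr0.
  by rewrite gt0_muley ?lte_fin//= mul0r.
- move: c0; rewrite le_eqVlt => /predU1P[<-|c0]; first by rewrite mul0e mulr0.
  by rewrite gt0_muleNy ?lte_fin//= mul0r.
Qed.

(** The real-valued integral is a difference of integrals of positive parts, so
it is measurable in the parameter with no integrability assumption; this makes
the fractional power of any measurable function measurable. *)
Lemma measurable_Rintegral (m2 : {sigma_finite_measure set T2 -> \bar R})
    (g : T1 * T2 -> R) : measurable_fun setT g ->
  measurable_fun setT (fun x => \int[m2]_y g (x, y)).
Proof.
move=> mg; have mge : measurable_fun setT (EFin \o g) by exact/measurable_EFinP.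
apply: (measurableT_comp (fine_measurable measurableT)).
under eq_fun do rewrite integralE.
apply: emeasurable_funB.
  have := @measurable_fun_fubini_tonelli_F _ _ T1 T2 R m2 (EFin \o g)^\+%E
    (measurable_funepos mge) (fun z => funepos_ge0 _ _).
  congr (measurable_fun _ _); apply/funext => x; apply: eq_integral => y _.
  by rewrite !funeposE.
have := @measurable_fun_fubini_tonelli_F _ _ T1 T2 R m2 (EFin \o g)^\-%E
  (measurable_funeneg mge) (fun z => funeneg_ge0 _ _).
congr (measurable_fun _ _); apply/funext => x; apply: eq_integral => y _.
by rewrite !funenegE.
Qed.

Lemma Rfubini (m1 : {sigma_finite_measure set T1 -> \bar R})
    (m2 : {sigma_finite_measure set T2 -> \bar R}) (g : T1 * T2 -> R) :
  (m1 \x m2)%E.-integrable setT (EFin \o g) ->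
  \int[m1]_x (\int[m2]_y g (x, y)) = \int[(m1 \x m2)%E]_z g z.
Proof.
move=> ig; rewrite /Rintegral; congr fine.
rewrite -(integral12_prod_meas1 ig).
have mg : measurable_fun setT g by apply/measurable_EFinP; case/integrableP: ig.
apply: ae_eq_integral => //.
- by apply/measurable_EFinP; exact: measurable_Rintegral.
- by have /integrableP[] := integrable_fubini_F ig.
apply: filterS (ae_integrable1 ig) => x ix _.
rewrite /fubini_F /= fineK//.
exact: integrable_fin_num.
Qed.

End Rintegral_facts.

(** * Complex-valued functions and their integrals *)

Section complex_facts.
Context {R : realType}.
Implicit Types z u : R[i].

Lemma ReM z u : complex.Re (z * u) = complex.Re z * complex.Re u - complex.Im z * complex.Im u.
Proof. by case: z u => [a b] [c e]. Qed.

Lemma ImM z u : complex.Im (z * u) = complex.Re z * complex.Im u + complex.Im z * complex.Re u.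
Proof. by case: z u => [a b] [c e]. Qed.

Lemma ReD z u : complex.Re (z + u) = complex.Re z + complex.Re u.
Proof. by case: z u => [a b] [c e]. Qed.

Lemma ImD z u : complex.Im (z + u) = complex.Im z + complex.Im u.
Proof. by case: z u => [a b] [c e]. Qed.

Lemma ReN z : complex.Re (- z) = - complex.Re z. Proof. by case: z. Qed.

Lemma ImN z : complex.Im (- z) = - complex.Im z. Proof. by case: z. Qed.

Lemma complexP z u : complex.Re z = complex.Re u -> complex.Im z = complex.Im u -> z = u.
Proof. by case: z u => [a b] [c e] /= -> ->. Qed.

Lemma normcE2 z : normc z = Num.sqrt (complex.Re z ^+ 2 + complex.Im z ^+ 2).
Proof. by case: z. Qed.

Lemma normc_ge0 z : 0 <= normc z.
Proof. by rewrite normcE2 sqrtr_ge0. Qed.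

Lemma normRe_le z : `|complex.Re z| <= normc z.
Proof. by rewrite normcE2 -sqrtr_sqr ler_sqrt ?lerDl ?addr_ge0 ?sqr_ge0. Qed.

Lemma normIm_le z : `|complex.Im z| <= normc z.
Proof. by rewrite normcE2 -sqrtr_sqr ler_sqrt ?lerDr ?addr_ge0 ?sqr_ge0. Qed.

Lemma normc_le z : normc z <= `|complex.Re z| + `|complex.Im z|.
Proof.
rewrite normcE2 -[leRHS]ger0_norm ?addr_ge0// -sqrtr_sqr ler_sqrt ?sqr_ge0// sqrrD !real_normK ?num_real//.
by rewrite lerD2r lerDl mulrn_wge0// mulr_ge0.
Qed.

Lemma normc_real (c : R) : normc c%:C%C = `|c|.
Proof. by rewrite normcE2/= expr0n/= addr0 sqrtr_sqr. Qed.

Lemma normcMx z u : normc (z * u) = normc z * normc u.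
Proof. exact: ComplexField.Normc.normcM. Qed.

Lemma normcD_le z u : normc (z + u) <= normc z + normc u.
Proof. exact: le_normcD. Qed.

Lemma normc_opp z : normc (- z) = normc z.
Proof. by rewrite !normcE2 ReN ImN !sqrrN. Qed.

Lemma normcx0 : normc (0 : R[i]) = 0.
Proof. exact: ComplexField.Normc.normc0. Qed.

End complex_facts.

Section complex_measurability.
Context d (X : measurableType d) {R : realType}.
Implicit Types (D : set X) (f g : X -> R[i]).

Lemma cmeasurableM D f g : cmeasurable D f -> cmeasurable D g ->
  cmeasurable D (fun x => f x * g x).
Proof.
move=> [f1 f2] [g1 g2]; split.
  under eq_fun do rewrite ReM.
  by apply: measurable_funB; apply: measurable_funM.
under eq_fun do rewrite ImM.
by apply: measurable_funD; apply: measurable_funM.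
Qed.

Lemma cmeasurableD D f g : cmeasurable D f -> cmeasurable D g ->
  cmeasurable D (fun x => f x + g x).
Proof.
move=> [f1 f2] [g1 g2]; split.
  by under eq_fun do rewrite ReD; exact: measurable_funD.
by under eq_fun do rewrite ImD; exact: measurable_funD.
Qed.

Lemma cmeasurableB D f g : cmeasurable D f -> cmeasurable D g ->
  cmeasurable D (fun x => f x - g x).
Proof.
move=> [f1 f2] [g1 g2]; split.
  by under eq_fun do rewrite ReD ReN; exact: measurable_funB.
by under eq_fun do rewrite ImD ImN; exact: measurable_funB.
Qed.

Lemma cmeasurable_cst D (c : R[i]) : cmeasurable D (fun=> c).
Proof. by split; exact: measurable_cst. Qed.

Lemma cmeasurable_real D (h : X -> R) : measurable_fun D h ->
  cmeasurable D (fun x => (h x)%:C%C).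
Proof. by move=> mh; split => //; exact: measurable_cst. Qed.

Lemma cmeasurable_comp d' (Y : measurableType d') (h : Y -> X) f :
  measurable_fun setT h -> cmeasurable setT f -> cmeasurable setT (fun y => f (h y)).
Proof.
move=> mh [f1 f2]; split; first exact: (measurableT_comp f1 mh).
exact: (measurableT_comp f2 mh).
Qed.

Lemma cmeasurable_if (D : set X) f : measurable D -> cmeasurable D f ->
  cmeasurable setT (fun x => if x \in D then f x else 0).
Proof.
move=> mD [f1 f2].
have E (h : R[i] -> R) : h 0 = 0 ->
    (fun x => h (if x \in D then f x else 0)) = ((fun x => h (f x)) \_ D).
  by move=> h0; apply/funext => x; rewrite patchE; case: ifP.
by split; rewrite E//; apply/(measurable_restrictT _ _).1.
Qed.

Lemma measurable_normc D f : cmeasurable D f -> measurable_fun D (fun x => normc (f x)).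
Proof.
move=> [f1 f2]; under eq_fun do rewrite normcE2.
apply: (@measurableT_comp _ _ _ _ _ _ (@Num.sqrt R)).
  by apply: continuous_measurable_fun; exact: sqrt_continuous.
by apply: measurable_funD; exact: measurable_funX.
Qed.

End complex_measurability.

Section complex_integral.
Context d1 d2 (T1 : measurableType d1) (T2 : measurableType d2) {R : realType}.

Lemma cmeasurable_cintegral (m2 : {sigma_finite_measure set T2 -> \bar R})
    (H : T1 * T2 -> R[i]) : cmeasurable setT H ->
  cmeasurable setT (fun x => cintegral m2 setT (fun y => H (x, y))).
Proof.
move=> [h1 h2]; split => /=.
  exact: (@measurable_Rintegral _ _ _ _ _ m2 (fun z => complex.Re (H z))).
exact: (@measurable_Rintegral _ _ _ _ _ m2 (fun z => complex.Im (H z))).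
Qed.

(** The factor 2 comes from bounding the real and imaginary parts separately;
it avoids choosing a phase. *)
Lemma normc_cintegral_le (m : {measure set T1 -> \bar R}) (f : T1 -> R[i]) :
  cmeasurable setT f ->
  ((normc (cintegral m setT f))%:E <= 2%:E * \int[m]_x (normc (f x))%:E)%E.
Proof.
move=> [f1 f2].
have part (h : T1 -> R) : measurable_fun setT h -> (forall x, `|h x| <= normc (f x)) ->
    (`|\int[m]_x h x|%:E <= \int[m]_x (normc (f x))%:E)%E.
  move=> mh hf; apply: (@le_trans _ _ `|\int[m]_x (h x)%:E|%E).
    by rewrite /Rintegral; case: (\int[m]_x (h x)%:E)%E => [u| |]//=; rewrite normr0 leey.
  apply: le_trans (le_abse_integral _ _ _) _ => //; first exact/measurable_EFinP.
  by apply: le_integral_ge0 => x _ //=; rewrite lee_fin.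
apply: (@le_trans _ _ (`|\int[m]_x complex.Re (f x)|%:E + `|\int[m]_x complex.Im (f x)|%:E)%E).
  by rewrite -EFinD lee_fin; exact: normc_le.
rewrite [leRHS](_ : _ = \int[m]_x (normc (f x))%:E + \int[m]_x (normc (f x))%:E)%E; last first.
  move: (\int[m]_x (normc (f x))%:E)%E => [u| |]; rewrite ?gt0_muley ?gt0_muleNy ?lte_fin//.
  by rewrite -EFinM -EFinD mulr_natl mulr2n.
apply: leeD; apply: part => // x; [exact: normRe_le|exact: normIm_le].
Qed.

Lemma cintegrable_parts (m : {measure set T1 -> \bar R}) (f : T1 -> R[i]) :
  cmeasurable setT f -> (\int[m]_x (normc (f x))%:E < +oo)%E ->
  m.-integrable setT (EFin \o (fun x => complex.Re (f x))) /\
  m.-integrable setT (EFin \o (fun x => complex.Im (f x))).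
Proof.
move=> [f1 f2] foo; split; apply/integrableP; (split; first exact/measurable_EFinP);
  apply: le_lt_trans foo; apply: le_integral_ge0 => x _ //=; rewrite lee_fin.
  exact: normRe_le.
exact: normIm_le.
Qed.

Lemma cintegralD (m : {measure set T1 -> \bar R}) (f g : T1 -> R[i]) :
  cmeasurable setT f -> cmeasurable setT g ->
  (\int[m]_x (normc (f x))%:E < +oo)%E -> (\int[m]_x (normc (g x))%:E < +oo)%E ->
  cintegral m setT (fun x => f x + g x) = cintegral m setT f + cintegral m setT g.
Proof.
move=> mf mg /(cintegrable_parts mf)[f1 f2] /(cintegrable_parts mg)[g1 g2].
apply: complexP; rewrite ?ReD ?ImD /=.
  by under eq_Rintegral do rewrite ReD; rewrite RintegralD.
by under eq_Rintegral do rewrite ImD; rewrite RintegralD.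
Qed.

Lemma cintegralZ (m : {measure set T1 -> \bar R}) (c : R[i]) (f : T1 -> R[i]) :
  cmeasurable setT f -> (\int[m]_x (normc (f x))%:E < +oo)%E ->
  cintegral m setT (fun x => c * f x) = c * cintegral m setT f.
Proof.
move=> mf /(cintegrable_parts mf)[f1 f2].
have iZ (a : R) (h : T1 -> R) : m.-integrable setT (EFin \o h) ->
    m.-integrable setT (EFin \o (fun x => a * h x)).
  by move=> ih; have := integrableZl measurableT a ih.
apply: complexP; rewrite ?ReM ?ImM /=.
  under eq_Rintegral do rewrite ReM.
  by rewrite RintegralB// ?RintegralZl//; exact: iZ.
under eq_Rintegral do rewrite ImM.
by rewrite RintegralD// ?RintegralZl//; exact: iZ.
Qed.

End complex_integral.

(** * The fractional power as one absolutely convergent integral *)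

Section fractional.
Context {R : realType} (n : nat) (alpha : R).
Local Notation Rn := (n.-tuple R).
Local Notation Fn := (Rn -> R[i]).
Local Notation mu := (@leb R n).
Local Notation leb1 := (@lebesgue_measure R).
Variable P : R -> Rn -> Rn -> R[i].
Hypothesis mP : cmeasurable [set u : R * (Rn * Rn) | 0 < u.1]
  (fun u : R * (Rn * Rn) => P u.1 u.2.1 u.2.2).

(** The kernel is measurable on positive times only; the extension by 0 makes it
measurable on the whole product space. *)
Definition pos_kernel (u : R * (Rn * Rn)) : R[i] :=
  if u \in [set u : R * (Rn * Rn) | 0 < u.1] then P u.1 u.2.1 u.2.2 else 0.

(** The function of (t, y) whose iterated integral is the fractional power, up
to the factor 1 / Gamma(alpha / 2). *)
Definition integrand (f : Fn) (x : Rn) (z : R * Rn) : R[i] :=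
  pos_kernel (z.1, (x, z.2)) * f z.2 * ((z.1 `^ (- (alpha / 2) + 1))^-1)%:C%C.

Lemma cmeasurable_pos_kernel : cmeasurable setT pos_kernel.
Proof.
apply: cmeasurable_if => //.
rewrite (_ : [set u | _] = fst @^-1` `]0, +oo[%classic); last first.
  by apply/seteqP; split => u /=; rewrite in_itv/= andbT.
rewrite -[X in measurable X]setTI; exact: measurable_fst.
Qed.

Lemma cmeasurable_integrand2 f : cmeasurable setT f ->
  cmeasurable setT (fun u : Rn * (R * Rn) => integrand f u.1 u.2).
Proof.
move=> mf; apply: cmeasurableM; first apply: cmeasurableM.
- apply: (@cmeasurable_comp _ _ _ _ _ (fun u : Rn * (R * Rn) => (u.2.1, (u.1, u.2.2))));
    last exact: cmeasurable_pos_kernel.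
  apply/measurable_fun_pair; last apply/measurable_fun_pair => //.
    exact: (measurableT_comp measurable_fst measurable_snd).
  exact: (measurableT_comp measurable_snd measurable_snd).
- apply: (@cmeasurable_comp _ _ _ _ _ (fun u : Rn * (R * Rn) => u.2.2)) => //.
  exact: (measurableT_comp measurable_snd measurable_snd).
- apply: cmeasurable_real; under eq_fun do rewrite -powRN.
  apply: measurable_comp_powR.
  exact: (measurableT_comp measurable_fst measurable_snd).
Qed.

Lemma cmeasurable_integrand f x : cmeasurable setT f -> cmeasurable setT (integrand f x).
Proof.
move=> mf; apply: (@cmeasurable_comp _ _ _ _ _ (fun z : R * Rn => (x, z))
  (fun u : Rn * (R * Rn) => integrand f u.1 u.2)); last exact: cmeasurable_integrand2.
exact: measurable_pair1.
Qed.

Lemma fractional_powerE f x : cmeasurable setT f ->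
  fractional_power alpha P f x = ((Gamma (alpha / 2))^-1)%:C%C *
    cintegral leb1 setT (fun t => cintegral mu setT (fun y => integrand f x (t, y))).
Proof.
move=> mf; congr (_ * _).
have mPf t : 0 < t -> cmeasurable setT (fun y => pos_kernel (t, (x, y)) * f y).
  move=> t0; apply: cmeasurableM => //.
  apply: (@cmeasurable_comp _ _ _ _ _ (fun y : Rn => (t, (x, y))));
    last exact: cmeasurable_pos_kernel.
  by apply/measurable_fun_pair => //; exact: measurable_pair1.
have main t : 0 < t -> kernel_op (P t) f x * ((t `^ (- (alpha / 2) + 1))^-1)%:C%C =
    cintegral mu setT (fun y => integrand f x (t, y)).
  move=> t0; have [m1 m2] := mPf t t0.
  have c0 : 0 <= (t `^ (- (alpha / 2) + 1))^-1 by rewrite invr_ge0 powR_ge0.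
  have kE y : P t x y = pos_kernel (t, (x, y)) by rewrite /pos_kernel mem_set.
  rewrite /kernel_op /integrand; apply: complexP; rewrite ?ReM ?ImM /= mulr0 ?subr0 ?add0r.
    rewrite -Rintegral_scale//; last by under eq_fun do rewrite kE.
    by apply: eq_Rintegral => y _; rewrite kE [RHS]ReM /= mulr0 subr0.
  rewrite -Rintegral_scale//; last by under eq_fun do rewrite kE.
  by apply: eq_Rintegral => y _; rewrite kE [RHS]ImM /= mulr0 add0r.
have zero t : ~ 0 < t -> cintegral mu setT (fun y => integrand f x (t, y)) = 0.
  move=> /negP t0; rewrite (_ : (fun y => _) = fun=> 0); last first.
    apply/funext => y; rewrite /integrand /pos_kernel memNset ?mul0r//=.
    exact/negP.
  by apply: complexP; rewrite /= /Rintegral integral0.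
rewrite /cintegral; congr (Complex _ _); rewrite Rintegral_mkcond; apply: eq_Rintegral => t _;
  rewrite patchE; case: ifPn.
- by move=> tI; congr complex.Re; apply: main; move: tI; rewrite inE/= in_itv/= andbT.
- move=> /negP tI; have t0 : ~ 0 < t.
    by apply: contra_not tI; rewrite inE/= in_itv/= andbT.
  by move: (congr1 (@complex.Re R) (zero t t0)) => /= ->.
- by move=> tI; congr complex.Im; apply: main; move: tI; rewrite inE/= in_itv/= andbT.
- move=> /negP tI; have t0 : ~ 0 < t.
    by apply: contra_not tI; rewrite inE/= in_itv/= andbT.
  by move: (congr1 (@complex.Im R) (zero t t0)) => /= ->.
Qed.

Lemma cmeasurable_fractional_power f : cmeasurable setT f ->
  cmeasurable setT (fractional_power alpha P f).
Proof.
move=> mf; rewrite (funext (fun x => fractional_powerE x mf)).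
apply: cmeasurableM; first exact: cmeasurable_cst.
have m1 : cmeasurable setT (fun u : (Rn * R) * Rn => integrand f u.1.1 (u.1.2, u.2)).
  apply: (@cmeasurable_comp _ _ _ _ _ (fun u : (Rn * R) * Rn => (u.1.1, (u.1.2, u.2)))
    (fun u : Rn * (R * Rn) => integrand f u.1 u.2)); last exact: cmeasurable_integrand2.
  apply/measurable_fun_pair; last apply/measurable_fun_pair => //.
    exact: (measurableT_comp measurable_fst measurable_fst).
  exact: (measurableT_comp measurable_snd measurable_fst).
have m2 := cmeasurable_cintegral mu m1.
have m3 := cmeasurable_cintegral leb1 m2.
exact: m3.
Qed.

(** Where this is finite, the iterated integral is absolutely convergent and the
operator is linear; elsewhere the conventional values of divergent integrals
make linearity fail. *)
Definition abs_integral (f : Fn) (x : Rn) : \bar R :=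
  \int[(leb1 \x mu)%E]_z (normc (integrand f x z))%:E.

Lemma fractional_power_fubini f x : cmeasurable setT f -> (abs_integral f x < +oo)%E ->
  fractional_power alpha P f x = ((Gamma (alpha / 2))^-1)%:C%C *
    cintegral (leb1 \x mu)%E setT (integrand f x).
Proof.
move=> mf foo; rewrite fractional_powerE//; congr (_ * _).
have [i1 i2] := @cintegrable_parts _ _ _ (leb1 \x mu)%E _ (cmeasurable_integrand x mf) foo.
by apply: complexP => /=; rewrite -Rfubini.
Qed.

Lemma fractional_powerD f g x : cmeasurable setT f -> cmeasurable setT g ->
  (abs_integral f x < +oo)%E -> (abs_integral g x < +oo)%E ->
  fractional_power alpha P (fun y => f y + g y) x =
  fractional_power alpha P f x + fractional_power alpha P g x.
Proof.
move=> mf mg foo goo.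
have E : integrand (fun y => f y + g y) x = (fun z => integrand f x z + integrand g x z).
  by apply/funext => z; rewrite /integrand mulrDr mulrDl.
have mF := cmeasurable_integrand x mf; have mG := cmeasurable_integrand x mg.
rewrite !fractional_power_fubini//; last 2 first.
- exact: cmeasurableD.
- rewrite /abs_integral E.
  apply: (@le_lt_trans _ _ (abs_integral f x + abs_integral g x)%E); last exact: lte_add_pinfty.
  rewrite /abs_integral -ge0_integralD//; try by move=> *; rewrite lee_fin normc_ge0.
  + by apply: le_integral_ge0 => z _; rewrite lee_fin ?normc_ge0// normcD_le.
  + by apply/measurable_EFinP; exact: measurable_normc.
  + by apply/measurable_EFinP; exact: measurable_normc.
by rewrite -mulrDr -cintegralD// E.
Qed.

Lemma abs_integralZ (c : R[i]) f x : cmeasurable setT f ->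
  abs_integral (fun y => c * f y) x = ((normc c)%:E * abs_integral f x)%E.
Proof.
move=> mf; rewrite /abs_integral.
have E : (fun z => (normc (integrand (fun y => c * f y) x z))%:E) =
    (fun z => (normc c)%:E * (normc (integrand f x z))%:E)%E.
  by apply/funext => z; rewrite -EFinM -normcMx /integrand mulrCA !mulrA.
rewrite E ge0_integralZl_EFin// ?normc_ge0//; last first.
  by apply/measurable_EFinP/measurable_normc; exact: cmeasurable_integrand.
by move=> z _; rewrite lee_fin normc_ge0.
Qed.

Lemma fractional_powerZ (c : R[i]) f x : cmeasurable setT f ->
  (abs_integral f x < +oo)%E ->
  fractional_power alpha P (fun y => c * f y) x = c * fractional_power alpha P f x.
Proof.
move=> mf foo.
have E : integrand (fun y => c * f y) x = (fun z => c * integrand f x z).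
  by apply/funext => z; rewrite /integrand mulrCA !mulrA.
rewrite !fractional_power_fubini//; last 2 first.
- by apply: cmeasurableM => //; exact: cmeasurable_cst.
- by rewrite abs_integralZ// lte_mul_pinfty// lee_fin normc_ge0.
by rewrite E cintegralZ//; [rewrite mulrCA|exact: cmeasurable_integrand].
Qed.

Lemma normc_fractional_power_le : exists2 A : R, 0 < A &
  forall f x, cmeasurable setT f ->
  ((normc (fractional_power alpha P f x))%:E <= A%:E * abs_integral f x)%E.
Proof.
exists (`|(Gamma (alpha / 2))^-1| * 2 + 1); first by rewrite ltr_wpDl// mulr_ge0.
move=> f x mf.
have A0 : 0 < `|(Gamma (alpha / 2))^-1| * 2 + 1 by rewrite ltr_wpDl// mulr_ge0.
have I0 : (0 <= abs_integral f x)%E.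
  by apply: integral_ge0 => z _; rewrite lee_fin normc_ge0.
have [foo|] := ltP (abs_integral f x) +oo%E; last first.
  by rewrite leye_eq => /eqP ->; rewrite gt0_muley ?lte_fin// leey.
rewrite fractional_power_fubini// normcMx normc_real EFinM.
apply: (@le_trans _ _ (`|(Gamma (alpha / 2))^-1|%:E * (2%:E * abs_integral f x))%E).
  apply: lee_wpmul2l; first by rewrite lee_fin.
  by apply: normc_cintegral_le; exact: cmeasurable_integrand.
by rewrite muleA -EFinM; apply: lee_wpmul2r => //; rewrite lee_fin lerDl.
Qed.

End fractional.

(** * Riesz potentials near and far from a ball *)

Section potential.
Context {R : realType} (n : nat) (alpha : R).
Local Notation Rn := (n.-tuple R).
Local Notation Fn := (Rn -> R[i]).
Local Notation mu := (@leb R n).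
Local Notation leb1 := (@lebesgue_measure R).
Hypothesis an : 0 < alpha < n%:R.
Variable c : R.
Hypothesis c0 : 0 < c.

(** Comparable to |x - y|^(alpha - n) away from the diagonal. Keeping the time
integral makes measurability in (x, y) a consequence of that of the heat
kernel. *)
Definition riesz_kernel (x y : Rn) : \bar R :=
  \int[leb1]_(t in `]0%R, +oo[) (heat (n%:R / 2) (alpha / 2) c t (eucl_dist x y ^+ 2))%:E.

Definition potential (g : Rn -> R) (x : Rn) : \bar R :=
  \int[mu]_y ((g y)%:E * riesz_kernel x y)%E.

Lemma riesz_kernel_ge0 x y : (0 <= riesz_kernel x y)%E.
Proof. by apply: integral_ge0 => t _; rewrite lee_fin heat_ge0. Qed.

Lemma measurable_heat d (T : measurableType d) (t q : T -> R) (nu b : R) :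
  measurable_fun setT t -> measurable_fun setT q ->
  measurable_fun setT (fun x => heat nu b c (t x) (q x)).
Proof.
move=> mt mq; apply: measurable_funM; first apply: measurable_funM.
- exact: measurable_comp_powR.
- apply: (measurableT_comp (@measurable_expR R)); apply: measurableT_comp => //.
  apply: measurable_funM; last exact: measurable_comp_powR.
  exact: measurable_funM.
- exact: measurable_comp_powR.
Qed.

Lemma measurable_riesz_kernel2 :
  measurable_fun setT (fun u : Rn * Rn => riesz_kernel u.1 u.2).
Proof.
pose h (u : (Rn * Rn) * R) := (heat (n%:R / 2) (alpha / 2) c u.2 (eucl_dist u.1.1 u.1.2 ^+ 2) *
   \1_(`]0, +oo[%classic : set R) u.2)%:E.
have mh : measurable_fun setT h.
  apply/measurable_EFinP; apply: measurable_funM.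
    apply: measurable_heat; first exact: measurable_snd.
    apply: measurable_funX.
    exact: (measurableT_comp (@measurable_eucl_dist2 R n) measurable_fst).
  by apply: (measurableT_comp (measurable_indic (measurable_itv _)) measurable_snd).
have := @measurable_fun_fubini_tonelli_F _ _ _ _ R leb1 h mh.
have h0 u : (0 <= h u)%E by rewrite lee_fin mulr_ge0 ?heat_ge0// indicE.
move=> /(_ h0); congr (measurable_fun _ _); apply/funext => u.
rewrite /riesz_kernel integral_mkcond; apply: eq_integral => t _.
by rewrite /h patchE indicE /=; case: (_ \in _); rewrite ?mulr1 ?mulr0.
Qed.

Lemma measurable_riesz_kernel x : measurable_fun setT (riesz_kernel x).
Proof. exact: (measurableT_comp measurable_riesz_kernel2 (measurable_pair1 x)). Qed.

Lemma riesz_kernelC x y : riesz_kernel x y = riesz_kernel y x.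
Proof. by rewrite /riesz_kernel eucl_distC. Qed.

Lemma riesz_kernel_le : exists2 C : R, 0 < C & forall x y, 0 < eucl_dist x y ->
  (riesz_kernel x y <= (C * eucl_dist x y `^ (alpha - n%:R))%:E)%E.
Proof.
have := @integral_heat_le R (n%:R / 2) (alpha / 2) c.
have -> : 0 < alpha / 2 < n%:R / 2.
  by case/andP: an => a0 a1; rewrite divr_gt0//= ltr_pM2r.
move=> /(_ isT c0)[C C0 h]; exists C => // x y d0.
apply: le_trans (h _ _) _; first by rewrite exprn_gt0.
rewrite lee_fin -powR_mulrn ?(ltW d0)// -powRrM.
by have -> : 2 * (alpha / 2 - n%:R / 2) = alpha - n%:R by lra.
Qed.

Lemma measurable_potential_fun (g : Rn -> R) x : measurable_fun setT g ->
  measurable_fun setT (fun y => (g y)%:E * riesz_kernel x y)%E.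
Proof.
move=> mg; apply: emeasurable_funM; first exact/measurable_EFinP.
exact: measurable_riesz_kernel.
Qed.

(** If x is in B(a, r) and y is outside B(a, 2 r), then |x - y| is at least half
of |a - y|; on the shell where |a - y| is about 2^(k+1) r, the kernel is thus
of order (2^(k+1) r)^(alpha - n). *)
Lemma potential_tail : exists2 C : R, 0 < C &
  forall (a x : Rn) (r : R) (g : Rn -> R), 0 < r -> eball a r x ->
  measurable_fun setT g -> (forall y, 0 <= g y) ->
  (forall y, eball a (2 * r) y -> g y = 0) ->
  (potential g x <= \sum_(0 <= k <oo) ((C * (2 * r * 2 ^+ k) `^ (alpha - n%:R))%:E *
      \int[mu]_(y in eball a (2 * r * 2 ^+ k.+1)) (g y)%:E))%E.
Proof.
have [C C0 hC] := riesz_kernel_le.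
have ga : 0 < n%:R - alpha by case/andP: an => *; rewrite subr_gt0.
exists (C * 2 `^ (n%:R - alpha)); first by rewrite mulr_gt0 ?powR_gt0.
move=> a x r g r0 xr mg g0 gz.
have r2 : 0 < 2 * r by rewrite mulr_gt0.
have X2 k : 0 < 2 * r * 2 ^+ k by rewrite mulr_gt0 ?exprn_gt0.
apply: le_trans (@integral_cover_le _ _ _ mu setT
  (fun k => eball a (2 * r * 2 ^+ k.+1))
  (fun k => C * 2 `^ (n%:R - alpha) * (2 * r * 2 ^+ k) `^ (alpha - n%:R))
  (fun y => (g y)%:E * riesz_kernel x y)%E (fun y => (g y)%:E) _ _ _ _ _ _ _) _.
- exact: measurableT.
- by move=> k; exact: measurable_eball.
- exact/measurable_EFinP.
- by move=> y _; rewrite lee_fin.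
- by move=> y _; rewrite mule_ge0 ?lee_fin// riesz_kernel_ge0.
- by move=> k; rewrite !mulr_ge0 ?powR_ge0// ltW.
- move=> y _; have [ay|ay] := ltP (eucl_dist a y) (2 * r).
    exists 0%N.
      by rewrite /eball/= (lt_le_trans ay)// ler_peMr ?(ltW r2)// expr1 ler1n.
    by rewrite gz// mul0e mule0.
  have [k /andP[k1 k2]] := dyadic_above r2 ay; exists k => //.
  rewrite muleC; apply: lee_wpmul2r; first by rewrite lee_fin.
  have ay0 : 0 < eucl_dist a y by exact: lt_le_trans ay.
  have xy : eucl_dist a y / 2 <= eucl_dist x y.
    rewrite -(@ler_pXn2r _ 2)// ?nnegrE ?eucl_dist_ge0//; last by rewrite divr_ge0// ltW.
    have h1 := eucl_dist_quasi a x y.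
    have h2 : eucl_dist a x ^+ 2 <= (eucl_dist a y / 2) ^+ 2.
      rewrite ler_pXn2r// ?nnegrE ?eucl_dist_ge0 ?divr_ge0 ?(ltW ay0)//.
      by rewrite ler_pdivlMr// mulrC (le_trans _ ay)// ler_pM2l// ltW.
    move: h1 h2; rewrite expr_div_n; lra.
  have xy0 : 0 < eucl_dist x y by apply: lt_le_trans xy; rewrite divr_gt0.
  apply: (le_trans (hC _ _ xy0)); rewrite lee_fin -mulrA ler_wpM2l ?(ltW C0)//.
  have -> : 2 `^ (n%:R - alpha) = 2^-1 `^ (alpha - n%:R) :> R.
    by rewrite -powR_inv1// -powRrM mulN1r opprB.
  rewrite -powRM ?invr_ge0 ?(ltW (X2 _))//.
  rewrite -(opprB n%:R) !powRN lef_pV2 ?posrE ?powR_gt0 ?mulr_gt0 ?invr_gt0 ?exprn_gt0//.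
  apply: ge0_ler_powR; rewrite ?nnegrE ?eucl_dist_ge0 ?(ltW ga)//.
    by rewrite mulr_ge0 ?invr_ge0// ltW.
  by apply: le_trans xy; rewrite mulrC ler_pM2r.
by under [X in (X <= _)%E]eq_eseriesr do rewrite setTI.
Qed.

(** By Tonelli the integral of the potential over B(a, r) is the integral of g
against the integrals of the kernel over B(a, r), which are bounded because the
kernel is locally integrable, uniformly in its pole. *)
Lemma potential_near (a : Rn) (r : R) (g : Rn -> R) : 0 < r ->
  measurable_fun setT g -> (forall y, 0 <= g y) ->
  (forall y, ~ eball a (2 * r) y -> g y = 0) ->
  (\int[mu]_y (g y)%:E < +oo)%E ->
  {ae mu, forall x, eball a r x -> (potential g x < +oo)%E}.
Proof.
move=> r0 mg g0 gz gfin.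
have nn : (0 < n)%N by case/andP: an => a0 a1; rewrite -(@ltr_nat R); exact: lt_trans a0 a1.
have [C C0 hC] := riesz_kernel_le; have [C' C'0 hC'] := @integral_riesz_near R n alpha an.
have mB := @measurable_eball R n a r.
have inner y : eball a (2 * r) y ->
    (\int[mu]_(x in eball a r) riesz_kernel x y <= (C * (C' * (4 * r) `^ alpha))%:E)%E.
  move=> ay.
  have sub : eball a r `<=` eball y (4 * r).
    move=> x ax; rewrite /eball/=.
    rewrite -(@ltr_pXn2r _ 2)// ?nnegrE ?eucl_dist_ge0//; last by rewrite mulr_ge0// ltW.
    apply: le_lt_trans (eucl_dist_quasi y a x) _.
    have h1 : eucl_dist y a ^+ 2 < (2 * r) ^+ 2.
      by rewrite eucl_distC ltr_pXn2r// nnegrE ?eucl_dist_ge0 ?mulr_ge0 ?(ltW r0).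
    have h2 : eucl_dist a x ^+ 2 < r ^+ 2.
      by rewrite ltr_pXn2r// nnegrE ?eucl_dist_ge0 ?(ltW r0).
    have := sqr_ge0 r; move: h1 h2; rewrite !exprMn; lra.
  have m0 : measurable [set x : Rn | eucl_dist y x = 0].
    rewrite (_ : [set x | _] = eucl_dist y @^-1` [set 0]); last by [].
    by rewrite -[X in measurable X]setTI; apply: measurable_eucl_dist.
  have mB4 := @measurable_eball R n y (4 * r).
  have mk D : measurable_fun D (fun x => riesz_kernel x y).
    apply: measurable_funTS; under eq_fun do rewrite riesz_kernelC.
    exact: measurable_riesz_kernel.
  have k0 D x : D x -> (0 <= riesz_kernel x y)%E by move=> _; exact: riesz_kernel_ge0.
  apply: (@le_trans _ _ (\int[mu]_(x in eball y (4 * r)) riesz_kernel x y)%E).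
    by apply: ge0_subset_integral => //; exact: k0.
  rewrite (ge0_negligible_integral m0 mB4 (mk _) (k0 _) (leb_dist0 y nn)).
  have mD : measurable (eball y (4 * r) `\` [set x | eucl_dist y x = 0]).
    exact: measurableD.
  apply: (@le_trans _ _ (\int[mu]_(x in eball y (4 * r) `\` [set x | eucl_dist y x = 0%R])
     (C%:E * ((eucl_dist y x) `^ (alpha - n%:R)%R)%:E))%E).
    apply: le_integral_ge0 => x [_ /eqP x0]; first exact: riesz_kernel_ge0.
    rewrite riesz_kernelC -EFinM; apply: hC.
    by rewrite lt_neqAle eq_sym x0 eucl_dist_ge0.
  rewrite ge0_integralZl_EFin//; last 3 first.
  - by move=> x _; rewrite lee_fin powR_ge0.
  - apply: measurable_funTS; apply/measurable_EFinP; apply: measurable_comp_powR.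
    exact: measurable_eucl_dist.
  - exact: ltW.
  rewrite EFinM; apply: lee_wpmul2l; first by rewrite lee_fin ltW.
  by apply: hC'; rewrite mulr_gt0.
pose h (u : Rn * Rn) := ((g u.2 * \1_(eball a r) u.1)%:E * riesz_kernel u.1 u.2)%E.
have mh : measurable_fun setT h.
  apply: emeasurable_funM; last exact: measurable_riesz_kernel2.
  apply/measurable_EFinP; apply: measurable_funM.
    exact: (measurableT_comp mg measurable_snd).
  exact: (measurableT_comp (measurable_indic mB) measurable_fst).
have h0 u : (0 <= h u)%E.
  by rewrite mule_ge0 ?riesz_kernel_ge0// lee_fin mulr_ge0 ?g0// indicE.
have fub := @fubini_tonelli _ _ _ _ R mu mu h mh h0.
have mF := @measurable_fun_fubini_tonelli_F _ _ _ _ R mu h mh h0.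
have fin : (\int[mu]_x fubini_F mu h x < +oo)%E.
  rewrite /fubini_F fub.
  apply: (@le_lt_trans _ _ (\int[mu]_y ((C * (C' * (4 * r) `^ alpha))%:E * (g y)%:E))%E).
    apply: le_integral_ge0 => y _; first exact: integral_ge0.
    have E : (\int[mu]_x h (x, y) = (g y)%:E * \int[mu]_(x in eball a r) riesz_kernel x y)%E.
      have mk : measurable_fun (eball a r) (fun x => riesz_kernel x y).
        apply: measurable_funTS; under eq_fun do rewrite riesz_kernelC.
        exact: measurable_riesz_kernel.
      rewrite -(@ge0_integralZl_EFin _ _ _ mu _ mB _ (fun x _ => riesz_kernel_ge0 x y) mk _ (g0 y)).
      rewrite [RHS]integral_mkcond; apply: eq_integral => x _.
      by rewrite /h patchE indicE /=; case: (_ \in _); rewrite ?mulr1 ?mulr0 ?mul0e.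
    rewrite E muleC; have [ay|ay] := pselect (eball a (2 * r) y).
      by apply: lee_wpmul2r; [rewrite lee_fin|exact: inner].
    rewrite (gz y ay) !mule0; exact: lexx.
  have K0 : 0 <= C * (C' * (4 * r) `^ alpha).
    apply: mulr_ge0; [exact: ltW|apply: mulr_ge0; [exact: ltW|exact: powR_ge0]].
  have mge : measurable_fun setT (fun y => (g y)%:E) by exact/measurable_EFinP.
  have ge0 y : [set: Rn] y -> (0 <= (g y)%:E)%E by move=> _; rewrite lee_fin.
  rewrite (@ge0_integralZl_EFin _ _ _ mu _ measurableT _ ge0 mge _ K0).
  by rewrite lte_mul_pinfty// lee_fin.
have iF : mu.-integrable setT (fubini_F mu h).
  apply/integrableP; split; first exact: mF.
  have absE : (fun x => `|fubini_F mu h x|%E) = fubini_F mu h.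
    apply/funext => x; apply: gee0_abs; apply: integral_ge0 => y _; exact: h0.
  by rewrite absE; exact: fin.
apply: filterS (integrable_ae measurableT iF) => x /(_ I) hx ax.
have -> : potential g x = fubini_F mu h x.
  by apply: eq_integral => y _; rewrite /h /= indicE (mem_set ax) mulr1.
by rewrite ltey_eq hx.
Qed.

End potential.

(** * The Gaussian bound *)

Section gaussian.
Context {R : realType} (n : nat) (alpha : R).
Local Notation Rn := (n.-tuple R).
Local Notation Fn := (Rn -> R[i]).
Local Notation mu := (@leb R n).
Local Notation leb1 := (@lebesgue_measure R).
Variable P : R -> Rn -> Rn -> R[i].
Hypothesis mP : cmeasurable [set u : R * (Rn * Rn) | 0 < u.1]
  (fun u : R * (Rn * Rn) => P u.1 u.2.1 u.2.2).
Variables C c : R.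
Hypotheses (C0 : 0 < C) (c0 : 0 < c).
Hypothesis gaussP : forall t x y, 0 < t -> normc (P t x y) <=
  C * t `^ (- (n%:R / 2)) * expR (- (c * eucl_dist x y ^+ 2 / t)).

Lemma normc_integrand_le (f : Fn) x (z : R * Rn) : normc (integrand alpha P f x z) <=
  (C * normc (f z.2)) * (heat (n%:R / 2) (alpha / 2) c z.1 (eucl_dist x z.2 ^+ 2) *
     \1_(`]0, +oo[%classic : set R) z.1).
Proof.
case: z => t y /=; rewrite /integrand /= /pos_kernel.
have [t0|t0] := ltP 0 t; last first.
  rewrite memNset/=; last by rewrite ltNge t0.
  rewrite !mul0r normcx0; apply: mulr_ge0; first by rewrite mulr_ge0 ?normc_ge0 ?(ltW C0).
  by rewrite mulr_ge0 ?heat_ge0.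
rewrite mem_set//= indicE mem_set ?mulr1; last by rewrite /= in_itv/= t0.
rewrite !normcMx normc_real ger0_norm ?invr_ge0 ?powR_ge0//.
have -> : (t `^ (- (alpha / 2) + 1))^-1 = t `^ (alpha / 2 - 1).
  by rewrite -powRN opprD opprK.
have gp := gaussP x y t0; rewrite /heat.
move: (eucl_dist x y ^+ 2) (_ `^ (- (n%:R / 2))) gp => q v gp.
rewrite !mulrA ler_wpM2r ?powR_ge0//.
have -> : C * normc (f y) * v * expR (- (c * q * t `^ (-1)))
  = C * v * expR (- (c * q * t `^ (-1))) * normc (f y) by ring.
by rewrite ler_wpM2r ?normc_ge0// powR_inv1 ?(ltW t0).
Qed.

Lemma abs_integral_le (f : Fn) x : cmeasurable setT f ->
  (abs_integral alpha P f x <= C%:E * potential alpha c (fun y => normc (f y)) x)%E.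
Proof.
move=> mf.
pose H (z : R * Rn) := ((C * normc (f z.2)) *
   (heat (n%:R / 2) (alpha / 2) c z.1 (eucl_dist x z.2 ^+ 2) *
     \1_(`]0, +oo[%classic : set R) z.1))%:E.
have mI : measurable (`]0, +oo[%classic : set R) by exact: measurable_itv.
have mnf : measurable_fun setT (fun y => normc (f y)) by exact: measurable_normc.
have md : measurable_fun setT (fun y => eucl_dist x y ^+ 2).
  by apply: measurable_funX; exact: measurable_eucl_dist.
have mH : measurable_fun setT H.
  apply/measurable_EFinP; apply: measurable_funM.
    apply: measurable_funM; first exact: measurable_cst.
    exact: (measurableT_comp mnf measurable_snd).
  apply: measurable_funM.
    apply: measurable_heat; first exact: measurable_fst.
    exact: (measurableT_comp md measurable_snd).
  exact: (measurableT_comp (measurable_indic mI) measurable_fst).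
have H0 z : (0 <= H z)%E.
  rewrite lee_fin; apply: mulr_ge0; first by rewrite mulr_ge0 ?normc_ge0 ?(ltW C0).
  by rewrite mulr_ge0 ?heat_ge0// indicE.
apply: (@le_trans _ _ (\int[(leb1 \x mu)%E]_z H z)%E).
  apply: le_integral_ge0 => z _; first by rewrite lee_fin normc_ge0.
  by rewrite lee_fin; exact: normc_integrand_le.
have fub := @fubini_tonelli2 _ _ _ _ R leb1 mu H mH H0.
rewrite fub.
have GE y : fubini_G leb1 H y = (C%:E * ((normc (f y))%:E * riesz_kernel alpha c x y))%E.
  have k0 : 0 <= C * normc (f y) by rewrite mulr_ge0 ?normc_ge0 ?(ltW C0).
  have mh : measurable_fun setT (fun t => (heat (n%:R / 2) (alpha / 2) c t (eucl_dist x y ^+ 2) *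
     \1_(`]0, +oo[%classic : set R) t)%:E).
    apply/measurable_EFinP; apply: measurable_funM; last exact: measurable_indic.
    by apply: measurable_heat; [exact: measurable_id|exact: measurable_cst].
  have h0 t : [set: R] t -> (0 <= (heat (n%:R / 2) (alpha / 2) c t (eucl_dist x y ^+ 2) *
     \1_(`]0, +oo[%classic : set R) t)%:E)%E.
    by move=> _; rewrite lee_fin mulr_ge0 ?heat_ge0// indicE.
  transitivity (\int[leb1]_t ((C * normc (f y))%:E *
      (heat (n%:R / 2) (alpha / 2) c t (eucl_dist x y ^+ 2) *
       \1_(`]0%R, +oo[%classic : set R) t)%:E))%E.
    by apply: eq_integral => t _; rewrite -EFinM.
  rewrite (@ge0_integralZl_EFin _ _ _ leb1 _ measurableT _ h0 mh _ k0).
  rewrite muleA -EFinM; congr (_ * _)%E.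
  rewrite /riesz_kernel [RHS]integral_mkcond; apply: eq_integral => t _.
  by rewrite patchE indicE /=; case: (_ \in _); rewrite ?mulr1 ?mulr0.
rewrite (eq_integral (fun y => C%:E * ((normc (f y))%:E * riesz_kernel alpha c x y))%E);
  last by move=> y _; exact: GE.
have p0 y : [set: Rn] y -> (0 <= (normc (f y))%:E * riesz_kernel alpha c x y)%E.
  by move=> _; apply: mule_ge0; [rewrite lee_fin normc_ge0|exact: riesz_kernel_ge0].
rewrite (@ge0_integralZl_EFin _ _ _ mu _ measurableT _ p0
  (measurable_potential_fun _ _ _ mnf) _ (ltW C0)).
exact: lexx.
Qed.

End gaussian.

(** * Exponents and positivity *)

Section positivity.
Context d (T : measurableType d) (R : realType) (mu : {measure set T -> \bar R}).
Local Open Scope ereal_scope.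

(** Balls have positive mass for every power of a weight, since weights are
positive almost everywhere. *)
Lemma ae_integral_gt0 (E : set T) (h : T -> R) : measurable E -> 0 < mu E ->
  measurable_fun setT h -> (forall x, 0 <= h x)%R -> {ae mu, forall x, (0 < h x)%R} ->
  0 < \int[mu]_(x in E) (h x)%:E.
Proof.
move=> mE E0 mh h0 hpos.
have I0 : 0 <= \int[mu]_(x in E) (h x)%:E by apply: integral_ge0 => x _; rewrite lee_fin.
rewrite lt_neqAle I0 andbT eq_sym; apply/eqP => I00.
have mhE : measurable_fun E (EFin \o h) by apply: measurable_funTS; exact/measurable_EFinP.
have [+ _] := ae_eq_integral_abs mu mE mhE.
have -> : (fun x => `|(EFin \o h) x|) = (fun x => (h x)%:E).
  by apply/funext => x; rewrite /= ger0_norm.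
move=> /(_ I00) hz.
have : mu.-negligible E.
  have : {ae mu, forall x, ~ E x}.
    apply: filterS2 hz hpos => x hx hp Ex.
    by have /(congr1 fine)/= h00 := hx Ex; rewrite h00 ltxx in hp.
  move=> [N [mN N0 sN]]; exists N; split => // x Ex; apply: sN => /=; exact.
by move/(negligibleP mu mE) => E00; rewrite E00 ltxx in E0.
Qed.

End positivity.

(** The A_(p,q) condition bounds a product, and the positivity of one factor
makes the other finite. *)
Lemma poweR_prod_fin (R : realType) (x y : \bar R) (a b C : R) :
  0 < a -> 0 < b -> (0 < x)%E -> (0 < y)%E -> (x `^ a * y `^ b <= C%:E)%E ->
  x \is a fin_num /\ y \is a fin_num.
Proof.
move=> a0 b0 x0 y0 h; split; rewrite ge0_fin_numE ?ltW// ltey; apply/eqP => E;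
  move: h; rewrite E poweRyr ?gt_eqF//.
  by rewrite gt0_mulye ?poweR_gt0// leye_eq.
by rewrite gt0_muley ?poweR_gt0// leye_eq.
Qed.

Section exponents.
Context {R : realType} (n : nat) (alpha p q : R).
Hypotheses (an : 0 < alpha < n%:R) (hp : 1 <= p < n%:R / alpha)
  (hq : q^-1 = p^-1 - alpha / n%:R).

Lemma natR_gt0 : 0 < n%:R :> R.
Proof. by case/andP: an => a b; exact: lt_trans b. Qed.

Lemma p_gt0 : 0 < p.
Proof. by case/andP: hp => h _; exact: lt_le_trans h. Qed.

Lemma qV_gt0 : 0 < q^-1.
Proof.
case/andP: an => a0 _; case/andP: hp => p1 pn.
rewrite hq subr_gt0 ltr_pdivrMr ?natR_gt0// mulrC -ltr_pdivrMr//.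
  by rewrite invrK mulrC -ltr_pdivlMr.
by rewrite invr_gt0 p_gt0.
Qed.

Lemma q_gt0 : 0 < q.
Proof. by rewrite -invr_gt0 qV_gt0. Qed.

Lemma qV_lt_pV : q^-1 < p^-1.
Proof.
by case/andP: an => a0 _; rewrite hq ltrBlDr ltrDl divr_gt0// natR_gt0.
Qed.

End exponents.

(** * The A_(p,q) condition in power form *)

Section weights.
Context {R : realType} (n : nat) (alpha p q : R).
Local Notation Rn := (n.-tuple R).
Local Notation mu := (@leb R n).
Hypotheses (an : 0 < alpha < n%:R) (hp : 1 <= p < n%:R / alpha)
  (hq : q^-1 = p^-1 - alpha / n%:R).

Let n0 := natR_gt0 an.
Let p0 := p_gt0 hp.
Let q0 := q_gt0 an hp hq.

Lemma measurable_wpow (w : Rn -> R) c : is_weight w -> measurable_fun setT (wpow w c).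
Proof. by move=> [mw _ _ _]; exact: measurable_comp_powR. Qed.

Lemma wmeas_wpow_gt0 (w : Rn -> R) c a r : is_weight w -> 0 < r ->
  (0 < wmeas (wpow w c) (eball a r))%E.
Proof.
move=> ww r0; apply: ae_integral_gt0.
- exact: measurable_eball.
- exact: leb_eball_gt0.
- exact: measurable_wpow.
- by move=> x; exact: powR_ge0.
- by case: ww => _ _ _; apply: filterS => x; exact: powR_gt0.
Qed.

Lemma wmeas_ge0 (w : Rn -> R) E : (forall x, 0 <= w x) -> (0 <= wmeas w E)%E.
Proof. by move=> w0; apply: integral_ge0 => x _; rewrite lee_fin. Qed.

Lemma leb_eballE (a : Rn) r : 0 < r -> exists2 V : R, mu (eball a r) = V%:E &
  (2 * (r / n.+1%:R)) ^+ n <= V <= (2 * r) ^+ n.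
Proof.
move=> r0; exists (fine (mu (eball a r))); first by rewrite fineK// leb_eball_fin.
by rewrite -!lee_fin fineK ?leb_eball_fin// leb_eball_ge// leb_eball_le.
Qed.

Lemma powR_nat_exp (x b : R) : 0 <= x -> (x ^+ n) `^ b = x `^ (n%:R * b).
Proof. by move=> x0; rewrite -powR_mulrn// -powRrM. Qed.

(** The A_(p,q) condition with the averages replaced by masses. The powers of
the volume of the ball combine into r^(n - alpha), as
1/q + 1/p' = 1 - alpha/n. *)
Definition power_bound (C : R) (v1 v2 : Rn -> R) := forall (a : Rn) (r : R), 0 < r ->
  wmeas (wpow v2 q) (eball a r) \is a fin_num /\
  wmeas (wpow v1 (- conj_exp p)) (eball a r) \is a fin_num /\
  (wmeas (wpow v2 q) (eball a r) `^ q^-1 *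
   wmeas (wpow v1 (- conj_exp p)) (eball a r) `^ (conj_exp p)^-1
   <= (C * r `^ (n%:R - alpha))%:E)%E.

Section pair.
Variables (s : R) (v1 v2 : Rn -> R).
Hypotheses (wv1 : is_weight v1) (wv2 : is_weight v2).

(** The hypothesis controls the average of v1^(- s (p/s)'), where
s (p/s)' = s p / (p - s) >= p' because s >= 1; Jensen lowers this exponent to
p'. *)
Lemma Apq_power_bound : 1 < p -> 1 <= s < p ->
  Apq (p / s) (q / s) (wpow v1 s) (wpow v2 s) -> exists2 C : R, 0 < C & power_bound C v1 v2.
Proof.
move=> p1 /andP[s1 sp] [C hC].
have s0 : 0 < s by exact: lt_le_trans s1.
have ps1 : p / s != 1.
  by apply/eqP => /(congr1 (fun x => x * s)); rewrite divfK ?gt_eqF// mul1r => E; rewrite E ltxx in sp.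
rewrite (negbTE ps1) in hC.
pose P' := conj_exp (p / s).
have P'V : P'^-1 = 1 - s / p by rewrite /P' /conj_exp invrK invf_div.
have P'V0 : 0 < P'^-1 by rewrite P'V subr_gt0 ltr_pdivrMr// mul1r.
have P'0 : 0 < P' by rewrite -invr_gt0.
pose p' := conj_exp p.
have p'V : p'^-1 = 1 - p^-1 by rewrite /p' /conj_exp invrK.
have p'V0 : 0 < p'^-1 by rewrite p'V subr_gt0 invf_lt1.
have p'0 : 0 < p' by rewrite -invr_gt0.
pose e := (s * P')^-1.
have e0 : 0 < e by rewrite invr_gt0 mulr_gt0.
have eE : e = s^-1 - p^-1.
  by rewrite /e invfM P'V mulrBr mulr1 mulrA mulVf ?gt_eqF// mul1r.
have ep : e <= p'^-1 by rewrite eE p'V lerD2r invf_le1.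
(* the exponent for Jensen: the ratio of p' to s (p/s)' *)
pose th := e * p'.
have th01 : 0 < th <= 1.
  by rewrite /th mulr_gt0//= -(ler_pM2r p'V0) mul1r -mulrA mulfV ?gt_eqF// mulr1.
pose K := `|C| `^ s^-1 + 1.
have K0 : 0 < K by rewrite ltr_wpDl ?powR_ge0.
have beta : q^-1 + p'^-1 = 1 - alpha / n%:R by rewrite hq p'V; ring.
have beta0 : 0 < q^-1 + p'^-1 by rewrite addr_gt0// invr_gt0.
exists (K * 2 `^ (n%:R - alpha)); first by rewrite mulr_gt0// powR_gt0.
move=> a r r0; have {hC} := hC a r r0.
have [V VE /andP[_ Vle]] := leb_eballE a r0.
have V0 : 0 < V by have := leb_eball_gt0 a r0; rewrite VE lte_fin.
rewrite /avg VE inver gt_eqF//.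
have -> : wpow (wpow v2 s) (q / s) = wpow v2 q.
  by apply/funext => x; rewrite /wpow -powRrM mulrC divfK// gt_eqF.
have -> : wpow (wpow v1 s) (- conj_exp (p / s)) = wpow v1 (- (s * P')).
  by apply/funext => x; rewrite /wpow -powRrM mulrN.
rewrite -!/(wmeas _ _).
have U0 := wmeas_wpow_gt0 q a wv2 r0.
have S0 := wmeas_wpow_gt0 (- (s * P')) a wv1 r0.
have V'0 : (0 < V^-1%:E)%E by rewrite lte_fin invr_gt0.
move=> hC.
have qs0 : 0 < (q / s)^-1 by rewrite invr_gt0 divr_gt0.
have [fU fS] : wmeas (wpow v2 q) (eball a r) \is a fin_num /\
    wmeas (wpow v1 (- (s * P'))) (eball a r) \is a fin_num.
  have [f1 f2] := poweR_prod_fin qs0 P'V0 (mule_gt0 V'0 U0) (mule_gt0 V'0 S0) hC.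
  split.
    rewrite (ge0_fin_numE (ltW U0)) ltey; apply/eqP => E.
    by rewrite E (gt0_muley V'0) in f1.
  rewrite (ge0_fin_numE (ltW S0)) ltey; apply/eqP => E.
  by rewrite E (gt0_muley V'0) in f2.
have jen : (wmeas (wpow v1 (- p')) (eball a r) <=
    wmeas (wpow v1 (- (s * P'))) (eball a r) `^ th * V%:E `^ (1 - th))%E.
  rewrite -VE.
  have := @jensen_powR _ _ _ mu (eball a r) (wpow v1 (- (s * P'))) th
    (@measurable_eball _ _ a r) (measurable_wpow _ wv1) (fun x => powR_ge0 _ _) th01.
  apply: le_trans; rewrite le_eqVlt; apply/orP; left; apply/eqP.
  apply: eq_integral => x _; congr EFin; rewrite /wpow -powRrM.
  by congr (_ `^ _); rewrite /th /e; field; rewrite !gt_eqF.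
split; first exact: fU.
have fS' : wmeas (wpow v1 (- p')) (eball a r) \is a fin_num.
  rewrite ge0_fin_numE; last by apply: wmeas_ge0 => x; exact: powR_ge0.
  apply: (le_lt_trans jen).
  by rewrite -(fineK fS) !poweR_EFin -EFinM ltry.
split; first exact: fS'.
have sg'0 : 0 <= fine (wmeas (wpow v1 (- p')) (eball a r)).
  by apply: fine_ge0; apply: wmeas_ge0 => x; exact: powR_ge0.
move: jen hC U0 S0.
rewrite -(fineK fU) -(fineK fS) -(fineK fS').
set sg' := fine (wmeas (wpow v1 (- p')) _) in sg'0 *.
set u := fine (wmeas (wpow v2 q) _); set sg := fine (wmeas (wpow v1 (- (s * P'))) _).
move: sg' sg'0 u sg => sg' sg'0 u sg.
rewrite -?EFinM ?poweR_EFin -?EFinM ?lee_fin ?lte_fin => jen hC u0 sg0.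
have h1 : sg' `^ p'^-1 <= sg `^ e * V `^ (p'^-1 - e).
  apply: (@le_trans _ _ ((sg `^ th * V `^ (1 - th)) `^ p'^-1)).
    by apply: ge0_ler_powR; rewrite ?nnegrE ?mulr_ge0 ?powR_ge0// ltW.
  rewrite powRM ?powR_ge0// -!powRrM.
  have -> : th * p'^-1 = e by rewrite /th mulfK// gt_eqF.
  have -> : (1 - th) * p'^-1 = p'^-1 - e.
    by rewrite mulrBl mul1r /th mulfK// gt_eqF.
  exact: lexx.
have h2 : (V^-1 * u) `^ q^-1 * (V^-1 * sg) `^ e <= K.
  apply: (@le_trans _ _ (((V^-1 * u) `^ (q / s)^-1 * (V^-1 * sg) `^ P'^-1) `^ s^-1)).
    have e1 : (q / s)^-1 * s^-1 = q^-1 by rewrite invf_div mulrAC mulfV ?gt_eqF// mul1r.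
    have e2 : P'^-1 * s^-1 = e by rewrite /e invfM mulrC.
    by rewrite powRM ?powR_ge0// -!powRrM e1 e2.
  apply: (@le_trans _ _ (`|C| `^ s^-1)); last by rewrite lerDl.
  apply: ge0_ler_powR; rewrite ?nnegrE ?mulr_ge0 ?powR_ge0// ?invr_ge0 ?(ltW s0)//.
  exact: le_trans hC (ler_norm _).
apply: (@le_trans _ _ (K * V `^ (q^-1 + p'^-1))).
  apply: (@le_trans _ _ (u `^ q^-1 * (sg `^ e * V `^ (p'^-1 - e)))).
    by rewrite ler_wpM2l ?powR_ge0.
  have -> : u `^ q^-1 * (sg `^ e * V `^ (p'^-1 - e)) =
      ((V^-1 * u) `^ q^-1 * (V^-1 * sg) `^ e) * V `^ (q^-1 + p'^-1).
    rewrite !powRM ?invr_ge0 ?(ltW u0) ?(ltW sg0) ?(ltW V0)//.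
    have VV b : (V^-1) `^ b = V `^ (- b) by rewrite -powR_inv1 ?(ltW V0)// -powRrM mulN1r.
    rewrite !VV.
    have -> : V `^ (p'^-1 - e) = V `^ (- q^-1) * V `^ (- e) * V `^ (q^-1 + p'^-1).
      by rewrite -!powRD ?(gt_eqF V0) ?implybT//; congr (_ `^ _); ring.
    ring.
  by rewrite ler_wpM2r ?powR_ge0.
rewrite -mulrA ler_wpM2l ?(ltW K0)//.
apply: (@le_trans _ _ (((2 * r) ^+ n) `^ (q^-1 + p'^-1))).
  by apply: ge0_ler_powR; rewrite ?nnegrE ?exprn_ge0 ?mulr_ge0 ?(ltW beta0) ?(ltW V0) ?(ltW r0).
rewrite powR_nat_exp ?mulr_ge0 ?(ltW r0)// beta mulrBr mulr1 mulrCA mulfV ?gt_eqF// mulr1.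
by rewrite powRM// ltW.
Qed.

End pair.
End weights.

(** * Duality and doubling *)

Section dual_bound.
Context {R : realType} (n : nat) (alpha p q : R).
Local Notation Rn := (n.-tuple R).
Local Notation mu := (@leb R n).
Hypotheses (an : 0 < alpha < n%:R) (hp : 1 <= p < n%:R / alpha)
  (hq : q^-1 = p^-1 - alpha / n%:R).

Let n0 := natR_gt0 an.
Let p0 := p_gt0 hp.
Let q0 := q_gt0 an hp hq.

(** The consequence of the A_(p,q) condition on which the estimates of the
operator rest; unlike the condition itself, it has the same form for p = 1 and
for p > 1. *)
Definition dual_bound (C : R) (v1 v2 : Rn -> R) := forall a r, 0 < r ->
  wmeas (wpow v2 q) (eball a r) \is a fin_num /\
  forall g : Rn -> R, measurable_fun setT g -> (forall x, 0 <= g x) ->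
    ((\int[mu]_(x in eball a r) (g x)%:E) * wmeas (wpow v2 q) (eball a r) `^ q^-1 <=
     (C * r `^ (n%:R - alpha))%:E *
       (\int[mu]_(x in eball a r) (g x `^ p * wpow v1 p x)%:E) `^ p^-1)%E.

(** Hoelder for the factorization g = (g v) v^(-1). *)
Lemma integral_le_dual (v : Rn -> R) (E : set Rn) (g : Rn -> R) : 1 < p ->
  is_weight v -> measurable E -> measurable_fun setT g -> (forall x, 0 <= g x) ->
  (\int[mu]_(x in E) (g x)%:E <=
   (\int[mu]_(x in E) (g x `^ p * wpow v p x)%:E) `^ p^-1 *
   wmeas (wpow v (- conj_exp p)) E `^ (conj_exp p)^-1)%E.
Proof.
move=> p1 wv mE mg g0; have [_ v0 _ vpos] := wv.
have p'V : (conj_exp p)^-1 = 1 - p^-1 by rewrite /conj_exp invrK.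
have p'V0 : 0 < (conj_exp p)^-1 by rewrite p'V subr_gt0 invf_lt1.
have pV0 : 0 < p^-1 by rewrite invr_gt0.
pose f x := g x `^ p * wpow v p x.
have mf : measurable_fun setT f.
  by apply: measurable_funM; [exact: measurable_comp_powR|exact: measurable_wpow].
have f0 x : 0 <= f x by rewrite mulr_ge0 ?powR_ge0.
have sum1 : p^-1 + (conj_exp p)^-1 = 1 by rewrite p'V; ring.
have := @hoelder_powR _ _ _ mu E f (wpow v (- conj_exp p)) p^-1 (conj_exp p)^-1 mE mf
  (measurable_wpow _ wv) f0 (fun x => powR_ge0 _ _) pV0 p'V0 sum1.
apply: le_trans.
have mF : measurable_fun setT (fun x => f x `^ p^-1 * wpow v (- conj_exp p) x `^ (conj_exp p)^-1).
  apply: measurable_funM; apply: measurable_comp_powR => //.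
  exact: measurable_wpow.
apply: ae_ge0_le_integral.
- exact: mE.
- by move=> x _; rewrite lee_fin.
- by apply: measurable_funTS; apply/measurable_EFinP.
- by move=> x _; rewrite lee_fin mulr_ge0 ?powR_ge0.
- by apply: measurable_funTS; apply/measurable_EFinP.
apply: filterS vpos => x vx _; rewrite lee_fin /f /wpow.
rewrite powRM ?powR_ge0// -!powRrM mulfV ?gt_eqF// mulNr mulfV; last first.
  by rewrite gt_eqF// -invr_gt0.
by rewrite !powRr1// powR_inv1 ?(ltW vx)// mulfK// gt_eqF.
Qed.

Section pair.
Variables (s : R) (v1 v2 : Rn -> R).
Hypotheses (wv1 : is_weight v1) (wv2 : is_weight v2).

Lemma dual_bound_gt1 : 1 < p -> 1 <= s < p ->
  Apq (p / s) (q / s) (wpow v1 s) (wpow v2 s) ->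
  exists2 C : R, 0 < C & dual_bound C v1 v2.
Proof.
move=> p1 sp hA; have [C C0 hC] := Apq_power_bound an hp hq wv1 wv2 p1 sp hA.
exists C => // a r r0; have [fU [fS hUS]] := hC a r r0; split; first exact: fU.
move=> g mg g0.
have h := integral_le_dual p1 wv1 (@measurable_eball _ _ a r) mg g0.
apply: (le_trans (lee_wpmul2r (poweR_ge0 _ _) h)).
rewrite -muleA muleC; apply: lee_wpmul2r; first exact: poweR_ge0.
by rewrite muleC.
Qed.

(** For p = 1 the essential supremum of 1 / v1 takes the place of Hoelder:
g <= ess sup (1 / v1) g v1 almost everywhere on the ball. *)
Lemma dual_bound_1 : p = 1 -> Apq 1 q (wpow v1 1) (wpow v2 1) ->
  exists2 C : R, 0 < C & dual_bound C v1 v2.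
Proof.
move=> p1 [C hC]; have [mv1 v10 _ v1pos] := wv1; have [mv2 v20 _ v2pos] := wv2.
have qE : q^-1 = 1 - alpha / n%:R by rewrite hq p1 invr1.
have qV0 : 0 < q^-1 by rewrite invr_gt0.
have wE v : (forall x, 0 <= v x) -> wpow v 1 = v.
  by move=> v0; apply/funext => x; rewrite /wpow powRr1.
rewrite eqxx !wE// in hC.
pose K := `|C| + 1; have K0 : 0 < K by rewrite ltr_wpDl.
exists (K * 2 `^ (n%:R - alpha)); first by rewrite mulr_gt0// powR_gt0.
move=> a r r0; have {hC} := hC a r r0.
have [V VE /andP[_ Vle]] := leb_eballE a r0.
have V0 : 0 < V by have := leb_eball_gt0 a r0; rewrite VE lte_fin.
rewrite /avg VE inver gt_eqF// -/(wmeas _ _).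
have U0 := wmeas_wpow_gt0 q a wv2 r0.
set M := Linfty _ _ => hC.
have mB := @measurable_eball R n a r.
have aeM : {ae mu, forall x, eball a r x -> ((v1 x)^-1%:E <= M)%E}.
  apply: filterS (ess_sup_ge mu ((fun x => `|(v1 x)^-1|%:E) \_ (eball a r))) => x hx Bx.
  by apply: le_trans hx; rewrite patchE mem_set// lee_fin ler_norm.
have M0 : (0 < M)%E.
  rewrite ltNge; apply/negP => M0.
  have neg : mu.-negligible (eball a r).
    have : {ae mu, forall x, ~ eball a r x}.
      apply: filterS2 aeM v1pos => x hx vx Bx.
      have := le_trans (hx Bx) M0; rewrite lee_fin invr_le0 => v0.
      by rewrite ltNge v0 in vx.
    move=> [N [mN N0 sN]]; exists N; split => // x Bx; apply: sN => /=; exact.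
  have := leb_eball_gt0 a r0.
  by move/(negligibleP mu mB) : neg => ->; rewrite ltxx.
have V'0 : (0 < V^-1%:E)%E by rewrite lte_fin invr_gt0.
have VU0 := mule_gt0 V'0 U0.
have [fVU fM] : (V^-1%:E * wmeas (wpow v2 q) (eball a r))%E \is a fin_num /\ M \is a fin_num.
  apply: (@poweR_prod_fin R _ _ q^-1 1 C) => //.
  by rewrite poweRe1 ?(ltW M0).
have fU : wmeas (wpow v2 q) (eball a r) \is a fin_num.
  rewrite ge0_fin_numE ?ltW// ltey; apply/eqP => E.
  by rewrite E gt0_muley in fVU.
split; first exact: fU.
move=> g mg g0.
have Ig : (\int[mu]_(x in eball a r) (g x)%:E <=
    M * \int[mu]_(x in eball a r) (g x * v1 x)%:E)%E.
  rewrite -(fineK fM); have m0 : 0 <= fine M by rewrite fine_ge0// ltW.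
  have mgv : measurable_fun (eball a r) (fun x => (g x * v1 x)%:E).
    by apply: measurable_funTS; apply/measurable_EFinP; exact: measurable_funM.
  have gv0 x : eball a r x -> (0 <= (g x * v1 x)%:E)%E by rewrite lee_fin mulr_ge0.
  rewrite -(@ge0_integralZl_EFin _ _ _ mu _ mB _ gv0 mgv _ m0).
  apply: ae_ge0_le_integral.
  - exact: mB.
  - by move=> x _; rewrite lee_fin.
  - by apply: measurable_funTS; apply/measurable_EFinP.
  - by move=> x Bx; rewrite mule_ge0 ?gv0 ?lee_fin.
  - exact: measurable_funeM.
  apply: filterS2 aeM v1pos => x hx vx Bx.
  rewrite -EFinM lee_fin mulrCA ler_peMr// mulrC -ler_pdivrMl// mulr1.
  by have := hx Bx; rewrite -(fineK fM) lee_fin.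
have IE : ((\int[mu]_(x in eball a r) (g x `^ p * wpow v1 p x)%:E) `^ p^-1 =
    \int[mu]_(x in eball a r) (g x * v1 x)%:E)%E.
  rewrite p1 invr1 poweRe1; last by apply: integral_ge0 => x _; rewrite lee_fin mulr_ge0 ?powR_ge0.
  by apply: eq_integral => x _; rewrite powRr1// /wpow powRr1.
rewrite IE.
have I0 : (0 <= \int[mu]_(x in eball a r) (g x * v1 x)%:E)%E.
  by apply: integral_ge0 => x _; rewrite lee_fin mulr_ge0.
apply: (le_trans (lee_wpmul2r (poweR_ge0 _ _) Ig)).
rewrite muleAC; apply: lee_wpmul2r => //.
move: hC U0; rewrite -(fineK fM) -(fineK fU).
have : 0 <= fine M by rewrite fine_ge0// ltW.
move: (fine M) (fine (wmeas _ _)) => m u m0.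
rewrite -?EFinM ?poweR_EFin -?EFinM ?lee_fin ?lte_fin => hC u0.
have -> : m * u `^ q^-1 = (V^-1 * u) `^ q^-1 * m * V `^ q^-1.
  rewrite powRM ?invr_ge0 ?(ltW V0) ?(ltW u0)//.
  rewrite -(powR_inv1 (ltW V0)) -powRrM mulN1r powRN.
  by field; rewrite gt_eqF// powR_gt0.
apply: (@le_trans _ _ (K * V `^ q^-1)).
  rewrite ler_wpM2r ?powR_ge0// (le_trans hC)// (le_trans (ler_norm _))//.
  by rewrite lerDl.
rewrite -mulrA ler_wpM2l ?(ltW K0)//.
apply: (@le_trans _ _ (((2 * r) ^+ n) `^ q^-1)).
  by apply: ge0_ler_powR; rewrite ?nnegrE ?exprn_ge0 ?mulr_ge0 ?(ltW qV0) ?(ltW V0) ?(ltW r0).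
rewrite powR_nat_exp ?mulr_ge0 ?(ltW r0)// qE mulrBr mulr1 mulrCA mulfV ?gt_eqF// mulr1.
by rewrite powRM// ltW.
Qed.

End pair.

Section doubling.
Variables (v : Rn -> R) (C : R).
Hypotheses (wv : is_weight v) (C0 : 0 < C) (hC : dual_bound C v v).

(** The dual bound for the pair (v, v) on the large ball, tested on the
indicator of the small ball, bounds the ratio of the masses; Jensen compares
the powers p and q of the weight on the small ball. *)
Lemma wmeas_doubling : exists2 K : R, 0 < K & forall a r, 0 < r ->
  (wmeas (wpow v q) (eball a (2 * r)) `^ q^-1 <=
   K%:E * wmeas (wpow v q) (eball a r) `^ q^-1)%E.
Proof.
have qV0 : 0 < q^-1 by rewrite invr_gt0.
have pV0 : 0 < p^-1 by rewrite invr_gt0.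
have na : 0 < n%:R - alpha by case/andP: an => *; rewrite subr_gt0.
exists (C * n.+1%:R `^ (n%:R - alpha)); first by rewrite mulr_gt0// powR_gt0.
move=> a r r0; have r20 : 0 < 2 * r by rewrite mulr_gt0.
have [fU2 h] := hC a r20; have [fU _] := hC a r0.
have [V VE /andP[Vge _]] := leb_eballE a r0.
have V0 : 0 < V by have := leb_eball_gt0 a r0; rewrite VE lte_fin.
have mB := @measurable_eball R n a r.
have sub : eball a (2 * r) `&` eball a r = eball a r.
  by apply/setIidr; apply: sub_eball; rewrite ler_peMl ?(ltW r0)// ler1n.
have h0 : forall x : Rn, 0 <= \1_(eball a r) x :> R by move=> x; rewrite indicE.
have := h (\1_(eball a r)) (measurable_indic mB) h0.
have -> : (\int[mu]_(x in eball a (2 * r)) (\1_(eball a r) x)%:E = V%:E)%E.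
  by rewrite integral_indic//; [rewrite setIC sub|exact: measurable_eball].
have E2 : (\int[mu]_(x in eball a (2 * r)) (\1_(eball a r) x `^ p * wpow v p x)%:E
    = wmeas (wpow v p) (eball a r))%E.
  rewrite /wmeas -[in RHS]sub [in RHS]integral_mkcondr; apply: eq_integral => x _.
  rewrite patchE indicE; case: (_ \in _); first by rewrite powR1 mul1r.
  by rewrite powR0 ?mul0r// gt_eqF.
rewrite E2 => h1.
have pq1 : 0 < p / q <= 1.
  rewrite divr_gt0//= ler_pdivrMr// mul1r.
  by rewrite -(lef_pV2 (x := q) (y := p)) ?posrE// ltW// (qV_lt_pV an hq).
have jen : (wmeas (wpow v p) (eball a r) <=
    wmeas (wpow v q) (eball a r) `^ (p / q) * V%:E `^ (1 - p / q))%E.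
  rewrite -VE.
  have := @jensen_powR _ _ _ mu (eball a r) (wpow v q) (p / q)
    mB (measurable_wpow _ wv) (fun x => powR_ge0 _ _) pq1.
  apply: le_trans; rewrite le_eqVlt; apply/orP; left; apply/eqP.
  apply: eq_integral => x _; congr EFin; rewrite /wpow -powRrM.
  by congr (_ `^ _); rewrite mulrC divfK// gt_eqF.
have U0 := wmeas_wpow_gt0 q a wv r0.
have W0 : (0 <= wmeas (wpow v p) (eball a r))%E by apply: wmeas_ge0 => x; exact: powR_ge0.
have fW : wmeas (wpow v p) (eball a r) \is a fin_num.
  rewrite ge0_fin_numE// (le_lt_trans jen)// -(fineK fU) !poweR_EFin -EFinM.
  exact: ltry.
have U20 := wmeas_wpow_gt0 q a wv r20.
move: h1 jen W0 U0 U20; rewrite -(fineK fU) -(fineK fU2) -(fineK fW).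
move: (fine (wmeas (wpow v q) (eball a r))) (fine (wmeas (wpow v q) (eball a (2 * r))))
  (fine (wmeas (wpow v p) (eball a r))) => u u2 w.
rewrite -?EFinM ?poweR_EFin -?EFinM ?lee_fin ?lte_fin => h1 jen w0 u0 u20.
have hw : w `^ p^-1 <= u `^ q^-1 * V `^ (alpha / n%:R).
  apply: (@le_trans _ _ ((u `^ (p / q) * V `^ (1 - p / q)) `^ p^-1)).
    by apply: ge0_ler_powR; rewrite ?nnegrE ?mulr_ge0 ?powR_ge0 ?(ltW pV0).
  rewrite powRM ?powR_ge0// -!powRrM.
  have -> : p / q * p^-1 = q^-1 by rewrite mulrAC mulfV ?gt_eqF// mul1r.
  have -> : (1 - p / q) * p^-1 = alpha / n%:R.
    by rewrite mulrBl mul1r mulrAC mulfV ?gt_eqF// mul1r hq; ring.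
  exact: lexx.
have Vpow : V `^ (alpha / n%:R) * (2 * r) `^ (n%:R - alpha) <= n.+1%:R `^ (n%:R - alpha) * V.
  have -> : n.+1%:R `^ (n%:R - alpha) * V =
      V `^ (alpha / n%:R) * (n.+1%:R `^ (n%:R - alpha) * V `^ (1 - alpha / n%:R)).
    rewrite mulrCA -powRD ?(gt_eqF V0) ?implybT//.
    have -> : alpha / n%:R + (1 - alpha / n%:R) = 1 by ring.
    by rewrite powRr1// ltW.
  rewrite ler_wpM2l ?powR_ge0//.
  have b0 : 0 < 1 - alpha / n%:R.
    by rewrite subr_gt0 ltr_pdivrMr// mul1r; case/andP: an.
  apply: (@le_trans _ _ (n.+1%:R `^ (n%:R - alpha) *
      (((2 * (r / n.+1%:R)) ^+ n) `^ (1 - alpha / n%:R)))); last first.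
    rewrite ler_wpM2l ?powR_ge0//.
    have d0 : 0 <= 2 * (r / n.+1%:R) by rewrite mulr_ge0// divr_ge0// ltW.
    by apply: ge0_ler_powR; rewrite ?nnegrE ?exprn_ge0 ?(ltW b0) ?(ltW V0).
  have d0 : 0 <= 2 * (r / n.+1%:R) by rewrite mulr_ge0// divr_ge0// ltW.
  have e1 : n%:R * (1 - alpha / n%:R) = n%:R - alpha.
    by rewrite mulrBr mulr1 mulrCA mulfV ?gt_eqF// mulr1.
  rewrite powR_nat_exp// e1 -powRM//; have -> : n.+1%:R * (2 * (r / n.+1%:R)) = 2 * r by field.
  exact: lexx.
rewrite -(ler_pM2l V0); apply: (le_trans h1).
apply: (@le_trans _ _ (C * (2 * r) `^ (n%:R - alpha) * (u `^ q^-1 * V `^ (alpha / n%:R)))).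
  by rewrite ler_wpM2l// mulr_ge0 ?powR_ge0// ltW.
have -> : C * (2 * r) `^ (n%:R - alpha) * (u `^ q^-1 * V `^ (alpha / n%:R)) =
  C * u `^ q^-1 * (V `^ (alpha / n%:R) * (2 * r) `^ (n%:R - alpha)) by ring.
have -> : V * (C * n.+1%:R `^ (n%:R - alpha) * u `^ q^-1) =
  C * u `^ q^-1 * (n.+1%:R `^ (n%:R - alpha) * V) by ring.
by rewrite ler_wpM2l// mulr_ge0 ?powR_ge0// ltW.
Qed.

End doubling.
End dual_bound.

(** * The tail series *)

Section Lp_norm_mono.
Context {R : realType} (n : nat).
Local Notation Rn := (n.-tuple R).
Local Notation Fn := (Rn -> R[i]).
Local Notation mu := (@leb R n).

Lemma Lp_norm_mono (p : R) (w : Rn -> R) (E E' : set Rn) (f : Fn) : 0 < p ->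
  measurable E -> measurable E' ->
  measurable_fun setT w -> (forall x, 0 <= w x) -> cmeasurable setT f -> E `<=` E' ->
  (Lp_norm p w E f <= Lp_norm p w E' f)%E.
Proof.
move=> p0 mE mE' mw w0 mf EE'.
have I0 D : (0 <= \int[mu]_(x in D) (normc (f x) `^ p * w x)%:E)%E.
  by apply: integral_ge0 => x _; rewrite lee_fin mulr_ge0 ?powR_ge0.
apply: lee_poweR; [by rewrite invr_ge0 ltW|exact: I0|].
apply: ge0_subset_integral => //.
- apply: measurable_funTS; apply/measurable_EFinP; apply: measurable_funM => //.
  by apply: measurable_comp_powR; exact: measurable_normc.
- by move=> x _; rewrite lee_fin mulr_ge0 ?powR_ge0.
Qed.

End Lp_norm_mono.

Section tail_series.
Context {R : realType} (n : nat) (alpha p q : R).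
Local Notation Rn := (n.-tuple R).
Local Notation Fn := (Rn -> R[i]).
Local Notation mu := (@leb R n).
Local Notation leb1 := (@lebesgue_measure R).
Hypotheses (an : 0 < alpha < n%:R) (hp : 1 <= p < n%:R / alpha)
  (hq : q^-1 = p^-1 - alpha / n%:R).

Let n0 := natR_gt0 an.
Let p0 := p_gt0 hp.
Let q0 := q_gt0 an hp hq.
Let pV0 : 0 < p^-1. Proof. by rewrite invr_gt0. Qed.
Let qV0 : 0 < q^-1. Proof. by rewrite invr_gt0. Qed.

Lemma eseries_single (f : nat -> \bar R) k : (forall j, 0 <= f j)%E ->
  (forall j, j != k -> f j = 0%E) -> (\sum_(0 <= j <oo) f j = f k)%E.
Proof.
move=> f0 fz; rewrite (@nneseriesD1 _ _ k)//.
rewrite eseries0 ?adde0// => j _ /andP[_ jk]; exact: fz.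
Qed.

Variables (w1 w2 : Rn -> R) (psi1 psi2 : Rn -> R -> R).
Hypotheses (ww1 : is_weight w1) (ww2 : is_weight w2).
Hypotheses (hpsi1 : forall a r, 0 < r -> 0 < psi1 a r)
  (hpsi2 : forall a r, 0 < r -> 0 < psi2 a r).

Local Notation U a r := (wmeas (wpow w2 q) (eball a r)).
Local Notation W a r := (wmeas (wpow w1 p) (eball a r)).

Lemma wmeas_mono (w : Rn -> R) c a r r' : is_weight w -> r <= r' ->
  (wmeas (wpow w c) (eball a r) <= wmeas (wpow w c) (eball a r'))%E.
Proof.
move=> ww rr; apply: ge0_subset_integral; try exact: measurable_eball.
- by apply: measurable_funTS; apply/measurable_EFinP; exact: measurable_wpow.
- by move=> x _; rewrite lee_fin powR_ge0.
- exact: sub_eball.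
Qed.

Lemma Lp_norm_ge0 w E (f : Fn) : (0 <= Lp_norm p w E f)%E.
Proof. exact: poweR_ge0. Qed.

Lemma inf_ratio_ge0 a t : (0 < t) -> (0 <= inf_ratio p q w1 w2 psi1 a t)%E.
Proof.
move=> t0; apply: mule_ge0; last by rewrite inve_ge0 poweR_ge0.
apply: le_ereal_inf_tmp => _ [l /= tl <-].
rewrite in_itv/= andbT in tl.
apply: mule_ge0; last exact: poweR_ge0.
by rewrite lee_fin ltW// hpsi1// (lt_le_trans t0).
Qed.

Hypothesis fU : forall a r, 0 < r -> U a r \is a fin_num.

(** If some ball had infinite w1^p-mass, all larger concentric balls would, and
the infimum in the hypothesis would be infinite for all large t. *)
Lemma wmeas_fin_of_tail (a : Rn) : (\int[leb1]_(t in `]1%R, +oo[)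
    (inf_ratio p q w1 w2 psi1 a t * (t^-1)%:E) < +oo)%E ->
  forall l, W a l \is a fin_num.
Proof.
move=> hfin l; have W0 r : (0 <= W a r)%E by apply: wmeas_ge0 => x; exact: powR_ge0.
suff h m : 1 <= m -> W a m \is a fin_num.
  have := h (Num.max 1 l); rewrite le_max lexx => /(_ isT) hm.
  rewrite ge0_fin_numE//; apply: (@le_lt_trans _ _ (W a (Num.max 1 l))).
    by apply: wmeas_mono => //; rewrite le_max lexx orbT.
  by rewrite ltey_eq hm.
move=> m1; have m0 : 0 < m by exact: lt_le_trans m1.
rewrite ge0_fin_numE// ltey; apply/eqP => Wm.
have Iy t : m <= t -> inf_ratio p q w1 w2 psi1 a t = +oo%E.
  move=> mt; have t0 : 0 < t by exact: lt_le_trans mt.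
  rewrite /inf_ratio.
  have -> : ereal_inf [set (psi1 a l)%:E * W a l `^ p^-1 | l in `[t, +oo[]%E = +oo%E.
    apply/ereal_inf_pinfty => _ [k /= tk <-] /=.
    rewrite in_itv/= andbT in tk.
    have Wk : W a k = +oo%E.
      by apply/eqP; rewrite -leye_eq -Wm wmeas_mono// (le_trans mt).
    rewrite Wk poweRyr ?gt_eqF// gt0_muley// lte_fin hpsi1//.
    exact: lt_le_trans tk.
  have f := fU a t0.
  have u0 := wmeas_wpow_gt0 q a ww2 t0.
  rewrite gt0_mulye// inve_gt0 ?poweR_gt0//.
    by rewrite gt_eqF// poweR_gt0.
  by rewrite -ltey ltey_eq fin_num_poweR.
suff : (\int[leb1]_(t in `]1%R, +oo[) (inf_ratio p q w1 w2 psi1 a t * (t^-1)%:E) = +oo)%E.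
  by move=> E; rewrite E ltxx in hfin.
apply/eqP; rewrite -leye_eq.
apply: (@le_trans _ _ (\int[leb1]_(t in `]1%R, +oo[) ((cst +oo%E : R -> \bar R) \_ `]m, (m + 1)%R[) t)%E).
  rewrite -integral_mkcondr setIidr; last first.
    move=> t /=; rewrite !in_itv/= andbT => /andP[mt _].
    exact: le_lt_trans m1 mt.
  rewrite (integral_cst leb1 (measurable_itv _)).
  rewrite [X in (_ <= _ * X)%E]lebesgue_measure_itv/= lte_fin ltrDl ltr01 -EFinB addrAC subrr add0r.
  by rewrite gt0_mulye ?lte_fin ?lexx.
apply: le_integral_ge0 => t; first by rewrite patchE; case: ifP => // _; rewrite leey.
rewrite /= in_itv/= andbT => t1; have t0 : 0 < t by exact: lt_trans t1.
rewrite patchE; case: ifPn => [|_]; last first.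
  by apply: mule_ge0; [exact: inf_ratio_ge0|rewrite lee_fin invr_ge0 ltW].
rewrite inE/= in_itv/= => /andP[mt _].
by rewrite (Iy _ (ltW mt)) gt0_mulye ?lte_fin ?invr_gt0// leey.
Qed.

Hypothesis fW : forall a r, W a r \is a fin_num.

Lemma Morrey_ball (f : Fn) (M : R) a l : (fnorm (Morrey p (wpow w1 p) psi1) f <= M%:E)%E ->
  0 < l -> (Lp_norm p (wpow w1 p) (eball a l) f <= M%:E * ((psi1 a l)%:E * W a l `^ p^-1))%E.
Proof.
move=> hM l0.
have hl : ((psi1 a l)^-1%:E * (W a l `^ p^-1)^-1 * Lp_norm p (wpow w1 p) (eball a l) f <= M%:E)%E.
  by apply: le_trans hM; apply: ereal_sup_ubound; exists (a, l).
have W0 := wmeas_wpow_gt0 p a ww1 l0.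
have := hpsi1 a l0; move: hl W0; rewrite -(fineK (fW a l)).
move: (fine _) (Lp_norm _ _ _ _) => x y; rewrite !poweR_EFin lte_fin => + x0 ps0.
have xp : 0 < x `^ p^-1 by rewrite powR_gt0.
rewrite inver gt_eqF// -!EFinM -invfM.
by rewrite lee_pdivrMl ?mulr_gt0// muleC.
Qed.

Variables (Kd : R).
Hypotheses (Kd0 : 0 < Kd)
  (hKd : forall a r, 0 < r -> (U a (2 * r) `^ q^-1 <= Kd%:E * U a r `^ q^-1)%E).

Definition Fball (f : Fn) a r : R := fine (Lp_norm p (wpow w1 p) (eball a r) f).
Definition Uball a r : R := fine (U a r) `^ q^-1.

Lemma Lp_norm_fin (f : Fn) (M : R) a l : (fnorm (Morrey p (wpow w1 p) psi1) f <= M%:E)%E ->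
  0 < l -> Lp_norm p (wpow w1 p) (eball a l) f = (Fball f a l)%:E.
Proof.
move=> hM l0; rewrite /Fball fineK// ge0_fin_numE ?Lp_norm_ge0//.
apply: le_lt_trans (Morrey_ball a hM l0) _.
by rewrite -(fineK (fW a l)) poweR_EFin -!EFinM ltry.
Qed.

Lemma UballE a r : 0 < r -> (U a r `^ q^-1 = (Uball a r)%:E)%E.
Proof. by move=> r0; rewrite /Uball -poweR_EFin fineK// fU. Qed.

Lemma Uball_gt0 a r : 0 < r -> 0 < Uball a r.
Proof. by move=> r0; rewrite -lte_fin -UballE// poweR_gt0// wmeas_wpow_gt0. Qed.

(** For every l >= t >= rho the Morrey norm bounds the norm of f on B(a, l),
hence on B(a, rho), which gives the numerator; doubling compares the mass of
B(a, t) with that of B(a, rho). *)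
Lemma inf_ratio_ge (f : Fn) (M : R) a rho t : cmeasurable setT f -> 0 < M ->
  (fnorm (Morrey p (wpow w1 p) psi1) f <= M%:E)%E -> 0 < rho -> rho <= t <= 2 * rho ->
  ((M^-1 * (Fball f a rho / (Kd * Uball a rho)))%:E <= inf_ratio p q w1 w2 psi1 a t)%E.
Proof.
move=> mf M0 hM rho0 /andP[rt tr].
have t0 : 0 < t by exact: lt_le_trans rt.
have U1 := Uball_gt0 a rho0; have U2 := Uball_gt0 a t0.
have UU : Uball a t <= Kd * Uball a rho.
  rewrite -lee_fin EFinM -(UballE a t0) -(UballE a rho0); apply: le_trans (hKd a rho0).
  apply: lee_poweR; [exact: ltW| |exact: wmeas_mono].
  exact/ltW/wmeas_wpow_gt0.
rewrite /inf_ratio (UballE a t0) inver gt_eqF// mulrA EFinM.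
apply: (@le_trans _ _ ((M^-1 * Fball f a rho)%:E * (Uball a t)^-1%:E)%E).
  rewrite -!EFinM lee_fin ler_wpM2l//.
    by rewrite mulr_ge0 ?invr_ge0 ?(ltW M0)// fine_ge0// Lp_norm_ge0.
  have KU0 := mulr_gt0 Kd0 U1.
  by rewrite (lef_pV2 KU0 U2).
apply: lee_wpmul2r; first by rewrite lee_fin invr_ge0 ltW.
apply: le_ereal_inf_tmp => _ [l /= tl <-].
rewrite in_itv/= andbT in tl; have l0 : 0 < l by exact: lt_le_trans tl.
rewrite EFinM lee_pdivrMl//.
apply: le_trans (Morrey_ball a hM l0).
rewrite -(Lp_norm_fin a hM rho0); apply: Lp_norm_mono => //.
- exact: measurable_eball.
- exact: measurable_eball.
- exact: measurable_wpow.
- by move=> x; exact: powR_ge0.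
- by apply: sub_eball; exact: le_trans tl.
Qed.

Variables (phi : R -> R) (c : nat -> R) (K A : R).
Hypotheses (c0 : forall k, 0 <= c k) (K0 : 0 < K) (A0 : 0 < A)
  (phi0 : forall x, 1 <= x -> 0 <= phi x)
  (cphi : forall k x, 2 ^+ k <= x -> c k <= K * phi x)
  (hA : forall a r, 0 < r -> (\int[leb1]_(t in `]r, +oo[)
     ((phi (t / r))%:E * inf_ratio p q w1 w2 psi1 a t * (t^-1)%:E) <= (A * psi2 a r)%:E)%E).

(** The k-th term is at most a constant times the integral of the integrand over
the interval from 2^k r to 2^(k+1) r, by the lower bound on the ratio there.
The weight phi is 1 for the operator and 1 + ln for its commutator, with
c_k = 1 and c_k = k + 1. *)
Lemma tail_series (f : Fn) (M : R) a r : cmeasurable setT f -> 0 < M ->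
  (fnorm (Morrey p (wpow w1 p) psi1) f <= M%:E)%E -> 0 < r ->
  (\sum_(0 <= k <oo) (c k * (Fball f a (r * 2 ^+ k) / Uball a (r * 2 ^+ k)))%:E
   <= (2 * K * Kd * A * M * psi2 a r)%:E)%E.
Proof.
move=> mf M0 hM r0.
have r2 k : 0 < r * 2 ^+ k by rewrite mulr_gt0 ?exprn_gt0.
pose G k := Fball f a (r * 2 ^+ k) / Uball a (r * 2 ^+ k).
have F0 b : 0 <= Fball f a b by rewrite fine_ge0// Lp_norm_ge0.
have G0 k : 0 <= G k by rewrite divr_ge0 ?F0// ltW// Uball_gt0.
pose E k : set R := `]r * 2 ^+ k, r * 2 ^+ k.+1[%classic.
have mE k : measurable (E k) by exact: measurable_itv.
pose m k := c k * G k / (r * 2 ^+ k).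
have m0 k : 0 <= m k by apply: divr_ge0; [exact: mulr_ge0|exact: ltW].
pose h (t : R) : \bar R := (\sum_(0 <= k <oo) (m k * \1_(E k) t)%:E)%E.
have Ih : (\int[leb1]_(t in `]r, +oo[) h t = \sum_(0 <= k <oo) (c k * G k)%:E)%E.
  have mI : measurable (`]r, +oo[%classic : set R) by exact: measurable_itv.
  have mind k : measurable_fun `]r, +oo[%classic (fun t => (m k * \1_(E k) t)%:E).
    apply: measurable_funTS; apply/measurable_EFinP; apply: measurable_funM; first exact: measurable_cst.
    exact: measurable_indic.
  have ind0 k (t : R) : `]r, +oo[%classic t -> (0 <= (m k * \1_(E k) t)%:E)%E.
    by move=> _; rewrite lee_fin mulr_ge0// indicE.
  rewrite /h (@integral_nneseries _ _ _ leb1 _ mI _ mind ind0).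
  apply: eq_eseriesr => k _.
  have ik0 (t : R) : `]r, +oo[%classic t -> (0 <= (\1_(E k) t)%:E :> \bar R)%E.
    by move=> _; rewrite lee_fin indicE.
  have mik : measurable_fun `]r, +oo[%classic (fun t => (\1_(E k) t)%:E :> \bar R).
    by apply: measurable_funTS; apply/measurable_EFinP; exact: measurable_indic.
  under eq_integral do rewrite EFinM.
  rewrite (@ge0_integralZl_EFin _ _ _ leb1 _ mI _ ik0 mik _ (m0 k)).
  have EI : E k `&` `]r, +oo[%classic = E k.
    apply/setIidl => t; rewrite /E/= !in_itv/= andbT => /andP[rt _]; apply: le_lt_trans rt.
    by rewrite ler_peMr ?(ltW r0)// exprn_ege1// ler1n.
  rewrite (integral_indic leb1 mI (mE k)) EI.
  rewrite [X in (_ * X = _)%E]lebesgue_measure_itv/= lte_fin exprS mulrCA ltr_pMl ?r2// ltr1n -EFinB.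
  have -> : 2 * (r * 2 ^+ k) - r * 2 ^+ k = r * 2 ^+ k by ring.
  by rewrite -EFinM /m divfK// gt_eqF.
rewrite -Ih.
pose B := 2 * K * Kd * M.
have B0 : 0 < B by rewrite !mulr_gt0.
pose g (t : R) : \bar R := ((phi (t / r))%:E * inf_ratio p q w1 w2 psi1 a t * (t^-1)%:E)%E.
have g0 t : `]r, +oo[%classic t -> (0 <= g t)%E.
  rewrite /= in_itv/= andbT => rt; have t0 : 0 < t by exact: lt_trans rt.
  apply: mule_ge0; last by rewrite lee_fin invr_ge0 ltW.
  apply: mule_ge0; last exact: inf_ratio_ge0.
  by rewrite lee_fin phi0// ler_pdivlMr// mul1r ltW.
apply: (@le_trans _ _ (\int[leb1]_(t in `]r, +oo[) (B%:E * g t))%E); last first.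
  apply: le_trans (le_integralZl_ge0 leb1 B0 g0) _.
  apply: (@le_trans _ _ (B%:E * (A * psi2 a r)%:E)%E).
    by apply: lee_wpmul2l; [rewrite lee_fin ltW|exact: hA].
  by rewrite -EFinM lee_fin /B le_eqVlt; apply/orP; left; apply/eqP; ring.
have ind0 (t : R) j : (0 <= (m j * \1_(E j) t)%:E)%E by rewrite lee_fin mulr_ge0// indicE.
apply: le_integral_ge0 => t tr; first by apply: nneseries_ge0 => k _ _; exact: ind0.
have Bg0 : (0 <= B%:E * g t)%E by rewrite mule_ge0 ?g0// lee_fin ltW.
move: tr; rewrite /= in_itv/= andbT => rt.
have [k /andP[k1 k2]] := dyadic_above r0 (ltW rt).
have t0 : 0 < t by exact: lt_trans rt.
have -> : h t = (m k * \1_(E k) t)%:E.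
  apply: eseries_single => j; first exact: ind0.
  move=> jk; rewrite indicE memNset ?mulr0 // /E /= in_itv/= => /andP[j1 j2].
  have : (j < k)%N || (k < j)%N by rewrite -neq_ltn.
  have mono i i' : (i <= i')%N -> r * 2 ^+ i <= r * 2 ^+ i'.
    by move=> ii; rewrite ler_pM2l// ler_eXn2l// ltr1n.
  move=> /orP[jk'|kj].
    by have := lt_le_trans j2 (le_trans (mono _ _ jk') k1); rewrite ltxx.
  by have := lt_le_trans k2 (le_trans (mono _ _ kj) (ltW j1)); rewrite ltxx.
apply: (@le_trans _ _ (m k)%:E).
  by rewrite lee_fin indicE; case: (_ \in _); rewrite ?mulr1// mulr0.
have tk : r * 2 ^+ k <= t <= 2 * (r * 2 ^+ k).
  by rewrite k1/=; move: k2; rewrite exprS mulrCA => /ltW.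
have ir := inf_ratio_ge a mf M0 hM (r2 k) tk.
have ck : c k <= K * phi (t / r) by apply: cphi; rewrite ler_pdivlMr// mulrC.
have phit : 0 <= phi (t / r) by rewrite phi0// ler_pdivlMr// mul1r ltW.
apply: (@le_trans _ _ (B%:E * ((phi (t / r))%:E *
    (M^-1 * (Fball f a (r * 2 ^+ k) / (Kd * Uball a (r * 2 ^+ k))))%:E * (t^-1)%:E))%E); last first.
  apply: lee_wpmul2l; first by rewrite lee_fin ltW.
  apply: lee_wpmul2r; first by rewrite lee_fin invr_ge0 ltW.
  by apply: lee_wpmul2l; rewrite ?lee_fin.
rewrite -!EFinM lee_fin /m /B.
have UB := Uball_gt0 a (r2 k).
have -> : 2 * K * Kd * M * (phi (t / r) *
    (M^-1 * (Fball f a (r * 2 ^+ k) / (Kd * Uball a (r * 2 ^+ k)))) / t) =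
    (K * phi (t / r)) * G k * (2 / t).
  rewrite /G; field; rewrite !gt_eqF// mulr_gt0//.
apply: ler_pM.
- by rewrite mulr_ge0.
- by rewrite invr_ge0 ltW.
- by rewrite ler_wpM2r.
- rewrite ler_pdivlMr// mulrC ler_pdivrMr//.
  by case/andP: tk.
Qed.

End tail_series.

(** * Quasi-norms, cut-offs and the near-far splitting *)

Section quasi_norms.
Context {R : realType} (n : nat).
Local Notation Rn := (n.-tuple R).
Local Notation Fn := (Rn -> R[i]).
Local Notation mu := (@leb R n).
Local Open Scope ereal_scope.

Lemma poweR_add_le (x y : \bar R) (a : R) : 0 <= x -> 0 <= y -> (0 <= a)%R ->
  (x + y) `^ a <= (2 `^ a)%:E * (x `^ a + y `^ a).
Proof.
move=> x0 y0 a0; have p2 : (0 <= 2 `^ a :> R)%R by exact: powR_ge0.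
have two (z : \bar R) : 0 <= z -> (z + z) `^ a = (2 `^ a)%:E * z `^ a.
  move=> z0; rewrite -(_ : 2%:E * z = z + z); last first.
    by case: z z0 => [z| |]//= _; [rewrite -EFinM mulr_natl mulr2n|rewrite gt0_muley ?lte_fin].
  by rewrite poweRM.
have [xy|/ltW yx] := leP x y.
  apply: (@le_trans _ _ ((y + y) `^ a)).
    by apply: lee_poweR; rewrite ?adde_ge0// leeD2r.
  by rewrite two// lee_wpmul2l ?lee_fin// leeDr// poweR_ge0.
apply: (@le_trans _ _ ((x + x) `^ a)).
  by apply: lee_poweR; rewrite ?adde_ge0// leeD2l.
by rewrite two// lee_wpmul2l ?lee_fin// leeDl// poweR_ge0.
Qed.

Lemma powR_add_le (x y a : R) : (0 <= x)%R -> (0 <= y)%R -> (0 <= a)%R ->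
  ((x + y) `^ a <= 2 `^ a * (x `^ a + y `^ a))%R.
Proof.
by move=> x0 y0 a0; rewrite -lee_fin; exact: (@poweR_add_le x%:E y%:E a).
Qed.

Variables (q : R) (u : Rn -> R) (E : set Rn).
Hypotheses (q0 : (0 < q)%R) (mE : measurable E) (mu_ : measurable_fun setT u)
  (u0 : forall x, (0 <= u x)%R).

(** A triangle inequality up to a constant, valid for every positive exponent;
an inequality almost everywhere is enough to apply it. *)
Lemma Lp_norm_add_le (H : Fn) (F G : Rn -> R) : cmeasurable setT H ->
  measurable_fun setT F -> measurable_fun setT G ->
  (forall x, (0 <= F x)%R) -> (forall x, (0 <= G x)%R) ->
  {ae mu, forall x, E x -> (normc (H x) <= F x + G x)%R} ->
  Lp_norm q u E H <= (2 * 2 `^ q^-1)%:E *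
    ((\int[mu]_(x in E) (F x `^ q * u x)%:E) `^ q^-1 +
     (\int[mu]_(x in E) (G x `^ q * u x)%:E) `^ q^-1).
Proof.
move=> mH mF mG F0 G0 hae.
have qV0 : (0 <= q^-1)%R by rewrite invr_ge0 ltW.
have mpw (h : Rn -> R) : measurable_fun setT h -> measurable_fun setT (fun x => h x `^ q * u x)%R.
  by move=> mh; apply: measurable_funM => //; exact: measurable_comp_powR.
have mpE (h : Rn -> R) : measurable_fun setT h -> measurable_fun E (fun x => (h x `^ q * u x)%:E).
  by move=> mh; apply: measurable_funTS; apply/measurable_EFinP; exact: mpw.
have p0 (h : Rn -> R) x : E x -> 0 <= (h x `^ q * u x)%:E.
  by move=> _; rewrite lee_fin mulr_ge0 ?powR_ge0.
set IF := \int[mu]_(x in E) (F x `^ q * u x)%:E.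
set IG := \int[mu]_(x in E) (G x `^ q * u x)%:E.
have IF0 : 0 <= IF by apply: integral_ge0 => x Ex; exact: p0.
have IG0 : 0 <= IG by apply: integral_ge0 => x Ex; exact: p0.
have k0 : (0 <= 2 `^ q :> R)%R by exact: powR_ge0.
have le1 : \int[mu]_(x in E) (normc (H x) `^ q * u x)%:E <= (2 `^ q)%:E * (IF + IG).
  rewrite /IF /IG -(@ge0_integralD _ _ _ mu _ mE _ _ (p0 F) (mpE _ mF) (p0 G) (mpE _ mG)).
  have s0 x : E x -> 0 <= (F x `^ q * u x)%:E + (G x `^ q * u x)%:E.
    by move=> Ex; rewrite adde_ge0 ?p0.
  have ms : measurable_fun E (fun x => (F x `^ q * u x)%:E + (G x `^ q * u x)%:E).
    by apply: emeasurable_funD; exact: mpE.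
  rewrite -(@ge0_integralZl_EFin _ _ _ mu _ mE _ s0 ms _ k0).
  apply: ae_ge0_le_integral.
  - exact: mE.
  - exact: p0.
  - by apply: mpE; exact: measurable_normc.
  - by move=> x Ex; rewrite mule_ge0 ?s0 ?lee_fin.
  - exact: measurable_funeM.
  apply: filterS hae => x hx Ex; rewrite -EFinD -EFinM lee_fin -mulrDl mulrA.
  rewrite ler_wpM2r//; apply: le_trans (powR_add_le (F0 x) (G0 x) (ltW q0)).
  by apply: ge0_ler_powR; rewrite ?nnegrE ?normc_ge0 ?addr_ge0 ?hx ?(ltW q0).
apply: (@le_trans _ _ (((2 `^ q)%:E * (IF + IG)) `^ q^-1)).
  by apply: (lee_poweR qV0 _ le1); apply: integral_ge0 => x Ex; exact: (p0 (fun x => normc (H x)) x Ex).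
have k0e : 0 <= (2 `^ q)%:E :> \bar R by rewrite lee_fin.
rewrite (poweRM q^-1 k0e (adde_ge0 IF0 IG0)) poweR_EFin -powRrM mulfV ?gt_eqF// powRr1//.
rewrite EFinM -muleA; apply: lee_wpmul2l; first by rewrite lee_fin.
exact: (poweR_add_le IF0 IG0 qV0).
Qed.

(** Where |F| + T exceeds gamma, either |F| exceeds gamma / 2 or T does. *)
Lemma WLp_norm_add_le (H F : Fn) (T : R) : cmeasurable setT H -> cmeasurable setT F ->
  (0 <= T)%R -> {ae mu, forall x, E x -> (normc (H x) <= normc (F x) + T)%R} ->
  WLp_norm q u E H <= 2%:E * (WLp_norm q u E F + T%:E * wmeas u E `^ q^-1).
Proof.
move=> mH mF T0 hae.
have qV0 : (0 <= q^-1)%R by rewrite invr_ge0 ltW.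
have WT0 : 0 <= T%:E * wmeas u E `^ q^-1 by rewrite mule_ge0 ?poweR_ge0 ?lee_fin.
have WF0 : 0 <= WLp_norm q u E F.
  apply: le_ereal_sup_tmp; eexists; first by exists 1%R => //=.
  by rewrite mul1e poweR_ge0.
have Wle (S : set Rn) : wmeas u (E `&` S) <= wmeas u E -> True by [].
have mset (f : Fn) (g : R) : cmeasurable setT f -> measurable [set x | (g < normc (f x))%R].
  move=> mf; have := measurable_normc mf.
  move=> /(_ measurableT `]g, +oo[%classic (measurable_itv _)); rewrite setTI.
  by congr (measurable _); apply/seteqP; split => x /=; rewrite in_itv/= andbT.
have w0 x : E x -> 0 <= (u x)%:E by rewrite lee_fin.
have muE : measurable_fun E (fun x => (u x)%:E).
  by apply: measurable_funTS; apply/measurable_EFinP.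
have wge0 S : 0 <= wmeas u S by apply: integral_ge0 => x _; rewrite lee_fin.
apply: ge_ereal_sup => _ [g /= g0 <-].
have [gT|Tg] := leP g (2 * T)%R.
  apply: (@le_trans _ _ (2%:E * (T%:E * wmeas u E `^ q^-1))); last first.
    by apply: lee_wpmul2l; rewrite ?lee_fin// leeDr.
  rewrite muleA -EFinM; apply: lee_pmul; rewrite ?lee_fin ?(ltW g0) ?poweR_ge0//.
  apply: lee_poweR => //; apply: ge0_subset_integral => //.
  by apply: measurableI => //; exact: mset.
apply: (@le_trans _ _ (2%:E * WLp_norm q u E F)); last first.
  by apply: lee_wpmul2l; rewrite ?lee_fin// leeDl.
have g20 : (0 < g / 2)%R by rewrite divr_gt0.
apply: (@le_trans _ _ (2%:E * ((g / 2)%:E *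
    wmeas u (E `&` [set x | (g / 2 < normc (F x))%R]) `^ q^-1))); last first.
  apply: lee_wpmul2l; first by rewrite lee_fin.
  by apply: ereal_sup_ubound; exists (g / 2)%R.
rewrite muleA -EFinM mulrCA mulfV// mulr1.
apply: lee_wpmul2l; first by rewrite lee_fin ltW.
apply: lee_poweR => //.
rewrite /wmeas !integral_mkcondr; apply: ae_ge0_le_integral.
- exact: mE.
- by move=> x Ex; rewrite patchE; case: ifP => // _; exact: w0.
- apply/measurable_restrict; [exact: mset|exact: mE|].
  by apply: measurable_funTS; apply/measurable_EFinP.
- by move=> x Ex; rewrite patchE; case: ifP => // _; exact: w0.
- apply/measurable_restrict; [exact: mset|exact: mE|].
  by apply: measurable_funTS; apply/measurable_EFinP.
apply: filterS hae => x hx Ex; rewrite !patchE; case: ifPn => [|_]; last first.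
  by case: ifP => // _; exact: w0.
rewrite inE/= => gH; rewrite mem_set//=.
have := lt_le_trans gH (hx Ex); lra.
Qed.

End quasi_norms.

Section cut.
Context {R : realType} (n : nat).
Local Notation Rn := (n.-tuple R).
Local Notation Fn := (Rn -> R[i]).
Local Notation mu := (@leb R n).

Definition cut (E : set Rn) (f : Fn) : Fn := fun x => if x \in E then f x else 0.

Lemma cmeasurable_cut E f : measurable E -> cmeasurable setT f -> cmeasurable setT (cut E f).
Proof.
move=> mE [f1 f2]; apply: cmeasurable_if => //.
by split; exact: measurable_funTS.
Qed.

Lemma normc_cut E f x : normc (cut E f x) = if x \in E then normc (f x) else 0.
Proof. by rewrite /cut; case: ifP => // _; rewrite normcx0. Qed.

Lemma cutD E f : f = (fun y => cut E f y + cut (~` E) f y).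
Proof.
apply/funext => y; rewrite /cut in_setC; case: (y \in E); first by rewrite addr0.
by rewrite add0r.
Qed.

Lemma Lp_norm_cut p w E f : 0 < p ->
  Lp_norm p w setT (cut E f) = Lp_norm p w E f.
Proof.
move=> p0; rewrite /Lp_norm [in RHS]integral_mkcond; congr (_ `^ _)%E.
apply: eq_integral => x _; rewrite patchE normc_cut; case: ifP => // _.
by rewrite powR0 ?mul0r// gt_eqF.
Qed.

Lemma shift_series (f : nat -> \bar R) m : (forall k, 0 <= f k)%E ->
  (\sum_(0 <= k <oo) f (k + m)%N <= \sum_(0 <= k <oo) f k)%E.
Proof.
move=> f0; rewrite (nneseries_addn m f0) (@nneseries_split _ f 0 m)//.
by rewrite add0n leeDr// sume_ge0.
Qed.

Lemma term_le_series (f : nat -> \bar R) m : (forall k, 0 <= f k)%E ->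
  (f m <= \sum_(0 <= k <oo) f k)%E.
Proof.
move=> f0; apply: le_trans (nneseries_lim_ge m.+1 _); last by move=> *; exact: f0.
by rewrite big_nat_recr//= leeDr// sume_ge0.
Qed.

End cut.

Section splitting.
Context {R : realType} (n : nat) (alpha : R).
Local Notation Rn := (n.-tuple R).
Local Notation Fn := (Rn -> R[i]).
Local Notation mu := (@leb R n).
Hypothesis an : 0 < alpha < n%:R.
Variable P : R -> Rn -> Rn -> R[i].
Hypothesis mP : cmeasurable [set u : R * (Rn * Rn) | 0 < u.1]
  (fun u : R * (Rn * Rn) => P u.1 u.2.1 u.2.2).
Hypothesis gaussP : gaussian_bound P.
Local Notation N := (fractional_power alpha P).

(** The near part has finite potential almost everywhere because it is
integrable. The far part is estimated by the dyadic tail of the potential, in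
which the powers of the radii cancel against those in the bound on the
integrals of h. The sequence D is left free since it depends on whether h is f
or (b - c) f. *)
Lemma fractional_power_split : exists2 C : R, 0 < C &
  forall (h : Fn) (a : Rn) (r S : R) (D : nat -> R), cmeasurable setT h -> 0 < r ->
    (forall k, 0 <= D k) ->
    (forall k, (\int[mu]_(y in eball a (r * 2 ^+ k)) (normc (h y))%:E
        <= ((r * 2 ^+ k) `^ (n%:R - alpha) * D k)%:E)%E) ->
    (\sum_(0 <= k <oo) (D k)%:E <= S%:E)%E ->
  {ae mu, forall x, eball a r x ->
     (abs_integral alpha P (cut (eball a (2 * r)) h) x < +oo)%E} /\
  forall x, eball a r x ->
    (abs_integral alpha P (cut (~` eball a (2 * r)) h) x < +oo)%E /\
    normc (N (cut (~` eball a (2 * r)) h) x) <= C * S.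
Proof.
have [C [c [C0 c0 hg]]] := gaussP.
have [C1 C10 tail] := potential_tail an c0.
have [A A0 hA] := normc_fractional_power_le alpha mP.
exists (A * (C * (C1 * 2 `^ (n%:R - alpha)))).
  by rewrite !mulr_gt0// powR_gt0.
move=> h a r S D mh r0 D0 hD hS.
have r20 : 0 < 2 * r by rewrite mulr_gt0.
have mB := @measurable_eball R n a (2 * r).
have mBc : measurable (~` eball a (2 * r)) by exact: measurableC.
have mh1 := cmeasurable_cut mB mh; have mh2 := cmeasurable_cut mBc mh.
have n1 (E : set Rn) y : 0 <= normc (cut E h y) by exact: normc_ge0.
split.
  have fin1 : (\int[mu]_y (normc (cut (eball a (2 * r)) h y))%:E < +oo)%E.
    apply: (@le_lt_trans _ _ (\int[mu]_(y in eball a (r * 2 ^+ 1)) (normc (h y))%:E)%E).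
      rewrite [leRHS]integral_mkcond le_eqVlt; apply/orP; left; apply/eqP.
      apply: eq_integral => y _; rewrite patchE normc_cut expr1 (mulrC r).
      by case: ifP.
    by apply: le_lt_trans (hD 1%N) _; exact: ltry.
  have z1 y : ~ eball a (2 * r) y -> normc (cut (eball a (2 * r)) h y) = 0.
    by move=> ny; rewrite normc_cut memNset.
  apply: filterS (potential_near an c0 r0 (measurable_normc mh1) (n1 _) z1 fin1) => x hx ax.
  apply: le_lt_trans (abs_integral_le alpha C0 hg x mh1) _.
  by apply: lte_mul_pinfty => //; [rewrite lee_fin ltW|exact: hx].
move=> x ax; set h2 := cut (~` eball a (2 * r)) h in mh2 *.
have z2 y : eball a (2 * r) y -> normc (h2 y) = 0.
  by move=> ny; rewrite /h2 normc_cut in_setC mem_set.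
have le1 : (abs_integral alpha P h2 x <= (C * (C1 * 2 `^ (n%:R - alpha)) * S)%:E)%E.
  apply: le_trans (abs_integral_le alpha C0 hg x mh2) _.
  rewrite -mulrA EFinM; apply: lee_wpmul2l; first by rewrite lee_fin ltW.
  apply: le_trans (tail a x r _ r0 ax (measurable_normc mh2) (n1 _) z2) _.
  have r2k k : 2 * r * 2 ^+ k.+1 = r * 2 ^+ (k + 2).
    by rewrite addn2 !exprS; ring.
  have rk k : 0 < 2 * r * 2 ^+ k by rewrite mulr_gt0 ?exprn_gt0.
  apply: (@le_trans _ _ (\sum_(0 <= k <oo)
      ((C1 * 2 `^ (n%:R - alpha))%:E * (D (k + 2)%N)%:E))%E).
    apply: lee_nneseries => k _.
      move=> _; apply: mule_ge0; first by rewrite lee_fin mulr_ge0 ?powR_ge0 ?(ltW C10).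
      by apply: integral_ge0 => y _; rewrite lee_fin normc_ge0.
    apply: (@le_trans _ _ ((C1 * (2 * r * 2 ^+ k) `^ (alpha - n%:R))%:E *
        ((r * 2 ^+ (k + 2)) `^ (n%:R - alpha) * D (k + 2)%N)%:E)%E).
      apply: lee_wpmul2l; first by rewrite lee_fin mulr_ge0 ?powR_ge0 ?(ltW C10).
      apply: le_trans (hD (k + 2)%N); rewrite r2k.
      apply: le_integral_ge0 => y _; first by rewrite lee_fin normc_ge0.
      by rewrite lee_fin /h2 normc_cut; case: ifP => // _; exact: normc_ge0.
    rewrite -!EFinM lee_fin -r2k.
    have -> : 2 * r * 2 ^+ k.+1 = 2 * (2 * r * 2 ^+ k) by rewrite exprS; ring.
    move: (2 * r * 2 ^+ k) (rk k) => z z0.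
    rewrite [(2 * z) `^ _]powRM ?(ltW z0)// -(opprB n%:R alpha) powRN.
    rewrite le_eqVlt; apply/orP; left; apply/eqP; field.
    by rewrite gt_eqF// powR_gt0.
  rewrite nneseriesZl; last by move=> k _; rewrite lee_fin.
  rewrite [leRHS]EFinM; apply: lee_wpmul2l.
    by rewrite lee_fin mulr_ge0 ?powR_ge0 ?(ltW C10).
  apply: le_trans hS.
  by apply: (@shift_series R (fun k => (D k)%:E)) => k; rewrite lee_fin.
split; first by apply: le_lt_trans le1 _; exact: ltry.
rewrite -lee_fin; apply: le_trans (hA h2 x mh2) _.
rewrite -[_ * S]mulrA [leRHS]EFinM; apply: lee_wpmul2l; last exact: le1.
by rewrite lee_fin ltW.
Qed.

End splitting.

(** * The operator on a time slice *)

(** Reduces a bound between norms to finite values M of the norm on the right,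
which keeps extended reals out of the estimates on balls. *)
Lemma le_norm_scale (R : realType) (x y : \bar R) (K : R) : 0 < K -> (0 <= x)%E ->
  (forall M, 0 < M -> (x <= M%:E)%E -> (y <= (K * M)%:E)%E) -> (y <= K%:E * x)%E.
Proof.
move=> K0; case: x => [x| |]//; last by move=> _ _; rewrite gt0_muley ?lte_fin// leey.
rewrite lee_fin => x0 h; apply/lee_addgt0Pr => e e0.
have e' : 0 < e / K by rewrite divr_gt0.
apply: le_trans (h (x + e / K) _ _) _.
- by rewrite ltr_wpDl.
- by rewrite lee_fin lerDl ltW.
by rewrite -EFinM -EFinD lee_fin mulrDr lerD2l mulrCA mulfV ?gt_eqF// mulr1.
Qed.

Section slices.
Context {R : realType} (n : nat) (alpha p q : R).
Local Notation Rn := (n.-tuple R).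
Local Notation Fn := (Rn -> R[i]).
Local Notation mu := (@leb R n).
Hypotheses (an : 0 < alpha < n%:R) (hp : 1 <= p < n%:R / alpha)
  (hq : q^-1 = p^-1 - alpha / n%:R).

Let n0 := natR_gt0 an.
Let p0 := p_gt0 hp.
Let q0 := q_gt0 an hp hq.
Let pV0 : 0 < p^-1. Proof. by rewrite invr_gt0. Qed.
Let qV0 : 0 < q^-1. Proof. by rewrite invr_gt0. Qed.

Variables (w1 w2 : Rn -> R) (psi1 psi2 : Rn -> R -> R).
Hypotheses (ww1 : is_weight w1) (ww2 : is_weight w2).
Hypotheses (hpsi1 : forall a r, 0 < r -> 0 < psi1 a r)
  (hpsi2 : forall a r, 0 < r -> 0 < psi2 a r).
Variable P : R -> Rn -> Rn -> R[i].
Hypothesis mP : cmeasurable [set u : R * (Rn * Rn) | 0 < u.1]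
  (fun u : R * (Rn * Rn) => P u.1 u.2.1 u.2.2).
Hypothesis gaussP : gaussian_bound P.
Local Notation N := (fractional_power alpha P).
Local Notation U a r := (wmeas (wpow w2 q) (eball a r)).
Local Notation W a r := (wmeas (wpow w1 p) (eball a r)).
Local Notation MX := (Morrey p (wpow w1 p) psi1).
Local Notation F := (Fball p w1).
Local Notation Ub := (Uball q w2).
Variables (Cd Kd Ct : R).
Hypotheses (Cd0 : 0 < Cd) (hCd : dual_bound alpha p q Cd w1 w2).
Hypotheses (Kd0 : 0 < Kd)
  (hKd : forall a r, 0 < r -> (U a (2 * r) `^ q^-1 <= Kd%:E * U a r `^ q^-1)%E).
Hypothesis fW : forall a r, W a r \is a fin_num.
Hypotheses (Ct0 : 0 < Ct) (tail1 : forall f M a r, cmeasurable setT f -> 0 < M ->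
  (fnorm MX f <= M%:E)%E -> 0 < r ->
  (\sum_(0 <= k <oo) (F f a (r * 2 ^+ k) / Ub a (r * 2 ^+ k))%:E
   <= (Ct * M * psi2 a r)%:E)%E).

Let fU a r (r0 : 0 < r) : U a r \is a fin_num := (hCd a r0).1.

Lemma Fball_ge0 f a r : 0 <= F f a r.
Proof. by rewrite fine_ge0// Lp_norm_ge0. Qed.

Lemma Uball_dual a r : 0 < r -> (U a r `^ q^-1 = (Ub a r)%:E)%E.
Proof. by move=> r0; apply: UballE => // *; exact: fU. Qed.

Lemma Uball_dual_gt0 a r : 0 < r -> 0 < Ub a r.
Proof.
by move=> r0; rewrite -lte_fin -Uball_dual//; apply: poweR_gt0; apply: wmeas_wpow_gt0.
Qed.

Lemma L1_ball_le (f : Fn) M a r : cmeasurable setT f -> (fnorm MX f <= M%:E)%E -> 0 < r ->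
  (\int[mu]_(y in eball a r) (normc (f y))%:E <=
   (r `^ (n%:R - alpha) * (Cd * (F f a r / Ub a r)))%:E)%E.
Proof.
move=> mf hM r0; have [_ h] := hCd a r0.
have := h (fun y => normc (f y)) (measurable_normc mf) (fun y => normc_ge0 _).
have hF := Lp_norm_fin ww1 hpsi1 fW a hM r0; rewrite /Lp_norm in hF; rewrite hF Uball_dual//.
have u0 := Uball_dual_gt0 a r0.
rewrite muleC -EFinM -lee_pdivlMl// -EFinM => /le_trans; apply.
by rewrite lee_fin le_eqVlt; apply/orP; left; apply/eqP; field; rewrite gt_eqF.
Qed.

(** The first conclusion is the term k = 1 of the tail series combined with
doubling; it controls the norm of f on B(a, 2 r), on which the near part
lives. The second is the near-far splitting. *)
Lemma slice_decomposition : exists2 C : R, 0 < C &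
  forall (f : Fn) M a r, cmeasurable setT f -> 0 < M -> (fnorm MX f <= M%:E)%E -> 0 < r ->
    F f a (2 * r) <= C * M * psi2 a r * Ub a r /\
    {ae mu, forall x, eball a r x ->
      normc (N f x) <= normc (N (cut (eball a (2 * r)) f) x) + C * M * psi2 a r}.
Proof.
have [C1 C10 split] := fractional_power_split an mP gaussP.
exists (Ct * Kd + C1 * Cd * Ct); first by rewrite addr_gt0 ?mulr_gt0.
move=> f M a r mf M0 hM r0.
have r2 k : 0 < r * 2 ^+ k by rewrite mulr_gt0 ?exprn_gt0.
have ps0 := hpsi2 a r0.
pose G k := F f a (r * 2 ^+ k) / Ub a (r * 2 ^+ k).
have G0 k : 0 <= G k by rewrite divr_ge0 ?Fball_ge0// ltW// Uball_dual_gt0.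
have hG := tail1 a mf M0 hM r0.
have hD : (\sum_(0 <= k <oo) (Cd * G k)%:E <= (Cd * (Ct * M * psi2 a r))%:E)%E.
  under eq_eseriesr do rewrite EFinM.
  rewrite nneseriesZl; last by move=> k _; rewrite lee_fin.
  by rewrite EFinM; apply: lee_wpmul2l; [rewrite lee_fin ltW|exact: hG].
split.
  have : ((G 1%N)%:E <= (Ct * M * psi2 a r)%:E)%E.
    apply: le_trans hG; apply: (@term_le_series R (fun k => (G k)%:E)) => k.
    by rewrite lee_fin.
  rewrite lee_fin /G expr1 (mulrC r) => h1.
  have r20 : 0 < 2 * r by rewrite mulr_gt0.
  have U1 := Uball_dual_gt0 a r0; have U2 := Uball_dual_gt0 a r20.
  have UU : Ub a (2 * r) <= Kd * Ub a r.
    by have h := hKd a r0; rewrite (Uball_dual a r0) (Uball_dual a r20) -EFinM lee_fin in h.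
  rewrite (ler_pdivrMr _ _ U2) in h1; apply: (le_trans h1).
  apply: (@le_trans _ _ (Ct * M * psi2 a r * (Kd * Ub a r))).
    by apply: ler_wpM2l UU; exact: (ltW (mulr_gt0 (mulr_gt0 Ct0 M0) ps0)).
  rewrite mulrA; apply: (ler_wpM2r (ltW U1)).
  have -> : Ct * M * psi2 a r * Kd = (Ct * Kd) * M * psi2 a r by ring.
  apply: (ler_wpM2r (ltW ps0)); apply: (ler_wpM2r (ltW M0)); rewrite lerDl.
  exact: (ltW (mulr_gt0 (mulr_gt0 C10 Cd0) Ct0)).
have D0 k : 0 <= Cd * G k by rewrite mulr_ge0// ltW.
have [near far] := split f a r _ (fun k => Cd * G k) mf r0 D0
  (fun k => L1_ball_le a mf hM (r2 k)) hD.
have mB := @measurable_eball R n a (2 * r).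
have m1 := cmeasurable_cut mB mf; have m2 := cmeasurable_cut (measurableC mB) mf.
apply: filterS near => x hx ax; have [fin2 le2] := far x ax.
rewrite {1}(cutD (eball a (2 * r)) f) (fractional_powerD mP m1 m2 (hx ax) fin2).
apply: le_trans (normcD_le _ _) _; rewrite lerD2l; apply: (le_trans le2).
have -> : C1 * (Cd * (Ct * M * psi2 a r)) = C1 * Cd * Ct * M * psi2 a r by ring.
apply: (ler_wpM2r (ltW ps0)); apply: (ler_wpM2r (ltW M0)); rewrite lerDr.
exact: (ltW (mulr_gt0 Ct0 Kd0)).
Qed.

Lemma sup_balls_le (G : Rn -> R -> \bar R) (B : \bar R) :
  (forall a r, 0 < r -> (G a r <= B)%E) -> (sup_balls G <= B)%E.
Proof. by move=> h; apply: ge_ereal_sup => _ [[a r] /= r0 <-]; exact: h. Qed.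

Lemma Morrey_norm_ge0 (p' : R) w psi (f : Fn) : (forall a r, 0 < r -> 0 < psi a r) ->
  (0 <= fnorm (Morrey p' w psi) f)%E.
Proof.
move=> ps; apply: le_ereal_sup_tmp; eexists.
  by exists ([tuple of nseq n 0], 1) => //=; exact: ltr01.
rewrite /=; apply: mule_ge0; last exact: poweR_ge0.
by apply: mule_ge0; [rewrite lee_fin invr_ge0 ltW// ps|rewrite inve_ge0 poweR_ge0].
Qed.

Lemma WMorrey_norm_ge0 (p' : R) w psi (f : Fn) : (forall a r, 0 < r -> 0 < psi a r) ->
  (0 <= fnorm (WMorrey p' w psi) f)%E.
Proof.
move=> ps; apply: le_ereal_sup_tmp; eexists.
  by exists ([tuple of nseq n 0], 1) => //=; exact: ltr01.
rewrite /=; apply: mule_ge0.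
  by apply: mule_ge0; [rewrite lee_fin invr_ge0 ltW// ps|rewrite inve_ge0 poweR_ge0].
apply: le_ereal_sup_tmp; eexists; first by exists 1 => //=; exact: ltr01.
by rewrite mul1e poweR_ge0.
Qed.

Lemma ball_normalize (X : \bar R) (B : R) a r : 0 < r ->
  (X <= (B * psi2 a r * Ub a r)%:E)%E ->
  ((psi2 a r)^-1%:E * (U a r `^ q^-1)^-1 * X <= B%:E)%E.
Proof.
move=> r0 h; have ps0 := hpsi2 a r0; have u0 := Uball_dual_gt0 a r0.
rewrite Uball_dual// inver gt_eqF// -EFinM -invfM lee_pdivrMl ?mulr_gt0//.
by rewrite -EFinM; apply: le_trans h _; rewrite lee_fin [leRHS]mulrC mulrA.
Qed.

Lemma cut_in_Lp f M a r : cmeasurable setT f -> (fnorm MX f <= M%:E)%E -> 0 < r ->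
  in_fspace (Lp p (wpow w1 p)) (cut (eball a r) f) /\
  fnorm (Lp p (wpow w1 p)) (cut (eball a r) f) = (F f a r)%:E.
Proof.
move=> mf hM r0; have mB := @measurable_eball R n a r.
have E : fnorm (Lp p (wpow w1 p)) (cut (eball a r) f) = (F f a r)%:E.
  by rewrite /= Lp_norm_cut//; rewrite (Lp_norm_fin ww1 hpsi1 fW a hM r0).
split => //; split; first exact: cmeasurable_cut.
by rewrite E ltry.
Qed.

Lemma slice_strong K0 : 0 < K0 ->
  bounded_by K0 (Lp p (wpow w1 p)) (Lp q (wpow w2 q)) N ->
  exists2 K : R, 0 < K & forall f, cmeasurable setT f ->
    (fnorm (Morrey q (wpow w2 q) psi2) (N f) <= K%:E * fnorm MX f)%E.
Proof.
move=> K00 bN; have [C C0 dec] := slice_decomposition.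
pose K := 2 * 2 `^ q^-1 * (K0 * C + C).
have p2 : 0 < 2 `^ q^-1 :> R by rewrite powR_gt0.
have Kgt0 : 0 < K by rewrite !mulr_gt0// addr_gt0// mulr_gt0.
exists K => // f mf; apply: le_norm_scale => //; first exact: Morrey_norm_ge0.
move=> M M0 hM; apply: sup_balls_le => a r r0; apply: ball_normalize => //.
have [F2 hae] := dec f M a r mf M0 hM r0.
have r20 : 0 < 2 * r by rewrite mulr_gt0.
have [in1 E1] := cut_in_Lp a mf hM r20.
have [[mN1 _] b1] := bN _ in1; rewrite E1 in b1.
set f1 := cut _ f in mN1 b1 hae.
have mB := @measurable_eball R n a r.
have ps0 := hpsi2 a r0; have u0 := Uball_dual_gt0 a r0.
have mNf : cmeasurable setT (N f) by exact: cmeasurable_fractional_power.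
have T0 : 0 <= C * M * psi2 a r by exact: (ltW (mulr_gt0 (mulr_gt0 C0 M0) ps0)).
have mw2 := measurable_wpow q ww2.
have := @Lp_norm_add_le R n q (wpow w2 q) (eball a r) q0 mB mw2 (fun x => powR_ge0 _ _)
  (N f) (fun x => normc (N f1 x)) (cst (C * M * psi2 a r)) mNf
  (measurable_normc mN1) (measurable_cst _) (fun x => normc_ge0 _) (fun x => T0) hae.
move=> /le_trans; apply.
have le1 : ((\int[mu]_(x in eball a r) (normc (N f1 x) `^ q * wpow w2 q x)%:E) `^ q^-1 <=
    (K0 * (C * M * psi2 a r * Ub a r))%:E)%E.
  apply: (@le_trans _ _ (fnorm (Lp q (wpow w2 q)) (N f1))).
    exact: (Lp_norm_mono q0 mB measurableT mw2 (fun x => powR_ge0 _ _) mN1 (@subsetT _ _)).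
  apply: (le_trans b1); rewrite -EFinM lee_fin.
  by apply: ler_wpM2l => //; exact: ltW.
have le2 : ((\int[mu]_(x in eball a r) (cst (C * M * psi2 a r)%R x `^ q * wpow w2 q x)%:E) `^ q^-1 =
    (C * M * psi2 a r * Ub a r)%:E)%E.
  have Tq0 : 0 <= (C * M * psi2 a r) `^ q by exact: powR_ge0.
  have mwE : measurable_fun (eball a r) (fun x => (wpow w2 q x)%:E).
    by apply: measurable_funTS; apply/measurable_EFinP.
  have w0 x : eball a r x -> (0 <= (wpow w2 q x)%:E)%E by rewrite lee_fin powR_ge0.
  under eq_integral do rewrite /= EFinM.
  rewrite (@ge0_integralZl_EFin _ _ _ mu _ mB _ w0 mwE _ Tq0) -/(wmeas _ _).
  rewrite poweRM ?lee_fin//; last by apply: wmeas_ge0 => x; exact: powR_ge0.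
  by rewrite Uball_dual// poweR_EFin -powRrM mulfV ?gt_eqF// powRr1// -EFinM.
rewrite le2; apply: (@le_trans _ _ ((2 * 2 `^ q^-1)%:E *
   ((K0 * (C * M * psi2 a r * Ub a r))%:E + (C * M * psi2 a r * Ub a r)%:E))%E).
  apply: lee_wpmul2l; last exact: leeD2r.
  by rewrite lee_fin; exact: (ltW (mulr_gt0 (ltr0Sn R 1) p2)).
rewrite -EFinD -EFinM lee_fin /K le_eqVlt; apply/orP; left; apply/eqP; ring.
Qed.

Lemma slice_weak K0 : 0 < K0 ->
  bounded_by K0 (Lp p (wpow w1 p)) (WLp q (wpow w2 q)) N ->
  exists2 K : R, 0 < K & forall f, cmeasurable setT f ->
    (fnorm (WMorrey q (wpow w2 q) psi2) (N f) <= K%:E * fnorm MX f)%E.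
Proof.
move=> K00 bN; have [C C0 dec] := slice_decomposition.
pose K := 2 * (K0 * C + C).
have Kgt0 : 0 < K by rewrite !mulr_gt0// addr_gt0// mulr_gt0.
exists K => // f mf; apply: le_norm_scale => //; first exact: Morrey_norm_ge0.
move=> M M0 hM; apply: sup_balls_le => a r r0; apply: ball_normalize => //.
have [F2 hae] := dec f M a r mf M0 hM r0.
have r20 : 0 < 2 * r by rewrite mulr_gt0.
have [in1 E1] := cut_in_Lp a mf hM r20.
have [[mN1 _] b1] := bN _ in1; rewrite E1 in b1.
set f1 := cut _ f in mN1 b1 hae.
have mB := @measurable_eball R n a r.
have ps0 := hpsi2 a r0; have u0 := Uball_dual_gt0 a r0.
have mNf : cmeasurable setT (N f) by exact: cmeasurable_fractional_power.
have T0 : 0 <= C * M * psi2 a r by exact: (ltW (mulr_gt0 (mulr_gt0 C0 M0) ps0)).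
have mw2 := measurable_wpow q ww2.
have := @WLp_norm_add_le R n q (wpow w2 q) (eball a r) q0 mB mw2 (fun x => powR_ge0 _ _)
  (N f) (N f1) (C * M * psi2 a r) mNf mN1 T0 hae.
move=> /le_trans; apply.
have le1 : (WLp_norm q (wpow w2 q) (eball a r) (N f1) <=
    (K0 * (C * M * psi2 a r * Ub a r))%:E)%E.
  apply: (@le_trans _ _ (fnorm (WLp q (wpow w2 q)) (N f1))).
    apply: ge_ereal_sup => _ [g /= g0 <-].
    apply: le_ereal_sup_tmp; eexists; first by exists g.
    apply: lee_wpmul2l; first by rewrite lee_fin ltW.
    apply: lee_poweR; first exact: ltW.
      by apply: wmeas_ge0 => x; exact: powR_ge0.
    have mS : measurable [set x | g < normc (N f1 x)].
      have := measurable_normc mN1.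
      move=> /(_ measurableT `]g, +oo[%classic (measurable_itv _)); rewrite setTI.
      by congr (measurable _); apply/seteqP; split => x /=; rewrite in_itv/= andbT.
    apply: ge0_subset_integral.
    - exact: measurableI.
    - exact: measurableI.
    - by apply: measurable_funTS; apply/measurable_EFinP.
    - by move=> x _; rewrite lee_fin powR_ge0.
    - by move=> x [_ ?].
  apply: (le_trans b1); rewrite -EFinM lee_fin.
  by apply: ler_wpM2l => //; exact: ltW.
rewrite Uball_dual// -EFinM; apply: (@le_trans _ _ (2%:E *
   ((K0 * (C * M * psi2 a r * Ub a r))%:E + (C * M * psi2 a r * Ub a r)%:E))%E).
  by apply: lee_wpmul2l; [rewrite lee_fin|exact: leeD2r].
rewrite -EFinD -EFinM lee_fin /K le_eqVlt; apply/orP; left; apply/eqP; ring.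
Qed.

End slices.

(** * The John-Nirenberg inequality on dyadic trees *)

Section dyadic_tree.
Context {R : realType} (n : nat).
Local Notation Rn := (n.-tuple R).
Local Notation mu := (@leb R n).
Implicit Types (o x : Rn) (l : R) (e : n.-tuple bool).

(** The bits of e choose, in each coordinate, the lower or the upper half of the
cube of corner o and side l. *)
Definition child o l e : Rn := [tuple tnth o i + (tnth e i)%:R * (l / 2) | i < n].

Definition child_index o l x : n.-tuple bool := [tuple (tnth o i + l / 2 <= tnth x i) | i < n].

Lemma mem_child o l e x : 0 < l ->
  cube (child o l e) (l / 2) x <-> cube o l x /\ child_index o l x = e.
Proof.
move=> l0; have l20 : 0 < l / 2 by rewrite divr_gt0.
split.
  move=> h; split.
    move=> i; have := h i; rewrite tnth_mktuple => /andP[h1 h2]; apply/andP; split.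
      by apply: le_trans h1; rewrite lerDl mulr_ge0// ltW.
    apply: (lt_le_trans h2); rewrite -addrA lerD2l.
    by case: (tnth e i); rewrite ?mul1r ?mul0r; lra.
  apply: eq_from_tnth => i; rewrite tnth_mktuple; have := h i; rewrite tnth_mktuple.
  case: (tnth e i); rewrite ?mul1r ?mul0r ?addr0; first by case/andP.
  by move=> /andP[_]; rewrite ltNge => /negbTE.
move=> [h <-] i; rewrite !tnth_mktuple; have /andP[h1 h2] := h i.
case: (leP (tnth o i + l / 2) (tnth x i)) => h3; rewrite ?mul1r ?mul0r ?addr0.
  by rewrite h3/=; move: h2; rewrite -addrA; have -> : l / 2 + l / 2 = l by lra.
by rewrite h1.
Qed.

Lemma child_sub o l e : 0 < l -> cube (child o l e) (l / 2) `<=` cube o l.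
Proof. by move=> l0 x /(mem_child _ _ _ l0)[]. Qed.

Lemma integral_children (h : Rn -> \bar R) o l : 0 < l -> measurable_fun setT h ->
  (forall x, 0 <= h x)%E ->
  (\int[mu]_(x in cube o l) h x =
   \sum_(e : n.-tuple bool) \int[mu]_(x in cube (child o l e) (l / 2)) h x)%E.
Proof.
move=> l0 mh h0.
transitivity (\int[mu]_x \sum_(e : n.-tuple bool) (h \_ (cube (child o l e) (l / 2))) x)%E.
  rewrite integral_mkcond; apply: eq_integral => x _.
  rewrite patchE; case: ifPn => [|] xo.
    rewrite (bigD1 (child_index o l x))//= patchE mem_set; last first.
      by apply/mem_child => //; split => //; move: xo; rewrite inE.
    rewrite big1 ?adde0// => e ne; rewrite patchE memNset// => /(mem_child _ _ _ l0)[_ E].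
    by rewrite E eqxx in ne.
  rewrite big1// => e _; rewrite patchE memNset// => /(child_sub l0) xo'.
  by move: xo; rewrite notin_setE.
rewrite ge0_integral_sum//; last 2 first.
- move=> e; apply/(measurable_restrictT _ _).1; first exact: measurable_cube.
  exact: measurable_funTS.
- by move=> e x _; rewrite patchE; case: ifP.
by apply: eq_bigr => e _; rewrite [RHS]integral_mkcond.
Qed.

Lemma leb_cube_children (l : R) : 0 <= l -> l ^+ n = 2 ^+ n * (l / 2) ^+ n.
Proof. by move=> l0; rewrite -exprMn mulrC divfK. Qed.

Section stopping.
Variables (b : Rn -> R) (av : Rn -> R -> R) (v : Rn -> R).
Hypotheses (mv : measurable_fun setT v) (v0 : forall x, 0 <= v x)
  (mb : measurable_fun setT b).

Definition osc o l (c : R) : \bar R := \int[mu]_(x in cube o l) `|b x - c|%:E.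

Hypothesis av_osc : forall o l c, 0 < l -> ((l ^+ n * `|av o l - c|)%:E <= osc o l c)%E.
Variable B : R.
Hypothesis B0 : 0 < B.
Hypothesis bmoB : forall o l, 0 < l -> (osc o l (av o l) <= (B * l ^+ n)%:E)%E.
Variable m : R.
Hypothesis m0 : 0 < m.

Local Notation nu o l := (wmeas v (cube o l)).

(** The integral of exp(m |b_j - c|) against v over the cube, where b_j is the
average of b over the j-th dyadic generation (tree_exp_integral). The recursive
form is what the induction uses. *)
Fixpoint tree_exp (j : nat) o l (c : R) : \bar R :=
  if j is j'.+1 then (\sum_(e : n.-tuple bool) tree_exp j' (child o l e) (l / 2) c)%E
  else ((expR (m * `|av o l - c|))%:E * nu o l)%E.

Let nu0 E : (0 <= wmeas v E)%E. Proof. exact: wmeas_ge0. Qed.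

Lemma measurable_osc_fun (c : R) : measurable_fun setT (fun x => `|b x - c|%:E).
Proof.
by apply/measurable_EFinP; apply: measurableT_comp => //; apply: measurable_funB.
Qed.

Lemma osc_children o l c : 0 < l ->
  osc o l c = (\sum_(e : n.-tuple bool) osc (child o l e) (l / 2) c)%E.
Proof.
by move=> l0; apply: integral_children => //; exact: measurable_osc_fun.
Qed.

Lemma nu_children o l : 0 < l ->
  nu o l = (\sum_(e : n.-tuple bool) nu (child o l e) (l / 2))%E.
Proof.
move=> l0; apply: integral_children => //; exact/measurable_EFinP.
Qed.

Lemma tree_exp_ge0 j o l c : (0 <= tree_exp j o l c)%E.
Proof.
elim: j o l => [|j IH] o l /=; first by rewrite mule_ge0// lee_fin expR_ge0.
by apply: sume_ge0 => e _; exact: IH.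
Qed.

Lemma tree_exp_shift j o l c c' :
  (tree_exp j o l c <= (expR (m * `|c' - c|))%:E * tree_exp j o l c')%E.
Proof.
elim: j o l => [|j IH] o l /=.
  rewrite muleA -EFinM -expRD; apply: lee_wpmul2r; first exact: nu0.
  rewrite lee_fin ler_expR -mulrDr ler_pM2l//.
  have -> : av o l - c = (c' - c) + (av o l - c') by ring.
  exact: ler_normD.
rewrite ge0_sume_distrr; last by move=> e _; exact: tree_exp_ge0.
by apply: lee_sum => e _; exact: IH.
Qed.

Variables (G : R).
Hypothesis G0 : 0 <= G.

Let a1 := expR (m * (2 * B)).
Let a2 := expR (m * (2 ^+ n * (2 * B))) * G.
Let a10 : 0 <= a1. Proof. exact: expR_ge0. Qed.
Let a20 : 0 <= a2. Proof. by rewrite mulr_ge0// expR_ge0. Qed.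

(** S stands for the union of the maximal dyadic subcubes of generation at most j
on which the mean oscillation about c reaches 2 B. Its volume is controlled by
the oscillation; outside S the averages stay within 2 B of c, and inside S the
bound G for the remaining generations applies. *)
Definition stopped j o l c := exists S : set Rn, [/\ measurable S,
  ((2 * B)%:E * \int[mu]_(x in cube o l) (\1_S x)%:E <= osc o l c)%E &
  (tree_exp j o l c <= a1%:E * nu o l + a2%:E * \int[mu]_(x in cube o l) (v x * \1_S x)%:E)%E].

Lemma stopped_children j o l c : 0 < l ->
  (forall e, stopped j (child o l e) (l / 2) c) -> stopped j.+1 o l c.
Proof.
move=> l0 /choice[S hS].
pose T := \bigcup_(e in [set: n.-tuple bool]) (S e `&` cube (child o l e) (l / 2)).
have TS e x : cube (child o l e) (l / 2) x -> \1_T x = \1_(S e) x :> R.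
  move=> xe; rewrite !indicE; congr (nat_of_bool _)%:R; apply/idP/idP; rewrite !inE.
    move=> [e' _ [Sx]] /(mem_child _ _ _ l0)[_ E']; move/(mem_child _ _ _ l0) : xe => [_ E].
    by rewrite -E E'.
  by move=> Sx; exists e.
have mT : measurable T.
  apply: fin_bigcup_measurable => // e _; apply: measurableI; last exact: measurable_cube.
  by have [] := hS e.
have indT0 x : (0 <= (\1_T x)%:E :> \bar R)%E by rewrite lee_fin indicE.
have vT0 x : (0 <= (v x * \1_T x)%:E)%E by rewrite lee_fin mulr_ge0// indicE.
have mindT : measurable_fun setT (\1_T : Rn -> R) by exact: measurable_indic.
exists T; split => //.
  rewrite integral_children//; last exact/measurable_EFinP.
  rewrite ge0_sume_distrr; last by move=> e _; apply: integral_ge0 => x _; exact: indT0.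
  rewrite osc_children//; apply: lee_sum => e _; have [_ + _] := hS e.
  apply: le_trans; rewrite le_eqVlt; apply/orP; left; apply/eqP; congr (_ * _)%E.
  by apply: eq_integral => x; rewrite inE => xe; rewrite (TS e x xe).
rewrite nu_children// integral_children//; last first.
  by apply/measurable_EFinP; exact: measurable_funM.
rewrite ge0_sume_distrr; last by move=> e _; exact: nu0.
rewrite ge0_sume_distrr; last by move=> e _; apply: integral_ge0 => x _; exact: vT0.
rewrite -big_split /=; apply: lee_sum => e _; have [_ _] := hS e.
move=> /le_trans; apply; rewrite leeD2l// le_eqVlt; apply/orP; left; apply/eqP; congr (_ * _)%E.
by apply: eq_integral => x; rewrite inE => xe; rewrite (TS e x xe).
Qed.

(** Either the cube is stopped at once, and S is the whole cube, or the
oscillation is small and its children satisfy the hypothesis, with the factor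
2^n lost in passing from the volume of the cube to that of a child. *)
Lemma stopped_of_bound j :
  (forall i o l, (i <= j)%N -> 0 < l -> (tree_exp i o l (av o l) <= G%:E * nu o l)%E) ->
  forall o l c, 0 < l -> (osc o l c <= (2 ^+ n * (2 * B) * l ^+ n)%:E)%E ->
  stopped j o l c.
Proof.
elim: j => [|j IH] hG o l c l0 hosc; have ln0 : 0 < l ^+ n by rewrite exprn_gt0.
all: have [big|small] := leP (2 * B * l ^+ n)%:E (osc o l c).
- exists setT; split; first exact: measurableT.
    rewrite (integral_indic mu (measurable_cube o l) measurableT) setTI.
    by rewrite [X in (_ * X <= _)%E](leb_cube o (ltW l0)) -EFinM.
  apply: (@le_trans _ _ (a2%:E * nu o l)%E); last first.
    rewrite indicT; under [X in (_ + _ * X)%E]eq_integral do rewrite mulr1.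
    by rewrite leeDr// mule_ge0// lee_fin.
  rewrite /a2 EFinM -muleA; apply: le_trans (tree_exp_shift _ _ _ _ (av o l)) _.
  apply: lee_pmul.
  + by rewrite lee_fin expR_ge0.
  + exact: tree_exp_ge0.
  + rewrite lee_fin ler_expR ler_pM2l// -(ler_pM2l ln0) [leRHS]mulrC -lee_fin.
    exact: le_trans (av_osc o c l0) hosc.
  + exact: hG.
- exists set0; split; first exact: measurable0.
    under eq_integral do rewrite indic0.
    by rewrite integral0 mule0; apply: integral_ge0 => x _; rewrite lee_fin.
  apply: (@le_trans _ _ (a1%:E * nu o l)%E); last first.
    by rewrite leeDl// mule_ge0 ?lee_fin//; apply: integral_ge0 => x _; rewrite lee_fin mulr_ge0// indicE.
  rewrite /=; apply: lee_wpmul2r; first exact: nu0.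
  rewrite lee_fin ler_expR ler_pM2l// -(ler_pM2l ln0) [leRHS]mulrC -lee_fin.
  exact: le_trans (av_osc o c l0) (ltW small).
- exists setT; split; first exact: measurableT.
    rewrite (integral_indic mu (measurable_cube o l) measurableT) setTI.
    by rewrite [X in (_ * X <= _)%E](leb_cube o (ltW l0)) -EFinM.
  apply: (@le_trans _ _ (a2%:E * nu o l)%E); last first.
    rewrite indicT; under [X in (_ + _ * X)%E]eq_integral do rewrite mulr1.
    by rewrite leeDr// mule_ge0// lee_fin.
  rewrite /a2 EFinM -muleA; apply: le_trans (tree_exp_shift _ _ _ _ (av o l)) _.
  apply: lee_pmul.
  + by rewrite lee_fin expR_ge0.
  + exact: tree_exp_ge0.
  + rewrite lee_fin ler_expR ler_pM2l// -(ler_pM2l ln0) [leRHS]mulrC -lee_fin.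
    exact: le_trans (av_osc o c l0) hosc.
  + exact: hG.
- apply: stopped_children => // e; apply: IH.
  + by move=> i o' l' ij; apply: hG; exact: leqW.
  + by rewrite divr_gt0.
  + apply: (@le_trans _ _ (osc o l c)).
      apply: ge0_subset_integral; try exact: measurable_cube.
      * by apply: measurable_funTS; exact: measurable_osc_fun.
      * by move=> x _; rewrite lee_fin.
      * exact: child_sub.
    apply: (le_trans (ltW small)); rewrite lee_fin (leb_cube_children (ltW l0)).
    by rewrite le_eqVlt; apply/orP; left; apply/eqP; ring.
Qed.

End stopping.

(** The A_infty property of v, in the quantitative form that the stopping-time
induction uses: a gain on sets that fill at most half of a cube. *)
Definition small_part_bound (v : Rn -> R) (d : R) := forall o l S, 0 < l -> measurable S ->
  (\int[mu]_(x in cube o l) (\1_S x)%:E <= (l ^+ n / 2)%:E)%E ->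
  (\int[mu]_(x in cube o l) (v x * \1_S x)%:E <= (1 - d)%:E * wmeas v (cube o l))%E.

Section john_nirenberg_tree.
Variables (b : Rn -> R) (av : Rn -> R -> R) (v : Rn -> R).
Hypotheses (mv : measurable_fun setT v) (v0 : forall x, 0 <= v x)
  (mb : measurable_fun setT b).
Hypothesis av_osc : forall o l c, 0 < l -> ((l ^+ n * `|av o l - c|)%:E <= osc b o l c)%E.
Variables (B d : R).
Hypotheses (B0 : 0 < B) (d01 : 0 < d <= 1).
Hypothesis bmoB : forall o l, 0 < l -> (osc b o l (av o l) <= (B * l ^+ n)%:E)%E.
Local Notation nu o l := (wmeas v (cube o l)).
Hypothesis weak : small_part_bound v d.

(** Chosen so that the factor exp(m 2^n 2 B) in the stopping estimate equals
1 + d, which is then compensated by the factor 1 - d of small_part_bound. *)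
Definition jn_exponent : R := ln (1 + d) / (2 ^+ n * (2 * B)).

Lemma jn_exponent_gt0 : 0 < jn_exponent.
Proof.
case/andP: d01 => d0 _.
by rewrite divr_gt0 ?mulr_gt0 ?exprn_gt0// ln_gt0// ltrDl.
Qed.

(** Stopping about the average of the cube gives a set S of at most half its
volume, so of mass at most 1 - d times that of the cube. With G = 2 / d^2 the
estimate reproduces itself, as (1 + d) + (1 + d) (1 - d) G <= G. *)
Lemma tree_exp_le j o l : 0 < l ->
  (tree_exp av v jn_exponent j o l (av o l) <= (2 / d ^+ 2)%:E * nu o l)%E.
Proof.
have m0 := jn_exponent_gt0.
case/andP: d01 => d0 d1.
have G0 : 0 < 2 / d ^+ 2 by rewrite divr_gt0// exprn_gt0.
have nu0 E : (0 <= wmeas v E)%E by exact: wmeas_ge0.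
have G1 : 1 <= 2 / d ^+ 2.
  rewrite ler_pdivlMr ?exprn_gt0// mul1r (@le_trans _ _ 1)// ?ler1n//.
  by rewrite expr_le1// ltW.
elim/ltn_ind: j o l => -[|j] IH o l l0.
  by rewrite /= subrr normr0 mulr0 expR0; apply: lee_wpmul2r; [exact: nu0|rewrite lee_fin].
have ln0 : 0 < l ^+ n by rewrite exprn_gt0.
have [S [mS hS hT]] : stopped b av v B jn_exponent (2 / d ^+ 2) j.+1 o l (av o l).
  apply: stopped_children => // e; apply: (stopped_of_bound mv v0 mb av_osc m0 (ltW G0)).
  - by move=> i o' l' ij l'0; apply: IH.
  - by rewrite divr_gt0.
  - apply: (@le_trans _ _ (osc b o l (av o l))).
      apply: ge0_subset_integral; try exact: measurable_cube.
      + by apply: measurable_funTS; exact: measurable_osc_fun.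
      + by move=> x _; rewrite lee_fin.
      + exact: child_sub.
    apply: (le_trans (bmoB o l0)); rewrite lee_fin (leb_cube_children (ltW l0)).
    have : 0 <= B * (2 ^+ n * (l / 2) ^+ n).
      by rewrite -(leb_cube_children (ltW l0)); exact: (ltW (mulr_gt0 B0 ln0)).
    lra.
have small : (\int[mu]_(x in cube o l) (\1_S x)%:E <= (l ^+ n / 2)%:E)%E.
  have B20 : 0 < 2 * B by rewrite mulr_gt0.
  have := le_trans hS (bmoB o l0); rewrite -lee_pdivlMl// -EFinM.
  have -> // : (2 * B)^-1 * (B * l ^+ n) = l ^+ n / 2.
  by field; rewrite gt_eqF.
have hv := weak l0 mS small.
have e1 : expR (jn_exponent * (2 ^+ n * (2 * B))) = 1 + d.
  rewrite /jn_exponent divfK ?lnK// ?posrE ?addr_gt0//.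
  by rewrite gt_eqF// mulr_gt0 ?exprn_gt0// mulr_gt0.
have e2 : expR (jn_exponent * (2 * B)) <= 1 + d.
  rewrite -e1 ler_expR ler_pM2l// ler_peMl ?(ltW (mulr_gt0 (ltr0Sn R 1) B0))//.
  by rewrite exprn_ege1// ler1n.
apply: (le_trans hT); rewrite e1.
apply: (@le_trans _ _ ((1 + d)%:E * nu o l +
    ((1 + d) * (2 / d ^+ 2))%:E * ((1 - d)%:E * nu o l))%E).
  apply: leeD; first by apply: lee_wpmul2r; [exact: nu0|rewrite lee_fin].
  apply: lee_wpmul2l => //; rewrite lee_fin.
  by apply: mulr_ge0; [rewrite addr_ge0// ltW|exact: ltW].
rewrite muleA -EFinM -ge0_muleDl ?lee_fin; last 2 first.
- by rewrite addr_ge0// ltW.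
- by rewrite !mulr_ge0 ?subr_ge0 ?addr_ge0 ?invr_ge0 ?exprn_ge0 ?(ltW d0).
apply: lee_wpmul2r; first exact: nu0.
rewrite -EFinD lee_fin.
have -> : 1 + d + (1 + d) * (2 / d ^+ 2) * (1 - d) = 2 / d ^+ 2 + (d - 1).
  by field; rewrite gt_eqF.
lra.
Qed.

End john_nirenberg_tree.

Section dyadic_average.
Variable av : Rn -> R -> R.

Fixpoint dyadic_avg (j : nat) o l x : R :=
  if j is j'.+1 then dyadic_avg j' (child o l (child_index o l x)) (l / 2) x else av o l.

Lemma measurable_dyadic_avg j o l : 0 < l -> measurable_fun setT (dyadic_avg j o l).
Proof.
elim: j o l => [|j IH] o l l0 /=; first exact: measurable_cst.
rewrite (_ : (fun x => _) = (fun x => \sum_(e : n.-tuple bool)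
    (dyadic_avg j (child o l e) (l / 2) x * \1_[set x | child_index o l x = e] x))); last first.
  apply/funext => x; rewrite (bigD1 (child_index o l x))//= indicE mem_set// mulr1 big1 ?addr0//.
  by move=> e ne; rewrite indicE memNset ?mulr0// => E /=; rewrite -E eqxx in ne.
apply: measurable_sum => e; apply: measurable_funM; first by apply: IH; rewrite divr_gt0.
apply: measurable_indic.
rewrite (_ : [set x | _] = \bigcap_(i in [set: 'I_n])
    [set x | (tnth o i + l / 2 <= tnth x i) = tnth e i]); last first.
  apply/seteqP; split => x /=.
    by move=> <- i _ /=; rewrite tnth_mktuple.
  by move=> h; apply: eq_from_tnth => i; rewrite tnth_mktuple h.
apply: fin_bigcap_measurable => // i _.
have mge : measurable [set x : Rn | tnth o i + l / 2 <= tnth x i].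
  rewrite (_ : [set x | _] = (fun x => tnth x i) @^-1` `[tnth o i + l / 2, +oo[%classic).
    by rewrite -[X in measurable X]setTI; exact: measurable_tnth.
  by apply/seteqP; split => x /=; rewrite in_itv/= andbT.
case: (tnth e i); first by rewrite (_ : [set x | _] = [set x : Rn | tnth o i + l / 2 <= tnth x i]).
rewrite (_ : [set x | _] = ~` [set x : Rn | tnth o i + l / 2 <= tnth x i]).
  exact: measurableC.
by apply/seteqP; split => x /=; [move=> -> //|move=> /negP/negbTE].
Qed.

Lemma dyadic_avg_child j o l e x : 0 < l -> cube (child o l e) (l / 2) x ->
  dyadic_avg j.+1 o l x = dyadic_avg j (child o l e) (l / 2) x.
Proof. by move=> l0 /(mem_child _ _ _ l0)[_ /= ->]. Qed.

Lemma tree_exp_integral (v : Rn -> R) (m : R) j o l c : 0 < l ->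
  measurable_fun setT v -> (forall x, 0 <= v x) ->
  (tree_exp av v m j o l c =
   \int[mu]_(x in cube o l) (expR (m * `|dyadic_avg j o l x - c|) * v x)%:E)%E.
Proof.
move=> l0 mv v0.
have mE i o' l' : 0 < l' ->
    measurable_fun setT (fun x => (expR (m * `|dyadic_avg i o' l' x - c|) * v x)%:E).
  move=> l'0; apply/measurable_EFinP; apply: measurable_funM => //.
  apply: (measurableT_comp (@measurable_expR R)); apply: measurable_funM => //.
  apply: measurableT_comp => //; apply: measurable_funB => //; exact: measurable_dyadic_avg.
elim: j o l l0 => [|j IH] o l l0.
  have mvE : measurable_fun (cube o l) (fun x => (v x)%:E).
    by apply: measurable_funTS; exact/measurable_EFinP.
  have vE0 x : cube o l x -> (0 <= (v x)%:E)%E by rewrite lee_fin.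
  rewrite /= /wmeas.
  rewrite -(@ge0_integralZl_EFin _ _ _ mu _ (measurable_cube o l) _ vE0 mvE _ (expR_ge0 _)).
  by apply: eq_integral => x _; rewrite -EFinM.
rewrite [RHS]integral_children//; last 2 first.
- exact: mE.
- by move=> x; rewrite lee_fin mulr_ge0// expR_ge0.
rewrite [LHS]/=; apply: eq_bigr => e _; rewrite (IH _ _ (divr_gt0 l0 (ltr0Sn R 1))); apply: eq_integral => x; rewrite inE => xe.
by rewrite (dyadic_avg_child j l0 xe).
Qed.

End dyadic_average.
End dyadic_tree.

(** * Convergence of dyadic averages *)

Section dyadic_differentiation.
Context {R : realType} (n : nat).
Local Notation Rn := (n.-tuple R).
Local Notation mu := (@leb R n).
Implicit Types (o x : Rn) (l : R) (e : n.-tuple bool) (f g h : Rn -> R).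

Definition cube_avg f o l : R := (l ^+ n)^-1 * Rintegral mu (cube o l) f.

Definition integrable_on o l f := mu.-integrable (cube o l) (EFin \o f).

Lemma integrable_on_child o l e f : 0 < l -> integrable_on o l f ->
  integrable_on (child o l e) (l / 2) f.
Proof.
move=> l0; apply: integrableS; [exact: measurable_cube|exact: measurable_cube|exact: child_sub].
Qed.

Lemma cube_avgE f o l : 0 < l -> integrable_on o l f ->
  ((l ^+ n * cube_avg f o l)%:E = \int[mu]_(x in cube o l) (f x)%:E)%E.
Proof.
move=> l0 fi; rewrite /cube_avg mulrA divff ?mul1r ?gt_eqF ?exprn_gt0//.
by rewrite /Rintegral fineK//; exact: (integrable_fin_num (measurable_cube o l) fi).
Qed.

Lemma cube_avg_cst f o l (c : R) : 0 < l -> (forall x, cube o l x -> f x = c) ->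
  cube_avg f o l = c.
Proof.
move=> l0 fc; rewrite /cube_avg /Rintegral.
have -> : (\int[mu]_(x in cube o l) (f x)%:E = (l ^+ n * c)%:E)%E.
  transitivity (\int[mu]_(x in cube o l) (cst c%:E) x)%E.
    by apply: eq_integral => x; rewrite inE => /fc ->.
  rewrite (integral_cst mu (measurable_cube o l)) [X in (_ * X)%E](leb_cube o (ltW l0)).
  by rewrite -EFinM mulrC.
by rewrite /= mulrA mulVf ?mul1r// gt_eqF// exprn_gt0.
Qed.

Lemma cube_avg_dist f g o l : 0 < l -> integrable_on o l f -> integrable_on o l g ->
  ((l ^+ n * `|cube_avg f o l - cube_avg g o l|)%:E <=
   \int[mu]_(x in cube o l) `|f x - g x|%:E)%E.
Proof.
move=> l0 fi gi; have ln0 : 0 < l ^+ n by rewrite exprn_gt0.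
have -> : (l ^+ n * `|cube_avg f o l - cube_avg g o l|)%:E =
    (`|(l ^+ n * cube_avg f o l)%:E - (l ^+ n * cube_avg g o l)%:E|)%E.
  rewrite -EFinB abse_EFin; congr EFin.
  by rewrite -[in RHS](mulrBr (l ^+ n)) [in RHS]normrM (gtr0_norm ln0).
rewrite !cube_avgE// -(integralB (measurable_cube o l) fi gi).
have fgi := integrableB (measurable_cube o l) fi gi.
apply: le_trans (le_abse_integral mu (measurable_cube o l) (measurable_int mu fgi)) _.
by rewrite le_eqVlt; apply/orP; left; apply/eqP; apply: eq_integral.
Qed.

Fixpoint cst_at_level (j : nat) o l h : Prop :=
  if j is j'.+1 then forall e, cst_at_level j' (child o l e) (l / 2) h
  else exists c, forall x, cube o l x -> h x = c.

Lemma cst_at_levelS j o l h : 0 < l -> cst_at_level j o l h -> cst_at_level j.+1 o l h.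
Proof.
elim: j o l => [|j IH] o l l0.
  by move=> [c hc] e; exists c => x /(child_sub l0)/hc.
by move=> hj e; apply: IH; [rewrite divr_gt0|exact: hj].
Qed.

Lemma cst_at_level_le i j o l h : 0 < l -> (i <= j)%N -> cst_at_level i o l h -> cst_at_level j o l h.
Proof.
by move=> l0 /subnKC <- hi; elim: (j - i)%N => [|k IH]; rewrite ?addn0// addnS; exact: cst_at_levelS.
Qed.

Lemma cst_at_level_op (op : R -> R -> R) j o l g h :
  cst_at_level j o l g -> cst_at_level j o l h -> cst_at_level j o l (fun x => op (g x) (h x)).
Proof.
elim: j o l => [|j IH] o l /=; last by move=> hg hh e; exact: IH.
by move=> [c hc] [c' hc']; exists (op c c') => x xo; rewrite hc// hc'.
Qed.

Lemma level_dyadic_avg av j o l : 0 < l -> cst_at_level j o l (dyadic_avg av j o l).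
Proof.
elim: j o l => [|j IH] o l l0; first by exists (av o l).
move=> e; have l20 : 0 < l / 2 by rewrite divr_gt0.
have : forall h g i o' l', 0 < l' -> (forall x, cube o' l' x -> h x = g x) ->
    cst_at_level i o' l' g -> cst_at_level i o' l' h.
  move=> h g; elim=> [|i IHi] o' l' l'0 hg; first by move=> [c hc]; exists c => x xo; rewrite hg// hc.
  move=> hl e'; apply: IHi; [by rewrite divr_gt0|by move=> x /(child_sub l'0)/hg|exact: hl].
apply; last exact: (IH (child o l e) _ l20).
- exact: l20.
- by move=> x; exact: dyadic_avg_child.
Qed.

Lemma dyadic_avg_level j o l h x : 0 < l -> cst_at_level j o l h -> cube o l x ->
  dyadic_avg (cube_avg h) j o l x = h x.
Proof.
elim: j o l => [|j IH] o l l0 /=.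
  by move=> [c hc] xo; rewrite (cube_avg_cst l0 hc) hc.
move=> hl xo; apply: IH; [by rewrite divr_gt0|exact: hl|exact/mem_child].
Qed.

(** Averaging is a contraction of L^1 on each subcube. *)
Lemma dyadic_avg_contraction j o l f g : 0 < l -> measurable_fun setT f -> measurable_fun setT g ->
  integrable_on o l f -> integrable_on o l g ->
  (\int[mu]_(x in cube o l) `|dyadic_avg (cube_avg f) j o l x - dyadic_avg (cube_avg g) j o l x|%:E <=
   \int[mu]_(x in cube o l) `|f x - g x|%:E)%E.
Proof.
move=> l0 mf mg; elim: j o l l0 => [|j IH] o l l0 fi gi.
  rewrite /= (integral_cst mu (measurable_cube o l)) [X in (_ * X)%E](leb_cube o (ltW l0)).
  by rewrite -EFinM mulrC; exact: cube_avg_dist.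
have mD h h' : measurable_fun setT h -> measurable_fun setT h' ->
    measurable_fun setT (fun x => `|h x - h' x|%:E).
  move=> mh mh'; apply/measurable_EFinP; apply: measurableT_comp => //.
  exact: measurable_funB.
rewrite integral_children//; last by apply: mD; exact: measurable_dyadic_avg.
rewrite [leRHS]integral_children//; last exact: mD.
apply: lee_sum => e _.
apply: le_trans (IH _ _ (divr_gt0 l0 (ltr0Sn R 1)) (integrable_on_child e l0 fi)
  (integrable_on_child e l0 gi)).
rewrite le_eqVlt; apply/orP; left; apply/eqP; apply: eq_integral => x; rewrite inE => xe.
by rewrite !(dyadic_avg_child _ _ l0 xe).
Qed.

Lemma dyadic_avg_coord i j o l x : 0 < l -> cube o l x ->
  dyadic_avg (fun o' _ => tnth o' i) j o l x <= tnth x i <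
  dyadic_avg (fun o' _ => tnth o' i) j o l x + l / 2 ^+ j.
Proof.
elim: j o l => [|j IH] o l l0 xo /=; first by rewrite expr0 divr1; exact: xo.
have := IH (child o l (child_index o l x)) _ (divr_gt0 l0 (ltr0Sn R 1)).
rewrite exprS invfM mulrA; apply; exact/mem_child.
Qed.

Lemma dyadic_avg_comp av (phi : R -> R) j o l x :
  dyadic_avg (fun o' l' => phi (av o' l')) j o l x = phi (dyadic_avg av j o l x).
Proof. by elim: j o l => [|j IH] o l //=. Qed.

Section approximable.
Variables (o : Rn) (l : R).
Hypothesis l0 : 0 < l.
Local Notation Q := (cube o l).
Let mQ : measurable Q. Proof. exact: measurable_cube. Qed.

Definition dist1 f g : \bar R := \int[mu]_(x in Q) `|f x - g x|%:E.

(** Functions that are limits in L^1 of the cube of functions constant on some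
generation of subcubes; all integrable functions are (approximable_integrable).
The class is shown to be closed under the operations that generate them. *)
Definition approximable f := [/\ measurable_fun setT f, integrable_on o l f &
  forall eps : R, 0 < eps -> exists j h,
    [/\ measurable_fun setT h, integrable_on o l h, cst_at_level j o l h & (dist1 f h <= eps%:E)%E]].

Lemma measurable_dist1 f g : measurable_fun setT f -> measurable_fun setT g ->
  measurable_fun setT (fun x => `|f x - g x|%:E).
Proof.
move=> mf mg; apply/measurable_EFinP; apply: measurableT_comp => //.
exact: measurable_funB.
Qed.

Lemma dist1_triangle f g h : measurable_fun setT f -> measurable_fun setT g ->
  measurable_fun setT h -> (dist1 f h <= dist1 f g + dist1 g h)%E.
Proof.
move=> mf mg mh; rewrite /dist1.
have mfg := measurable_funS measurableT (@subsetT _ Q) (measurable_dist1 mf mg).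
have mgh := measurable_funS measurableT (@subsetT _ Q) (measurable_dist1 mg mh).
have p1 x : Q x -> (0 <= `|f x - g x|%:E :> \bar R)%E by rewrite lee_fin.
have p2 x : Q x -> (0 <= `|g x - h x|%:E :> \bar R)%E by rewrite lee_fin.
rewrite -(ge0_integralD mu mQ p1 mfg p2 mgh).
apply: le_integral_ge0 => x _; first by rewrite lee_fin.
rewrite -EFinD lee_fin (_ : f x - h x = (f x - g x) + (g x - h x)); last by ring.
exact: ler_normD.
Qed.

Lemma integrable_lipschitz K (op : R -> R -> R) f g :
  op 0 0 = 0 ->
  (forall a a' c c', `|op a c - op a' c'| <= K * (`|a - a'| + `|c - c'|)) ->
  measurable_fun setT (fun x => op (f x) (g x)) ->
  integrable_on o l f -> integrable_on o l g -> integrable_on o l (fun x => op (f x) (g x)).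
Proof.
move=> op0 lip mop fi gi.
have fgi := integrableZl mQ K (integrableD mQ (integrable_abse fi) (integrable_abse gi)).
apply: (le_integrable mQ _ _ fgi).
  by apply/measurable_EFinP; exact: measurable_funTS.
move=> x _; rewrite [leRHS](_ : _ = (`|K * (`|f x| + `|g x|)|)%:E)// lee_fin.
have := lip (f x) 0 (g x) 0; rewrite op0 !subr0 => /le_trans; apply.
exact: ler_norm.
Qed.

Lemma approximable_op K (op : R -> R -> R) f g : 0 < K ->
  op 0 0 = 0 ->
  (forall a a' c c', `|op a c - op a' c'| <= K * (`|a - a'| + `|c - c'|)) ->
  (forall f g, measurable_fun setT f -> measurable_fun setT g ->
    measurable_fun setT (fun x : Rn => op (f x) (g x))) ->
  approximable f -> approximable g -> approximable (fun x => op (f x) (g x)).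
Proof.
move=> K0 op0 lip mop [mf fi fa] [mg gi ga]; split; first exact: mop.
  by apply: integrable_lipschitz => //; exact: mop.
move=> eps eps0; have e2 : 0 < eps / (2 * K) by rewrite divr_gt0// mulr_gt0.
have [j [h [mh hi hl hd]]] := fa _ e2; have [j' [h' [mh' hi' hl' hd']]] := ga _ e2.
exists (maxn j j'), (fun x => op (h x) (h' x)); split; first exact: mop.
- by apply: integrable_lipschitz => //; exact: mop.
- by apply: cst_at_level_op; [apply: (cst_at_level_le l0 (leq_maxl _ _))|apply: (cst_at_level_le l0 (leq_maxr _ _))].
- have mfg := measurable_funS measurableT (@subsetT _ Q) (measurable_dist1 mf mh).
  have mgh := measurable_funS measurableT (@subsetT _ Q) (measurable_dist1 mg mh').
  have p1 x : Q x -> (0 <= `|f x - h x|%:E :> \bar R)%E by rewrite lee_fin.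
  have p2 x : Q x -> (0 <= `|g x - h' x|%:E :> \bar R)%E by rewrite lee_fin.
  apply: (@le_trans _ _ (K%:E * (dist1 f h + dist1 g h'))%E).
    rewrite /dist1 -(ge0_integralD mu mQ p1 mfg p2 mgh).
    apply: (@le_trans _ _ (\int[mu]_(x in Q) (K%:E * (`|f x - h x|%:E + `|g x - h' x|%:E)))%E).
      apply: le_integral_ge0 => x _; first by rewrite lee_fin.
      by rewrite -EFinD -EFinM lee_fin.
    apply: le_integralZl_ge0 => // x Qx.
    by apply: adde_ge0; [exact: p1|exact: p2].
  apply: (@le_trans _ _ (K%:E * ((eps / (2 * K))%:E + (eps / (2 * K))%:E))%E).
    by apply: lee_wpmul2l; [rewrite lee_fin ltW|exact: leeD].
  rewrite -EFinD -EFinM lee_fin le_eqVlt; apply/orP; left; apply/eqP.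
  by field; rewrite gt_eqF.
Qed.

Lemma approximable_lim f : measurable_fun setT f -> integrable_on o l f ->
  (forall eps : R, 0 < eps -> exists2 g, approximable g & (dist1 f g <= eps%:E)%E) ->
  approximable f.
Proof.
move=> mf fi hf; split => // eps eps0.
have e2 : 0 < eps / 2 by rewrite divr_gt0.
have [g [mg gi ga] fg] := hf _ e2; have [j [h [mh hi hl gh]]] := ga _ e2.
exists j, h; split => //; apply: le_trans (dist1_triangle mf mg mh) _.
by rewrite (splitr eps) EFinD; exact: leeD.
Qed.

Lemma integrable_bounded f (M : R) : measurable_fun setT f -> (forall x, `|f x| <= M) ->
  integrable_on o l f.
Proof.
move=> mf fM.
have ci : mu.-integrable Q (cst M%:E).
  apply/integrableP; split; first exact: measurable_cst.
  rewrite (_ : \int[mu]_(x in Q) _ = \int[mu]_(x in Q) (cst `|M|%:E x))%E//.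
  rewrite (integral_cst mu mQ) [X in (_ * X)%E](leb_cube o (ltW l0)) -EFinM.
  exact: ltry.
apply: (le_integrable mQ _ _ ci).
  by apply/measurable_EFinP; exact: measurable_funTS.
move=> x _ /=; rewrite lee_fin; apply: le_trans (fM x) _; exact: ler_norm.
Qed.

Lemma approximable_cvg (g : nat -> Rn -> R) f : measurable_fun setT f ->
  (forall k, approximable (g k)) -> (forall k x, `|g k x| <= 1) -> (forall x, `|f x| <= 1) ->
  (forall x, Q x -> g k x @[k --> \oo] --> f x) -> approximable f.
Proof.
move=> mf ga g1 f1 gf.
have mg k : measurable_fun setT (g k) by have [] := ga k.
apply: approximable_lim => //; first exact: integrable_bounded f1.
have : dist1 f (g k) @[k --> \oo] --> (\int[mu]_(x in Q) cst 0%E x)%E.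
  rewrite /dist1; apply: (@dominated_cvg _ _ _ mu Q mQ _ _ (cst 2%:E)).
  - by move=> k; apply: measurable_funTS; exact: measurable_dist1.
  - move=> x Qx; apply/fine_cvgP; split; first by apply: nearW => k.
    have -> : 0 = `|f x - f x| by rewrite subrr normr0.
    apply: cvg_norm; apply: cvgB; [exact: cvg_cst|exact: gf].
  - by [].
  - have := @integrable_bounded (cst 2) 2 (@measurable_cst _ _ _ _ _ _).
    by apply => x; rewrite ger0_norm.
  - move=> k x _; rewrite abse_EFin lee_fin normr_id; apply: le_trans (ler_normB _ _) _.
    by rewrite (_ : 2 = 1 + 1)//; exact: lerD.
rewrite integral0 => /fine_cvgP[dfin dcvg] eps eps0.
have /cvgrPdist_lt/(_ eps eps0) := dcvg.
move=> hd; near \oo => k; exists (g k) => //.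
have kfin : dist1 f (g k) \is a fin_num by near: k.
rewrite -(fineK kfin) lee_fin; apply/ltW/(le_lt_trans (ler_norm _)).
rewrite -normrN -[X in `|X|]add0r; near: k; exact: hd.
Unshelve. all: by end_near. Qed.

Lemma approximable_cst (c : R) : approximable (cst c).
Proof.
have ci : integrable_on o l (cst c) by apply: (@integrable_bounded _ `|c|) => // x.
split => // eps eps0; exists 0%N, (cst c); split => //; first by exists c.
rewrite /dist1; under eq_integral do rewrite subrr normr0.
by rewrite integral0 lee_fin ltW.
Qed.

Lemma normr_indic_le1 (A : set Rn) x : `|\1_A x| <= 1 :> R.
Proof. by rewrite indicE; case: (_ \in _); rewrite ?normr1 ?normr0. Qed.

Lemma indicU_max (A B : set Rn) : \1_(A `|` B) = (fun x => Num.max (\1_A x) (\1_B x)) :> (Rn -> R).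
Proof.
apply/funext => x; rewrite !indicE in_setU.
by case: (x \in A); case: (x \in B); rewrite /= ?maxxx//; [rewrite max_l|rewrite max_r].
Qed.

Lemma approximable_indicU (A B : set Rn) : approximable (\1_A) -> approximable (\1_B) ->
  approximable (\1_(A `|` B)).
Proof.
move=> aA aB; rewrite indicU_max.
apply: (@approximable_op 1 (fun a c => Num.max a c) _ _ ltr01) => //; first by rewrite maxxx.
- move=> a a' c c'; rewrite mul1r.
  have := ler_norm (a - a'); have := ler_norm (a' - a); have := ler_norm (c - c').
  have := ler_norm (c' - c); rewrite (distrC a' a) (distrC c' c) => h1 h2 h3 h4.
  have p1 := normr_ge0 (a - a'); have p2 := normr_ge0 (c - c').
  by case: (leP a c) => ac; case: (leP a' c') => ac'; rewrite ler_norml; apply/andP; split; lra.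
- by move=> f g mf mg; exact: measurable_maxr.
Qed.

(** Complements are differences, finite unions are maxima, and countable unions
are dominated limits. *)
Lemma sigma_algebra_approximable :
  sigma_algebra [set: Rn] [set A | measurable A /\ approximable (\1_A)].
Proof.
split.
- split; first exact: measurable0.
  rewrite (_ : \1_set0 = cst 0); first exact: approximable_cst.
  by apply/funext => x; rewrite indic0.
- move=> A [mA aA]; rewrite setTD; split; first exact: measurableC.
  rewrite (_ : \1_(~` A) = (fun x => cst 1 x - \1_A x)); last first.
    by apply/funext => x; rewrite !indicE in_setC; case: (x \in A); rewrite /= ?subrr ?subr0.
  apply: (@approximable_op 1 (fun a c => a - c) _ _ ltr01) => //; first by rewrite subr0.
  + move=> a a' c c'; rewrite mul1r (_ : a - c - (a' - c') = (a - a') - (c - c')); last by ring.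
    exact: ler_normB.
  + by move=> f g mf mg; exact: measurable_funB.
  + exact: approximable_cst.
- move=> A hA; have mU : measurable (\bigcup_k A k).
    by apply: bigcup_measurable => k _; have [] := hA k.
  split => //; pose g k : Rn -> R := \1_(\big[setU/set0]_(i < k) A i).
  have ag k : approximable (g k).
    rewrite /g; elim: k => [|k IH].
      rewrite big_ord0 (_ : \1_set0 = cst 0); first exact: approximable_cst.
      by apply/funext => x; rewrite indic0.
    by rewrite big_ord_recr /=; apply: approximable_indicU => //; have [] := hA k.
  apply: (approximable_cvg _ ag); first exact: measurable_indic.
  + by move=> k x; exact: normr_indic_le1.
  + exact: normr_indic_le1.
  + move=> x _; rewrite indicE; have [|xA] := boolP (x \in \bigcup_k A k).
      rewrite inE => -[k _ Akx]; apply: cvg_near_cst; exists k.+1 => // i /= ki.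
      rewrite /g indicE mem_set// -bigcup_mkord; exists k => //.
    rewrite (_ : g^~ x = cst 0); first exact: cvg_cst.
    apply/funext => k; rewrite /g indicE memNset// -bigcup_mkord => -[i _ Aix].
    by move: xA; rewrite notin_setE; apply; exists i.
Qed.

Lemma measurable_ray (i : 'I_n) (t : R) : measurable [set x : Rn | t < tnth x i].
Proof.
rewrite (_ : [set x | _] = (fun x => tnth x i) @^-1` `]t, +oo[%classic).
  by rewrite -[X in measurable X]setTI; exact: measurable_tnth.
by apply/seteqP; split => x /=; rewrite in_itv/= andbT.
Qed.

(** The indicator of a half-space is the pointwise limit of the indicators of the
subcubes whose lower corner is in it; strictness of the inequality makes the
limit correct also on the boundary, so that no null set is involved. *)
Lemma approximable_ray (i : 'I_n) (t : R) :
  approximable (\1_[set x | t < tnth x i]).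
Proof.
have mray := measurable_ray i t.
pose g k := dyadic_avg (fun o' _ => (t < tnth o' i)%R%:R : R) k o l.
have gE k x : g k x = (t < dyadic_avg (fun o' _ => tnth o' i) k o l x)%R%:R.
  exact: (dyadic_avg_comp (fun o' _ => tnth o' i) (fun c => (t < c)%R%:R)).
have g1 k x : `|g k x| <= 1 by rewrite gE; case: (_ < _); rewrite ?normr1 ?normr0.
have mg k : measurable_fun setT (g k) by exact: measurable_dyadic_avg.
apply: (@approximable_cvg g) => //.
- move=> k; split => //; first exact: integrable_bounded (g1 k).
  move=> eps eps0; exists k, (g k); split => //.
  + exact: integrable_bounded (g1 k).
  + exact: level_dyadic_avg.
  + rewrite /dist1; under eq_integral do rewrite subrr normr0.
    by rewrite integral0 lee_fin ltW.
- exact: normr_indic_le1.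
- move=> x Qx; rewrite indicE; have [|xt] := boolP (x \in [set x : Rn | t < tnth x i]).
    rewrite inE /= => tx; apply: cvg_near_cst.
    have : (fun k => l / 2 ^+ k : R) @ \oo --> 0.
      rewrite -(mulr0 l); under eq_fun do rewrite -exprVn.
      by apply: cvgMr => //; apply: cvg_expr; rewrite ger0_norm ?invr_ge0// invf_lt1// ltr1n.
    move=> /cvgrPdist_lt/(_ (tnth x i - t)); rewrite subr_gt0 => /(_ tx) near_l.
    near=> k; apply/eqP; rewrite gE.
    have hk : `|0 - l / 2 ^+ k| < tnth x i - t by near: k.
    have /andP[_ h2] := dyadic_avg_coord i k l0 Qx.
    rewrite sub0r normrN in hk; have := le_lt_trans (ler_norm _) hk => hk'.
    by rewrite (_ : t < _)//; lra.
  rewrite (_ : g^~ x = cst 0); first exact: cvg_cst.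
  apply/funext => k; rewrite gE; have /andP[h1 _] := dyadic_avg_coord i k l0 Qx.
  move: xt; rewrite notin_setE /= => /negP; rewrite -leNgt => xt.
  by rewrite ltNge (le_trans h1 xt).
Unshelve. all: by end_near. Qed.

(** Half-spaces generate the product sigma-algebra. *)
Lemma approximable_indic A : measurable A -> approximable (\1_A).
Proof.
suff : measurable `<=` [set A : set Rn | measurable A /\ approximable (\1_A)].
  by move=> h mA; have [] := h _ mA.
have [S0 SC SU] := sigma_algebra_approximable.
apply: smallest_sub => // B; rewrite -bigcup_seq => -[i _ [C mC <-]]; rewrite setTI.
pose ti (x : Rn) : R := tnth x i.
suff : (@ocitv R).-sigma.-measurable `<=` [set C : set R | measurable (ti @^-1` C) /\
    approximable (\1_(ti @^-1` C))] by apply.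
rewrite RGenOInfty.measurableE; apply: smallest_sub.
  split.
  - by rewrite /= preimage_set0.
  - by move=> D hD; rewrite /= setTD preimage_setC -setTD; exact: SC.
  - by move=> D hD; rewrite /= preimage_bigcup; exact: SU.
move=> D [t ->] /=; rewrite (_ : _ @^-1` _ = [set x : Rn | t < tnth x i]); last first.
  by apply/seteqP; split => x /=; rewrite in_itv/= andbT.
split; [exact: measurable_ray|exact: approximable_ray].
Qed.

Lemma approximable_integrable f : measurable_fun setT f -> integrable_on o l f ->
  approximable f.
Proof.
move=> mf fi; have [g_ [gi _ gf]] := approximation_sfun_integrable mQ fi.
apply: approximable_lim => // eps eps0.
move/fine_cvgP : gf => [dfin dcvg].
have /cvgrPdist_lt/(_ eps eps0) := dcvg => hd.
near \oo => k; exists (fun x : Rn => g_ k x); last first.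
  have kfin : dist1 f (g_ k) \is a fin_num by near: k.
  rewrite -(fineK kfin) lee_fin; apply/ltW/(le_lt_trans (ler_norm _)).
  rewrite -normrN -[X in `|X|]add0r; near: k; exact: hd.
rewrite (_ : (fun x : Rn => g_ k x) = fun x : Rn =>
    \sum_(y <- finmap.enum_fset (fset_set (range (g_ k)))) y * \1_(g_ k @^-1` [set y]) x).
  elim: (finmap.enum_fset _) => [|y s IH].
    under eq_fun do rewrite big_nil; exact: approximable_cst.
  under eq_fun do rewrite big_cons.
  apply: (@approximable_op 1 (fun a c => a + c) _ _ ltr01) => //; first by rewrite addr0.
  - move=> a a' c c'; rewrite mul1r (_ : a + c - (a' + c') = (a - a') + (c - c')); last by ring.
    exact: ler_normD.
  - by move=> f1 f2 m1 m2; exact: measurable_funD.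
  - have ai : approximable (\1_(g_ k @^-1` [set y])) by exact: approximable_indic.
    have K0 : 0 < `|y| + 1 by rewrite ltr_wpDl.
    apply: (@approximable_op _ (fun a c => y * a) _ (cst 0) K0) => //; first by rewrite mulr0.
    + move=> a a' c c'; rewrite -mulrBr normrM; apply: ler_pM => //; first by rewrite lerDl.
      by rewrite lerDl.
    + by move=> f1 f2 m1 m2; exact: measurable_funM.
    + exact: approximable_cst.
by apply/funext => x; rewrite [LHS]fimfunE fsbig_finite.
Unshelve. all: by end_near. Qed.

(** A function constant on a generation of subcubes is equal to its later
averages; contraction transfers this to its limits. *)
Lemma dyadic_avg_cvg_L1 f : measurable_fun setT f -> integrable_on o l f ->
  forall eps : R, 0 < eps -> exists J, forall j, (J <= j)%N ->
    (dist1 (dyadic_avg (cube_avg f) j o l) f <= eps%:E)%E.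
Proof.
move=> mf fi eps eps0; have [_ _ fa] := approximable_integrable mf fi.
have e2 : 0 < eps / 2 by rewrite divr_gt0.
have [J [h [mh hi hl fh]]] := fa _ e2; exists J => j Jj.
have hj : cst_at_level j o l h by exact: cst_at_level_le hl.
have md g : measurable_fun setT (dyadic_avg (cube_avg g) j o l) by exact: measurable_dyadic_avg.
apply: le_trans (dist1_triangle (md f) (md h) mf) _; rewrite (splitr eps) EFinD; apply: leeD.
  by apply: le_trans (dyadic_avg_contraction j l0 mf mh fi hi) _.
rewrite (_ : dist1 _ _ = dist1 f h)//; apply: eq_integral => x; rewrite inE => xo.
by rewrite (dyadic_avg_level l0 hj xo) distrC.
Qed.

(** Along a subsequence the L^1 distances are summable, so almost everywhere the
sum of the differences is finite and its terms tend to 0. The subsequence is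
common to two functions because the two densities are differentiated
together. *)
Lemma dyadic_avg_cvg_ae f g : measurable_fun setT f -> integrable_on o l f ->
  measurable_fun setT g -> integrable_on o l g ->
  exists phi : nat -> nat, {ae mu, forall x, Q x ->
    dyadic_avg (cube_avg f) (phi i) o l x @[i --> \oo] --> f x /\
    dyadic_avg (cube_avg g) (phi i) o l x @[i --> \oo] --> g x}.
Proof.
move=> mf fi mg gi.
have ex i : exists j, (dist1 (dyadic_avg (cube_avg f) j o l) f <= ((2 ^+ i)^-1)%:E)%E /\
    (dist1 (dyadic_avg (cube_avg g) j o l) g <= ((2 ^+ i)^-1)%:E)%E.
  have i0 : 0 < (2 ^+ i : R)^-1 by rewrite invr_gt0 exprn_gt0.
  have [J hJ] := dyadic_avg_cvg_L1 mf fi i0; have [J' hJ'] := dyadic_avg_cvg_L1 mg gi i0.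
  by exists (maxn J J'); split; [apply: hJ; exact: leq_maxl|apply: hJ'; exact: leq_maxr].
(* the generation phi i makes both L^1 distances at most 2^-i *)
have [phi hphi] := choice ex; exists phi.
have key h : measurable_fun setT h ->
    (forall i, (dist1 (dyadic_avg (cube_avg h) (phi i) o l) h <= ((2 ^+ i)^-1)%:E)%E) ->
    {ae mu, forall x, Q x -> dyadic_avg (cube_avg h) (phi i) o l x @[i --> \oo] --> h x}.
  move=> mh hd.
  pose F i x : \bar R := `|dyadic_avg (cube_avg h) (phi i) o l x - h x|%:E.
  have mF i : measurable_fun Q (F i).
    by apply: measurable_funTS; apply: measurable_dist1 => //; exact: measurable_dyadic_avg.
  have F0 i x : Q x -> (0 <= F i x)%E by rewrite lee_fin.
  have mS : measurable_fun Q (fun x => \sum_(0 <= i <oo) F i x)%E.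
    by apply: ge0_emeasurable_sum => // i x Qx _; exact: F0.
  have Sfin : (\int[mu]_(x in Q) (\sum_(0 <= i <oo) F i x) < +oo)%E.
    rewrite integral_nneseries//.
    apply: (@le_lt_trans _ _ (\sum_(0 <= i <oo) ((2^-1) ^+ i)%:E)%E).
      apply: lee_nneseries => [i _ _|i _].
        by apply: integral_ge0 => x Qx; exact: F0.
      by rewrite exprVn; exact: hd.
    rewrite (_ : (\sum_(0 <= i <oo) _)%E = (1 / (1 - 2^-1))%:E) ?ltry//.
    rewrite -geometric_eseries//; first by apply: eq_eseriesr => i _; rewrite mul1r.
    by rewrite invr_ge0 ler0n/= invf_lt1// ltr1n.
  have Sint : mu.-integrable Q (fun x => \sum_(0 <= i <oo) F i x)%E.
    apply/integrableP; split => //.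
    apply: le_lt_trans Sfin; rewrite le_eqVlt; apply/orP; left; apply/eqP.
    apply: eq_integral => x; rewrite inE => Qx; rewrite gee0_abs//.
    by apply: nneseries_ge0 => i _ _; exact: F0.
  apply: filterS (integrable_ae mQ Sint) => x hx Qx.
  have Fx0 i : (0 <= F i x)%E by exact: F0.
  have Sx : (\sum_(0 <= i <oo) F i x < +oo)%E.
    by have := hx Qx; rewrite ge0_fin_numE//; apply: nneseries_ge0.
  have tail := nneseries_tail_cvg Sx (fun k _ => Fx0 k).
  have : F i x @[i --> \oo] --> 0%E.
    apply: (squeeze_cvge _ (cvg_cst 0%E) tail); apply: nearW => i; rewrite Fx0/=.
    apply: le_trans (nneseries_lim_ge i.+1 _); last by move=> *; exact: Fx0.
    by rewrite big_nat1.
  move=> /fine_cvgP[_ /= /norm_cvg0 F_0].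
  have -> : (fun i => dyadic_avg (cube_avg h) (phi i) o l x) =
      (fun i => (dyadic_avg (cube_avg h) (phi i) o l x - h x) + h x).
    by apply/funext => i; rewrite subrK.
  rewrite -[X in _ --> X]add0r; apply: cvgD => //; exact: cvg_cst.
have [h1 h2] : (forall i, (dist1 (dyadic_avg (cube_avg f) (phi i) o l) f <= ((2 ^+ i)^-1)%:E)%E) /\
  (forall i, (dist1 (dyadic_avg (cube_avg g) (phi i) o l) g <= ((2 ^+ i)^-1)%:E)%E).
  by split => i; have [] := hphi i.
have := key f mf h1; have := key g mg h2.
by apply: filterS2 => x hg hf Qx; split; [exact: hf|exact: hg].
Qed.

End approximable.
End dyadic_differentiation.

(** * Pairs of densities with bounded product *)

Section two_densities.
Context {R : realType} (n : nat).
Local Notation Rn := (n.-tuple R).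
Local Notation mu := (@leb R n).
Implicit Types (o x : Rn) (l : R).
Variables (g1 g2 : Rn -> R) (a b K : R).
Hypotheses (mg1 : measurable_fun setT g1) (mg2 : measurable_fun setT g2)
  (g10 : forall x, 0 <= g1 x) (g20 : forall x, 0 <= g2 x)
  (a0 : 0 < a) (b0 : 0 < b) (K0 : 0 < K).
Hypothesis bound : forall o l, 0 < l -> [/\ wmeas g1 (cube o l) \is a fin_num,
  wmeas g2 (cube o l) \is a fin_num &
  (wmeas g1 (cube o l) `^ a * wmeas g2 (cube o l) `^ b <= (K * (l ^+ n) `^ (a + b))%:E)%E].

Let ab0 : 0 < a + b. Proof. exact: addr_gt0. Qed.

Lemma wmeas_setID (v : Rn -> R) (E S : set Rn) : measurable E -> measurable S ->
  measurable_fun setT v -> (forall x, 0 <= v x) ->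
  wmeas v E = (wmeas v (E `&` S) + wmeas v (E `\` S))%E.
Proof.
move=> mE mS mv v0; rewrite /wmeas -[in LHS](setUIDK E S).
apply: (ge0_integral_setU mu).
- exact: measurableI.
- exact: measurableD.
- by apply: measurable_funTS; exact/measurable_EFinP.
- by move=> x _; rewrite lee_fin.
- by apply/disj_setPS => x [[_ Sx] [_ nSx]].
Qed.

Section weak.
Hypothesis prod1 : {ae mu, forall x, g1 x `^ a * g2 x `^ b = 1}.

(** Hoelder for the constant 1, written as the product of powers of the two
densities. *)
Lemma leb_le_densities (E : set Rn) : measurable E ->
  (mu E <= wmeas g1 E `^ (a / (a + b)) * wmeas g2 E `^ (b / (a + b)))%E.
Proof.
move=> mE; have sum1 : a / (a + b) + b / (a + b) = 1.
  by rewrite -mulrDl mulfV// gt_eqF.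
have := @hoelder_powR _ _ _ mu E g1 g2 _ _ mE mg1 mg2 g10 g20 (divr_gt0 a0 ab0)
  (divr_gt0 b0 ab0) sum1.
apply: le_trans; rewrite -(mul1e (mu E)) -(integral_cst mu mE).
have mF : measurable_fun setT (fun x => g1 x `^ (a / (a + b)) * g2 x `^ (b / (a + b))).
  by apply: measurable_funM; exact: measurable_comp_powR.
apply: ae_ge0_le_integral.
- exact: mE.
- by move=> x _; rewrite lee_fin.
- exact: measurable_cst.
- by move=> x _; rewrite lee_fin mulr_ge0 ?powR_ge0.
- by apply: measurable_funTS; exact/measurable_EFinP.
apply: filterS prod1 => x gx _; rewrite lee_fin !powRrM -powRM ?powR_ge0// gx.
by rewrite powR1.
Qed.

(** Let F be the complement of S in the cube Q, with at least half its volume.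
Then |Q|^(a+b) is at most a multiple of g1(F)^a g2(Q)^b, while the bound gives
g1(Q)^a g2(Q)^b <= K |Q|^(a+b); so g1(F) is at least a fixed proportion of
g1(Q). *)
Lemma weak_Ainfty : exists2 d : R, 0 < d <= 1 & small_part_bound g1 d.
Proof.
pose Kt := K * 2 `^ (a + b) + 1.
have Kt1 : 1 <= Kt by rewrite /Kt lerDr mulr_ge0 ?powR_ge0// ltW.
have Kt0 : 0 < Kt by exact: lt_le_trans Kt1.
(* the proportion d of g1(Q) that is left outside of S; adding 1 in Kt ensures d <= 1 *)
exists (Kt `^ (- a^-1)).
  rewrite powR_gt0//= powRN invf_le1 ?powR_gt0//.
  apply: (@le_trans _ _ (1 `^ a^-1)); first by rewrite powR1.
  by apply: ge0_ler_powR; rewrite ?nnegrE ?invr_ge0 ?(ltW a0) ?(ltW Kt0).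
move=> o l S l0 mS hS; have mQ := measurable_cube o l.
have [f1 f2 hb] := bound o l0.
set Q := cube o l in mQ hS f1 f2 hb *; pose F := Q `\` S.
have mF : measurable F by exact: measurableD.
have ln0 : 0 < l ^+ n by rewrite exprn_gt0.
have -> : (\int[mu]_(x in Q) (g1 x * \1_S x)%:E = wmeas g1 (Q `&` S))%E.
  rewrite /wmeas [RHS]integral_mkcondr; apply: eq_integral => x _.
  by rewrite patchE indicE; case: (_ \in _); rewrite ?mulr1 ?mulr0.
have muQ : mu Q = (l ^+ n)%:E by exact: leb_cube (ltW l0).
have muF : ((l ^+ n / 2)%:E <= mu F)%E.
  move: hS; rewrite (integral_indic mu mQ mS) setIC => hS0.
  have hS : (mu (Q `&` S) <= (l ^+ n / 2)%:E)%E by exact: hS0.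
  have : (mu Q = mu F + mu (Q `&` S))%E by exact: (measureDI mu mQ mS).
  rewrite muQ.
  case: (mu F) (mu (Q `&` S)) hS => [x| |] [y| |]//; rewrite ?leey// -EFinD !lee_fin.
  by move=> h [h1]; lra.
have E1 := wmeas_setID mQ mS mg1 g10.
have hF := leb_le_densities mF.
have F1 : (wmeas g1 F <= wmeas g1 Q)%E by rewrite E1 leeDr// wmeas_ge0.
have F2 : (wmeas g2 F <= wmeas g2 Q)%E.
  by rewrite (wmeas_setID mQ mS mg2 g20) leeDr// wmeas_ge0.
have S1 : (wmeas g1 (Q `&` S) <= wmeas g1 Q)%E by rewrite E1 leeDl// wmeas_ge0.
have f1F : wmeas g1 F \is a fin_num.
  by rewrite ge0_fin_numE ?wmeas_ge0// (le_lt_trans F1)// ltey_eq f1.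
have f2F : wmeas g2 F \is a fin_num.
  by rewrite ge0_fin_numE ?wmeas_ge0// (le_lt_trans F2)// ltey_eq f2.
have f1S : wmeas g1 (Q `&` S) \is a fin_num.
  by rewrite ge0_fin_numE ?wmeas_ge0// (le_lt_trans S1)// ltey_eq f1.
have p1 := wmeas_ge0 F g10; have p2 := wmeas_ge0 F g20; have p3 := wmeas_ge0 Q g10.
have p4 := wmeas_ge0 Q g20.
have {hF muF} hF := le_trans muF hF.
move: hb hF E1 F1 F2 p1 p2 p3 p4; rewrite -/F.
rewrite -(fineK f1F) -(fineK f2F) -(fineK f1) -(fineK f2) -(fineK f1S).
move: (fine (wmeas g1 F)) (fine (wmeas g2 F)) (fine (wmeas g1 Q)) (fine (wmeas g2 Q))
  (fine (wmeas g1 (Q `&` S))) => x y' N y z.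
rewrite -?EFinD !poweR_EFin -?EFinM !lee_fin => hb hF [E1] F1 F2 p1 p2 p3 p4.
suff : Kt `^ (- a^-1) * N <= x by rewrite mulrBl mul1r; lra.
have step : N `^ a <= Kt * x `^ a.
  have h1 : (l ^+ n / 2) `^ (a + b) <= x `^ a * y `^ b.
    apply: (@le_trans _ _ ((x `^ (a / (a + b)) * y' `^ (b / (a + b))) `^ (a + b))).
      apply: ge0_ler_powR; rewrite ?nnegrE ?mulr_ge0 ?powR_ge0 ?(ltW ab0) ?(ltW ln0)//.
    rewrite powRM ?powR_ge0// -!powRrM !divfK ?gt_eqF//.
    apply: ler_wpM2l; first exact: powR_ge0.
    by apply: ge0_ler_powR; rewrite ?nnegrE ?(ltW b0).
  have lt0 : 0 < (l ^+ n) `^ (a + b) by rewrite powR_gt0.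
  have h2 : (l ^+ n) `^ (a + b) * N `^ a <= (l ^+ n) `^ (a + b) * (K * 2 `^ (a + b) * x `^ a).
    have e3 : 2 `^ (a + b) * (l ^+ n / 2) `^ (a + b) = (l ^+ n) `^ (a + b).
      by rewrite -powRM ?divr_ge0 ?(ltW ln0)// mulrC divfK.
    rewrite -e3 -mulrA.
    have -> : 2 `^ (a + b) * (l ^+ n / 2) `^ (a + b) * (K * 2 `^ (a + b) * x `^ a) =
      2 `^ (a + b) * (x `^ a * (K * (2 `^ (a + b) * (l ^+ n / 2) `^ (a + b)))) by ring.
    apply: ler_wpM2l; first exact: powR_ge0.
    rewrite e3.
    apply: (@le_trans _ _ (x `^ a * (N `^ a * y `^ b))).
      by rewrite mulrCA mulrC; apply: ler_wpM2l => //; exact: powR_ge0.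
    by apply: ler_wpM2l => //; exact: powR_ge0.
  move: h2; rewrite ler_pM2l// => /le_trans; apply; apply: ler_wpM2r; first exact: powR_ge0.
  by rewrite /Kt lerDl.
have aV0 : 0 <= a^-1 by rewrite invr_ge0 ltW.
have : N <= Kt `^ a^-1 * x.
  have : (N `^ a) `^ a^-1 <= (Kt * x `^ a) `^ a^-1.
    by apply: ge0_ler_powR; rewrite ?nnegrE ?mulr_ge0 ?powR_ge0 ?(ltW Kt0).
  by rewrite powRM ?powR_ge0 ?(ltW Kt0)// -!powRrM mulfV ?gt_eqF// !powRr1.
by rewrite powRN ler_pdivrMl ?powR_gt0.
Qed.

End weak.

Lemma integrable_on_wmeas (v : Rn -> R) o l : measurable_fun setT v -> (forall x, 0 <= v x) ->
  wmeas v (cube o l) \is a fin_num -> integrable_on o l v.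
Proof.
move=> mv v0 fv; apply/integrableP; split.
  by apply/measurable_EFinP; exact: measurable_funTS.
rewrite -ge0_fin_numE; last by apply: integral_ge0 => x _; exact: abse_ge0.
rewrite (_ : (\int[mu]_(x in _) _)%E = wmeas v (cube o l))//.
by apply: eq_integral => x _; rewrite /= ger0_norm.
Qed.

Lemma dyadic_avg_densities_le j o l x : 0 < l ->
  0 <= dyadic_avg (cube_avg g1) j o l x /\ 0 <= dyadic_avg (cube_avg g2) j o l x /\
  dyadic_avg (cube_avg g1) j o l x `^ a * dyadic_avg (cube_avg g2) j o l x `^ b <= K.
Proof.
elim: j o l => [|j IH] o l l0 /=; last by apply: IH; rewrite divr_gt0.
have ln0 : 0 < l ^+ n by rewrite exprn_gt0.
have lnV0 : 0 <= (l ^+ n)^-1 by rewrite invr_ge0 ltW.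
have [f1 f2] := bound o l0.
have := wmeas_ge0 (cube o l) g10; have := wmeas_ge0 (cube o l) g20.
rewrite /cube_avg /Rintegral -/(wmeas g1 (cube o l)) -/(wmeas g2 (cube o l)).
rewrite -(fineK f1) -(fineK f2) !poweR_EFin -EFinM !lee_fin /=.
move: (fine (wmeas g1 (cube o l))) (fine (wmeas g2 (cube o l))) => x1 x2 x20 x10 h.
split; first by rewrite mulr_ge0.
split; first by rewrite mulr_ge0.
have L0 : 0 < (l ^+ n) `^ (a + b) by rewrite powR_gt0.
rewrite -(ler_pM2l L0) [leRHS]mulrC.
have -> // : (l ^+ n) `^ (a + b) * (((l ^+ n)^-1 * x1) `^ a * ((l ^+ n)^-1 * x2) `^ b) =
  x1 `^ a * x2 `^ b.
rewrite powRD; last by rewrite (gt_eqF ln0) implybT.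
have e (c z : R) : 0 <= z -> (l ^+ n) `^ c * ((l ^+ n)^-1 * z) `^ c = z `^ c.
  move=> z0; rewrite -powRM ?mulr_ge0 ?(ltW ln0)//.
  by rewrite mulrA mulfV ?mul1r// gt_eqF.
by rewrite mulrACA !e.
Qed.

(** The bound passes to averages on dyadic subcubes, hence to the limit. Since
eventually an average exceeds half of its positive limit, the factor 2^(a+b)
replaces an argument of continuity. *)
Lemma densities_le : {ae mu, forall x, 0 < g1 x /\ 0 < g2 x} ->
  {ae mu, forall x, g1 x `^ a * g2 x `^ b <= K * 2 `^ (a + b)}.
Proof.
move=> gpos.
pose o_ k : Rn := [tuple - k.+1%:R | i < n].
have ae_k k : {ae mu, forall x, cube (o_ k) (2 * k.+1%:R) x ->
    g1 x `^ a * g2 x `^ b <= K * 2 `^ (a + b)}.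
  have l0 : 0 < 2 * k.+1%:R :> R by rewrite mulr_gt0.
  have [f1 f2 _] := bound (o_ k) l0.
  have [phi hphi] := dyadic_avg_cvg_ae l0 mg1 (integrable_on_wmeas mg1 g10 f1) mg2
    (integrable_on_wmeas mg2 g20 f2).
  apply: filterS2 hphi gpos => x hx [gx1 gx2] /hx[/cvgrPdist_lt c1 /cvgrPdist_lt c2].
  have {c1}c1 := c1 _ (divr_gt0 gx1 (ltr0Sn R 1)).
  have {c2}c2 := c2 _ (divr_gt0 gx2 (ltr0Sn R 1)).
  near \oo => i.
  have h1 : `|g1 x - dyadic_avg (cube_avg g1) (phi i) (o_ k) (2 * k.+1%:R) x| < g1 x / 2.
    by near: i; exact: c1.
  have h2 : `|g2 x - dyadic_avg (cube_avg g2) (phi i) (o_ k) (2 * k.+1%:R) x| < g2 x / 2.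
    by near: i; exact: c2.
  have [d1 [d2 hd]] := dyadic_avg_densities_le (phi i) (o_ k) x l0.
  move: h1 h2 d1 d2 hd; move: (dyadic_avg (cube_avg g1) _ _ _ _) (dyadic_avg (cube_avg g2) _ _ _ _) => y1 y2 h1 h2 d1 d2 hd.
  have e1 : g1 x / 2 <= y1 by move: h1; rewrite ltr_norml => /andP[]; lra.
  have e2 : g2 x / 2 <= y2 by move: h2; rewrite ltr_norml => /andP[]; lra.
  have e (c z y : R) : 0 < c -> 0 < z -> z / 2 <= y -> z `^ c <= 2 `^ c * y `^ c.
    move=> c0 z0 zy; have y0 : 0 <= y by apply: le_trans zy; rewrite divr_ge0// ltW.
    rewrite -powRM//; apply: ge0_ler_powR; rewrite ?nnegrE ?mulr_ge0 ?(ltW c0) ?(ltW z0)//.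
    lra.
  apply: (@le_trans _ _ ((2 `^ a * y1 `^ a) * (2 `^ b * y2 `^ b))).
    by apply: ler_pM; rewrite ?powR_ge0//; exact: e.
  rewrite mulrACA -powRD; last by rewrite pnatr_eq0/= implybT.
  by rewrite mulrC; apply: ler_wpM2r => //; exact: powR_ge0.
have := ae_foralln ae_k; apply: filterS => x hx.
pose k := Num.truncn (eucl_dist [tuple 0 | i < n] x).
apply: (hx k) => i; rewrite tnth_mktuple.
have := coord_le_eucl_dist [tuple 0 | i < n] x i; rewrite tnth_mktuple sub0r normrN.
have /andP[_ kx] := truncn_itv (eucl_dist_ge0 [tuple 0 | i < n] x).
move=> /le_lt_trans/(_ kx); rewrite ltr_norml -/k => /andP[]; lra.
Unshelve. all: by end_near. Qed.

End two_densities.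

(** * The John-Nirenberg inequality *)

Section john_nirenberg.
Context {R : realType} (n : nat).
Local Notation Rn := (n.-tuple R).
Local Notation mu := (@leb R n).
Implicit Types (o x : Rn) (l : R).
Variables (b v : Rn -> R) (B d : R).
Hypotheses (mb : measurable_fun setT b) (mv : measurable_fun setT v)
  (v0 : forall x, 0 <= v x).
Hypothesis lb : forall o l, 0 < l -> integrable_on o l b.
Hypotheses (B0 : 0 < B) (d01 : 0 < d <= 1).
Hypothesis bmoB : forall o l, 0 < l -> (osc b o l (cube_avg b o l) <= (B * l ^+ n)%:E)%E.
Hypothesis weak : small_part_bound v d.

Let m := jn_exponent n B d.
Let m0 : 0 < m. Proof. exact: jn_exponent_gt0. Qed.

Lemma cube_avg_osc o l c : 0 < l ->
  ((l ^+ n * `|cube_avg b o l - c|)%:E <= osc b o l c)%E.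
Proof.
move=> l0; have ci : integrable_on o l (cst c).
  by apply: (@integrable_bounded _ _ _ _ l0 _ `|c|) => // x.
have := cube_avg_dist l0 (lb o l0) ci.
by rewrite (@cube_avg_cst _ _ (cst c) o l c l0).
Qed.

(** The bound for dyadic averages is uniform in the generation; the averages
converge almost everywhere along a subsequence, and Fatou concludes. *)
Lemma john_nirenberg o l : 0 < l ->
  (\int[mu]_(x in cube o l) (expR (m * `|b x - cube_avg b o l|) * v x)%:E <=
   (2 / d ^+ 2)%:E * wmeas v (cube o l))%E.
Proof.
move=> l0; have mQ := measurable_cube o l; set c := cube_avg b o l.
have [phi hphi] := dyadic_avg_cvg_ae l0 mb (lb o l0) mb (lb o l0).
pose F (g : Rn -> R) x : \bar R := (expR (m * `|g x - c|) * v x)%:E.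
have mF g : measurable_fun setT g -> measurable_fun setT (F g).
  move=> mg; apply/measurable_EFinP; apply: measurable_funM => //.
  apply: (measurableT_comp (@measurable_expR R)); apply: measurable_funM => //.
  by apply: measurableT_comp => //; exact: measurable_funB.
have F0 g x : (0 <= F g x)%E by rewrite lee_fin mulr_ge0// expR_ge0.
pose f i := F (dyadic_avg (cube_avg b) (phi i) o l).
have mf i : measurable_fun (cube o l) (f i).
  by apply: measurable_funTS; apply: mF; exact: measurable_dyadic_avg.
have fle i : (\int[mu]_(x in cube o l) f i x <= (2 / d ^+ 2)%:E * wmeas v (cube o l))%E.
  rewrite /f /F -(tree_exp_integral _ _ _ _ _ l0 mv v0).
  exact: (tree_exp_le mv v0 mb cube_avg_osc B0 d01 bmoB weak).
have fatou_f := fatou mu mQ mf (fun i x _ => F0 _ x).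
apply: (le_trans (le_trans _ fatou_f)).
  apply: ae_ge0_le_integral.
  - exact: mQ.
  - by move=> x _; exact: F0.
  - exact: measurable_funTS (mF b mb).
  - move=> x _; rewrite limn_einf_lim; apply: lime_ge; first exact: is_cvg_einfs.
    by apply: nearW => k; apply: le_ereal_inf_tmp => _ [i _ <-]; exact: F0.
  - rewrite /limn_einf; apply: measurableT_comp => //; apply: measurable_fun_limn_esup => i.
    by apply: measurableT_comp.
  apply: filterS hphi => x hx Qx; have [hx1 _] := hx Qx.
  have cv : f i x @[i --> \oo] --> F b x.
    apply/fine_cvgP; split; first exact: nearW.
    apply: cvgMl; apply: continuous_cvg; first exact: continuous_expR.
    apply: cvgMr; apply: cvg_norm; apply: cvgB => //; exact: cvg_cst.
  by rewrite (cvg_limn_einf_sup cv).1.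
rewrite limn_einf_lim; apply: lime_le; first exact: is_cvg_einfs.
apply: nearW => k; apply: le_trans (fle k); apply: ereal_inf_lbound; exists k => //=.
Qed.

Lemma john_nirenberg_power g o l : 0 < g -> 0 < l ->
  (\int[mu]_(x in cube o l) (`|b x - cube_avg b o l| `^ g * v x)%:E <=
   ((g / m) `^ g * (2 / d ^+ 2))%:E * wmeas v (cube o l))%E.
Proof.
move=> g0 l0; have mQ := measurable_cube o l.
have k0 : 0 <= (g / m) `^ g by exact: powR_ge0.
have mE : measurable_fun setT (fun x => (expR (m * `|b x - cube_avg b o l|) * v x)%:E).
  apply/measurable_EFinP; apply: measurable_funM => //.
  apply: (measurableT_comp (@measurable_expR R)); apply: measurable_funM => //.
  by apply: measurableT_comp => //; exact: measurable_funB.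
have mEQ := measurable_funS measurableT (@subsetT _ (cube o l)) mE.
have E0 x : cube o l x -> (0 <= (expR (m * `|b x - cube_avg b o l|) * v x)%:E)%E.
  by move=> _; rewrite lee_fin mulr_ge0// expR_ge0.
apply: (@le_trans _ _ (((g / m) `^ g)%:E * \int[mu]_(x in cube o l)
    (expR (m * `|b x - cube_avg b o l|) * v x)%:E)%E).
  rewrite -(@ge0_integralZl_EFin _ _ _ mu _ mQ _ E0 mEQ _ k0).
  apply: le_integral_ge0 => x _; first by rewrite lee_fin mulr_ge0 ?powR_ge0.
  by rewrite -EFinM lee_fin mulrA; apply: ler_wpM2r => //; exact: powR_le_expR.
rewrite [in leRHS]EFinM -muleA; apply: lee_wpmul2l; first by rewrite lee_fin.
exact: john_nirenberg.
Qed.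

End john_nirenberg.

(** * The two densities of a weight in A_(p,q) *)

Section cubes_of_balls.
Context {R : realType} (n : nat) (alpha p q : R).
Local Notation Rn := (n.-tuple R).
Local Notation mu := (@leb R n).
Hypotheses (an : 0 < alpha < n%:R) (hp : 1 <= p < n%:R / alpha)
  (hq : q^-1 = p^-1 - alpha / n%:R).
Hypothesis p1 : 1 < p.

Let n0 := natR_gt0 an.
Let p0 := p_gt0 hp.
Let q0 := q_gt0 an hp hq.

Lemma conj_expV : (conj_exp p)^-1 = 1 - p^-1.
Proof. by rewrite /conj_exp invrK. Qed.

Lemma conj_exp_gt0 : 0 < conj_exp p.
Proof. by rewrite -invr_gt0 conj_expV subr_gt0 invf_lt1. Qed.

Lemma exponent_sum : n%:R * (q^-1 + (conj_exp p)^-1) = n%:R - alpha.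
Proof.
rewrite hq conj_expV (_ : p^-1 - alpha / n%:R + (1 - p^-1) = 1 - alpha / n%:R); last by ring.
by rewrite mulrBr mulr1 mulrCA mulfV ?mulr1// gt_eqF.
Qed.

Lemma cube_power_bound C v1 v2 : is_weight v1 -> is_weight v2 -> 0 < C ->
  power_bound alpha p q C v1 v2 ->
  forall (o : Rn) l, 0 < l -> [/\ wmeas (wpow v2 q) (cube o l) \is a fin_num,
    wmeas (wpow v1 (- conj_exp p)) (cube o l) \is a fin_num &
    (wmeas (wpow v2 q) (cube o l) `^ q^-1 *
     wmeas (wpow v1 (- conj_exp p)) (cube o l) `^ (conj_exp p)^-1
     <= ((C * n.+1%:R `^ (n%:R - alpha)) * (l ^+ n) `^ (q^-1 + (conj_exp p)^-1))%:E)%E].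
Proof.
move=> wv1 wv2 C0 hC o l l0; have nl0 : 0 < n.+1%:R * l by rewrite mulr_gt0.
have [f2 [f1 h]] := hC o _ nl0.
have sub (v : Rn -> R) c : is_weight v ->
    (wmeas (wpow v c) (cube o l) <= wmeas (wpow v c) (eball o (n.+1%:R * l)))%E.
  move=> wv; apply: ge0_subset_integral.
  - exact: measurable_cube.
  - exact: measurable_eball.
  - by apply: measurable_funTS; apply/measurable_EFinP; exact: measurable_wpow.
  - by move=> x _; rewrite lee_fin powR_ge0.
  - exact: cube_sub_eball.
have g0 (v : Rn -> R) c E : (0 <= wmeas (wpow v c) E)%E.
  by apply: wmeas_ge0 => x; exact: powR_ge0.
split.
- by rewrite ge0_fin_numE// (le_lt_trans (sub _ _ wv2))// ltey_eq f2.
- by rewrite ge0_fin_numE// (le_lt_trans (sub _ _ wv1))// ltey_eq f1.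
rewrite powR_nat_exp ?(ltW l0)// exponent_sum -mulrA -powRM ?(ltW l0)//.
apply: le_trans h; apply: lee_pmul; try exact: poweR_ge0.
- by apply: lee_poweR => //; [rewrite invr_ge0 ltW|exact: sub].
- by apply: lee_poweR => //; [rewrite invr_ge0 (ltW conj_exp_gt0)|exact: sub].
Qed.

Lemma wpowVK (v : Rn -> R) c x : 0 < v x -> c != 0 -> wpow v c x `^ c^-1 = v x.
Proof. by move=> vx c0; rewrite /wpow -powRrM mulfV// powRr1// ltW. Qed.

Lemma wpowNVK (v : Rn -> R) c x : 0 < v x -> c != 0 -> wpow v (- c) x `^ c^-1 = (v x)^-1.
Proof. by move=> vx c0; rewrite /wpow -powRrM mulNr mulfV// powR_inv1// ltW. Qed.

Lemma small_part_bound_le (v : Rn -> R) (d d' : R) : (forall x, 0 <= v x) -> d' <= d ->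
  small_part_bound v d -> small_part_bound v d'.
Proof.
move=> v0 dd h o l S l0 mS hS; apply: le_trans (h o l S l0 mS hS) _.
by apply: lee_wpmul2r; [exact: wmeas_ge0|rewrite lee_fin lerB].
Qed.

(** The densities v^q and v^(-p') with the powers 1/q and 1/p' have product 1,
and the power bound on balls controls cubes. *)
Lemma weights_weak_Ainfty C (v : Rn -> R) : is_weight v -> 0 < C -> power_bound alpha p q C v v ->
  exists2 d : R, 0 < d <= 1 &
    small_part_bound (wpow v q) d /\ small_part_bound (wpow v (- conj_exp p)) d.
Proof.
move=> wv C0 hC; have [_ _ _ vpos] := wv.
have K0 : 0 < C * n.+1%:R `^ (n%:R - alpha) by rewrite mulr_gt0// powR_gt0.
have hb := cube_power_bound wv wv C0 hC.
have qV0 : 0 < q^-1 by rewrite invr_gt0.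
have pV0 : 0 < (conj_exp p)^-1 by rewrite invr_gt0 conj_exp_gt0.
have ge0 c x : 0 <= wpow v c x by exact: powR_ge0.
have [d1 /andP[d10 d11] h1] : exists2 d : R, 0 < d <= 1 & small_part_bound (wpow v q) d.
  apply: (weak_Ainfty (measurable_wpow q wv) (measurable_wpow (- conj_exp p) wv) (ge0 _) (ge0 _) qV0 pV0 K0 hb).
  apply: filterS vpos => x vx.
  by rewrite wpowVK ?gt_eqF// wpowNVK ?(gt_eqF conj_exp_gt0)// mulfV// gt_eqF.
have [d2 /andP[d20 d21] h2] : exists2 d : R, 0 < d <= 1 & small_part_bound (wpow v (- conj_exp p)) d.
  apply: (weak_Ainfty (measurable_wpow (- conj_exp p) wv) (measurable_wpow q wv) (ge0 _) (ge0 _) pV0 qV0 K0).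
    move=> o l l0; have [f1 f2 h] := hb o l l0; split; [exact: f2|exact: f1|].
    by rewrite muleC (addrC (conj_exp p)^-1).
  apply: filterS vpos => x vx.
  by rewrite wpowVK ?gt_eqF// wpowNVK ?(gt_eqF conj_exp_gt0)// mulVf// gt_eqF.
exists (Num.min d1 d2); first by rewrite lt_min d10 d20 ge_min d11.
split; [apply: small_part_bound_le h1|apply: small_part_bound_le h2] => //.
  by rewrite ge_min lexx.
by rewrite ge_min lexx orbT.
Qed.

(** Differentiation of the two-weight power bound: the limits of the averages
are v2 and 1 / v1 after the powers 1/q and 1/p'. *)
Lemma weights_le C v1 v2 : is_weight v1 -> is_weight v2 -> 0 < C ->
  power_bound alpha p q C v1 v2 -> exists2 K : R, 0 < K & {ae mu, forall x, v2 x <= K * v1 x}.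
Proof.
move=> wv1 wv2 C0 hC; have [_ _ _ v1pos] := wv1; have [_ _ _ v2pos] := wv2.
have K0 : 0 < C * n.+1%:R `^ (n%:R - alpha) by rewrite mulr_gt0// powR_gt0.
have hb := cube_power_bound wv1 wv2 C0 hC.
have qV0 : 0 < q^-1 by rewrite invr_gt0.
have pV0 : 0 < (conj_exp p)^-1 by rewrite invr_gt0 conj_exp_gt0.
have ge0 v c x : 0 <= wpow v c x :> R by exact: powR_ge0.
have h := densities_le (measurable_wpow q wv2) (measurable_wpow (- conj_exp p) wv1) (ge0 n v2 q) (ge0 n v1 _) qV0 pV0 hb.
have pos : {ae mu, forall x, 0 < wpow v2 q x /\ 0 < wpow v1 (- conj_exp p) x}.
  by apply: filterS2 v1pos v2pos => x x1 x2; rewrite !powR_gt0.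
have {}h := h pos.
exists (C * n.+1%:R `^ (n%:R - alpha) * 2 `^ (q^-1 + (conj_exp p)^-1)).
  by rewrite mulr_gt0// powR_gt0.
apply: filterS3 v1pos v2pos h => x x1 x2.
by rewrite wpowVK ?gt_eqF// wpowNVK ?(gt_eqF conj_exp_gt0)// ler_pdivrMr.
Qed.

End cubes_of_balls.

(** * Functions of bounded mean oscillation *)

Section bmo_on_cubes.
Context {R : realType} (n : nat).
Local Notation Rn := (n.-tuple R).
Local Notation mu := (@leb R n).
Implicit Types (o a x : Rn) (l r : R).

(** The average is an optimal constant up to a factor 2. *)
Lemma osc_cube_avg_le (b : Rn -> R) o l (M c : R) : measurable_fun setT b ->
  (forall o l, 0 < l -> integrable_on o l b) -> 0 < l ->
  (osc b o l c <= (M * l ^+ n)%:E)%E ->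
  (osc b o l (cube_avg b o l) <= (2 * M * l ^+ n)%:E)%E.
Proof.
move=> mb lb l0 h; have mQ := measurable_cube o l.
have p1 x : cube o l x -> (0 <= `|b x - c|%:E :> \bar R)%E by rewrite lee_fin.
have p2 x : cube o l x -> (0 <= (cst `|cube_avg b o l - c|%:E) x :> \bar R)%E by rewrite lee_fin.
have m1 := measurable_funS measurableT (@subsetT _ (cube o l)) (measurable_osc_fun mb c).
have m2 : measurable_fun (cube o l) (cst `|cube_avg b o l - c|%:E) by exact: measurable_cst.
apply: (@le_trans _ _ (osc b o l c + (`|cube_avg b o l - c| * l ^+ n)%:E)%E).
  have -> : (`|cube_avg b o l - c| * l ^+ n)%:E =
      (\int[mu]_(x in cube o l) (cst `|cube_avg b o l - c|%:E) x)%E.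
    by rewrite (integral_cst mu mQ) [X in (_ * X)%E](leb_cube o (ltW l0)) -EFinM.
  rewrite /osc -(ge0_integralD mu mQ p1 m1 p2 m2).
  apply: le_integral_ge0 => x _; first by rewrite lee_fin.
  rewrite -EFinD lee_fin (distrC (cube_avg b o l)).
  rewrite (_ : b x - cube_avg b o l = (b x - c) + (c - cube_avg b o l)); last by ring.
  exact: ler_normD.
have -> : 2 * M * l ^+ n = M * l ^+ n + M * l ^+ n by ring.
rewrite EFinD; apply: leeD => //; apply: le_trans h.
by rewrite mulrC; exact: cube_avg_osc.
Qed.

Variables (b : Rn -> R[i]) (A : R).
Hypotheses (mb : cmeasurable setT b)
  (lb : forall a r, 0 < r -> (\int[mu]_(x in eball a r) (normc (b x))%:E < +oo)%E)
  (A0 : 0 < A)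
  (bA : forall a r, 0 < r ->
    (avg (eball a r) (fun x => normc (b x - cavg (eball a r) b)%R) <= A%:E)%E).

Definition bmo_cube_const : R := 2 * (2 * n.+1%:R) ^+ n.

Lemma bmo_cube_const_gt0 : 0 < bmo_cube_const.
Proof. by rewrite mulr_gt0// exprn_gt0// mulr_gt0. Qed.

(** Used for the real and imaginary parts. A cube lies in a ball of comparable
volume, whose average of b serves as a constant on the cube. *)
Lemma bmo_part (phi : R[i] -> R) : measurable_fun setT (fun x => phi (b x)) ->
  phi 0 = 0 -> (forall z u, `|phi z - phi u| <= normc (z - u)) ->
  (forall o l, 0 < l -> integrable_on o l (fun x => phi (b x))) /\
  (forall o l, 0 < l -> (osc (fun x => phi (b x)) o l (cube_avg (fun x => phi (b x)) o l) <=
     (bmo_cube_const * A * l ^+ n)%:E)%E).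
Proof.
move=> mphi phi0 lip.
have sub o l : 0 < l -> cube o l `<=` eball o (n.+1%:R * l) by exact: cube_sub_eball.
have nl0 l : 0 < l -> 0 < n.+1%:R * l by move=> l0; rewrite mulr_gt0.
have mbn c : measurable_fun setT (fun x => (normc (b x - c))%:E).
  apply/measurable_EFinP; apply: measurable_normc.
  exact: (cmeasurableB mb (cmeasurable_cst _ c)).
have int o l : 0 < l -> integrable_on o l (fun x => phi (b x)).
  move=> l0; apply/integrableP; split.
    by apply/measurable_EFinP; exact: measurable_funTS.
  apply: le_lt_trans (lb o (nl0 l l0)).
  apply: (@le_trans _ _ (\int[mu]_(x in cube o l) (normc (b x))%:E)%E).
    apply: le_integral_ge0 => x _ /=; first by rewrite lee_fin.
    by rewrite lee_fin; have := lip (b x) 0; rewrite phi0 !subr0.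
  apply: ge0_subset_integral; [exact: measurable_cube|exact: measurable_eball| | |exact: sub].
    by apply: measurable_funTS; have := mbn 0; under eq_fun do rewrite subr0.
  by move=> x _; rewrite lee_fin normc_ge0.
split=> // o l l0; rewrite /bmo_cube_const -(mulrA 2).
set Bo := eball o (n.+1%:R * l); set c := cavg Bo b.
apply: (@osc_cube_avg_le _ _ _ _ (phi c)) => //.
apply: (@le_trans _ _ (\int[mu]_(x in cube o l) (normc (b x - c)%R)%:E)%E).
  apply: le_integral_ge0 => x _; first by rewrite lee_fin.
  by rewrite lee_fin; exact: lip.
apply: (@le_trans _ _ (\int[mu]_(x in Bo) (normc (b x - c)%R)%:E)%E).
  apply: ge0_subset_integral; [exact: measurable_cube|exact: measurable_eball| | |exact: sub].
    by apply: measurable_funTS; exact: mbn.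
  by move=> x _; rewrite lee_fin normc_ge0.
have [V VE /andP[_ Vle]] := leb_eballE o (nl0 l l0).
have V0 : 0 < V by have := leb_eball_gt0 o (nl0 l l0); rewrite VE lte_fin.
have := bA o (nl0 l l0); rewrite /avg VE inver gt_eqF// -/Bo -/c lee_pdivrMl//.
move=> /le_trans; apply; rewrite -EFinM lee_fin mulrC -mulrA mulrCA ler_pM2l//.
by rewrite -exprMn -mulrA.
Qed.

Definition ball_cube a r : set Rn := cube [tuple of map (fun u => u - r) a] (2 * r).

Definition ball_cube_avg (phi : R[i] -> R) a r : R :=
  cube_avg (fun x => phi (b x)) [tuple of map (fun u => u - r) a] (2 * r).

(** The average over the cube circumscribed to the ball; on cubes the dyadic
estimates apply directly. *)
Definition ball_avg a r : R[i] :=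
  Complex (ball_cube_avg (@complex.Re R) a r) (ball_cube_avg (@complex.Im R) a r).

Lemma ball_cube_sub a r : 0 < r -> ball_cube a r `<=` eball a (n.+1%:R * r).
Proof.
move=> r0 x xa; apply: eucl_dist_lt => // i; have := xa i.
rewrite tnth_map => /andP[h1 h2]; rewrite ler_norml; lra.
Qed.

Lemma Re_lip (z u : R[i]) : `|complex.Re z - complex.Re u| <= normc (z - u).
Proof. by rewrite -ReN -ReD; exact: normRe_le. Qed.

Lemma Im_lip (z u : R[i]) : `|complex.Im z - complex.Im u| <= normc (z - u).
Proof. by rewrite -ImN -ImD; exact: normIm_le. Qed.

(** The smaller cube is contained in the larger one, in which it has the
proportion 2^(-n) of the volume. *)
Lemma ball_cube_avg_double (phi : R[i] -> R) a r : 0 < r ->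
  measurable_fun setT (fun x => phi (b x)) ->
  phi 0 = 0 -> (forall z u, `|phi z - phi u| <= normc (z - u)) ->
  `|ball_cube_avg phi a (2 * r) - ball_cube_avg phi a r| <= bmo_cube_const * A * 2 ^+ n.
Proof.
move=> r0 mphi phi0 lip; have [int hosc] := bmo_part mphi phi0 lip.
have r20 : 0 < 2 * r by rewrite mulr_gt0.
have r40 : 0 < 2 * (2 * r) by rewrite mulr_gt0.
rewrite distrC /ball_cube_avg.
set o1 := [tuple of map (fun u => u - r) a]; set o2 := [tuple of map (fun u => u - 2 * r) a].
have := cube_avg_osc int o1 (cube_avg (fun x => phi (b x)) o2 (2 * (2 * r))) r20.
have sub : cube o1 (2 * r) `<=` cube o2 (2 * (2 * r)).
  by move=> x xo i; have := xo i; rewrite !tnth_map => /andP[]; lra.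
move=> h; have : (osc (fun x => phi (b x)) o1 (2 * r) (cube_avg (fun x => phi (b x)) o2 (2 * (2 * r)))
    <= (bmo_cube_const * A * (2 * (2 * r)) ^+ n)%:E)%E.
  apply: le_trans (hosc o2 _ r40); apply: ge0_subset_integral; try exact: measurable_cube.
  - by apply: measurable_funTS; exact: measurable_osc_fun.
  - by move=> x _; rewrite lee_fin.
  - exact: sub.
have P0 : 0 < (2 * r) ^+ n by rewrite exprn_gt0.
move=> /(le_trans h); rewrite lee_fin => h3; rewrite -(ler_pM2l P0).
apply: le_trans h3 _; have -> : (2 * (2 * r)) ^+ n = 2 ^+ n * (2 * r) ^+ n by rewrite -exprMn.
by rewrite le_eqVlt; apply/orP; left; apply/eqP; ring.
Qed.

Lemma ball_avg_double a r : 0 < r ->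
  normc (ball_avg a (2 * r) - ball_avg a r) <= 2 * (bmo_cube_const * 2 ^+ n) * A.
Proof.
move=> r0; apply: le_trans (normc_le _) _; have [mRe mIm] := mb.
rewrite ReD ImD ReN ImN /=.
have h1 := ball_cube_avg_double a r0 mRe erefl Re_lip.
have h2 := ball_cube_avg_double a r0 mIm erefl Im_lip.
lra.
Qed.

Section moments.
Variables (v : Rn -> R) (d g : R).
Hypotheses (mv : measurable_fun setT v) (v0 : forall x, 0 <= v x).
Hypotheses (d01 : 0 < d <= 1) (g0 : 0 < g).
Hypothesis weak : small_part_bound v d.

(** The constant of john_nirenberg_power for the real and the imaginary part,
homogenized to the power 1/g, with A divided out. *)
Definition moment_const : R :=
  g / (ln (1 + d) / (2 ^+ n * (2 * bmo_cube_const))) *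
  (2 `^ g * 2 * (2 / d ^+ 2)) `^ g^-1.

Lemma bmo_moment a r : 0 < r ->
  (\int[mu]_(x in ball_cube a r) (normc (b x - ball_avg a r) `^ g * v x)%:E <=
   ((moment_const * A) `^ g)%:E * wmeas v (ball_cube a r))%E.
Proof.
move=> r0; have r20 : 0 < 2 * r by rewrite mulr_gt0.
have [mRe mIm] := mb; have B0 : 0 < bmo_cube_const * A by rewrite mulr_gt0// bmo_cube_const_gt0.
have [iRe hRe] := bmo_part mRe erefl Re_lip; have [iIm hIm] := bmo_part mIm erefl Im_lip.
have jRe := john_nirenberg_power mRe mv v0 iRe B0 d01 hRe weak
  [tuple of map (fun u => u - r) a] g0 r20.
have jIm := john_nirenberg_power mIm mv v0 iIm B0 d01 hIm weak
  [tuple of map (fun u => u - r) a] g0 r20.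
set k := (g / jn_exponent n (bmo_cube_const * A) d) `^ g * (2 / d ^+ 2) in jRe jIm.
have /andP[d0 d1] := d01.
have mpos : 0 < g / jn_exponent n (bmo_cube_const * A) d.
  by rewrite divr_gt0// jn_exponent_gt0.
have kE : (moment_const * A) `^ g = 2 `^ g * 2 * k.
  have c0 : 0 < 2 `^ g * 2 * (2 / d ^+ 2).
    by rewrite mulr_gt0 ?divr_gt0 ?exprn_gt0 ?mulr_gt0 ?powR_gt0.
  have l1 : 0 < ln (1 + d) by rewrite ln_gt0// ltrDl.
  have -> : moment_const * A = g / jn_exponent n (bmo_cube_const * A) d *
      (2 `^ g * 2 * (2 / d ^+ 2)) `^ g^-1.
    rewrite /moment_const /jn_exponent; move: (_ `^ g^-1) => y.
    have := bmo_cube_const_gt0; move: bmo_cube_const => z z0.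
    by field; rewrite !gt_eqF ?exprn_gt0//.
  rewrite powRM ?powR_ge0 ?(ltW mpos)// -powRrM mulVf ?gt_eqF// powRr1 ?(ltW c0)//.
  by rewrite /k; ring.
have k0 : 0 <= k by rewrite mulr_ge0 ?powR_ge0// divr_ge0// exprn_ge0// ltW.
rewrite -/(ball_cube a r) in jRe jIm.
pose F (phi : R[i] -> R) x : R := `|phi (b x) - ball_cube_avg phi a r| `^ g * v x.
have mQ : measurable (ball_cube a r) by exact: measurable_cube.
have mF phi : measurable_fun setT (fun x => phi (b x)) ->
    measurable_fun (ball_cube a r) (fun x => (F phi x)%:E).
  move=> mphi; apply: measurable_funTS; apply/measurable_EFinP; apply: measurable_funM => //.
  apply: measurable_comp_powR; apply: measurableT_comp => //.
  exact: measurable_funB.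
have F0 phi x : ball_cube a r x -> (0 <= (F phi x)%:E)%E.
  by move=> _; rewrite lee_fin mulr_ge0 ?powR_ge0.
have c0 : 0 <= 2 `^ g by exact: powR_ge0.
have c0e : 0 < 2 `^ g by rewrite powR_gt0.
have nu0 := wmeas_ge0 (ball_cube a r) v0.
apply: (@le_trans _ _ (\int[mu]_(x in ball_cube a r) ((2 `^ g)%:E *
    ((F (@complex.Re R) x)%:E + (F (@complex.Im R) x)%:E)))%E).
  apply: le_integral_ge0 => x _; first by rewrite lee_fin mulr_ge0 ?powR_ge0.
  rewrite -EFinD -EFinM lee_fin /F -mulrDl mulrA; apply: ler_wpM2r => //.
  apply: le_trans (powR_add_le _ _ _); rewrite ?(ltW g0)//.
  apply: ge0_ler_powR; rewrite ?nnegrE ?normc_ge0 ?addr_ge0 ?(ltW g0)//.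
  by apply: le_trans (normc_le _) _; rewrite ReD ImD ReN ImN.
apply: (@le_trans _ _ ((2 `^ g)%:E * \int[mu]_(x in ball_cube a r)
    ((F (@complex.Re R) x)%:E + (F (@complex.Im R) x)%:E))%E).
  by apply: le_integralZl_ge0 => // x Qx; apply: adde_ge0; exact: F0.
rewrite (ge0_integralD mu mQ (F0 _) (mF _ mRe) (F0 _) (mF _ mIm)).
rewrite kE (_ : 2 `^ g * 2 * k = 2 `^ g * (k + k)); last by ring.
rewrite [in leRHS]EFinM -muleA; apply: lee_wpmul2l; first by rewrite lee_fin.
rewrite [(k + k)%:E]EFinD ge0_muleDl ?lee_fin//; apply: leeD; [exact: jRe|exact: jIm].
Qed.

End moments.
End bmo_on_cubes.

(** * Oscillation bounds on balls *)

Lemma powR_dual (R : realType) (x y w s t : R) : 0 <= x -> 0 <= y -> 0 < w -> 0 < s -> 0 < t ->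
  (x `^ s * w `^ s) `^ s^-1 * (y `^ t * w `^ (- t)) `^ t^-1 = x * y.
Proof.
move=> x0 y0 w0 s0 t0.
have e (z c : R) : 0 <= z -> 0 < c -> (z `^ c) `^ c^-1 = z.
  by move=> z0 c0; rewrite -powRrM mulfV ?gt_eqF// powRr1.
have wV0 : 0 <= w^-1 by rewrite invr_ge0 ltW.
have -> : w `^ (- t) = w^-1 `^ t by rewrite -mulN1r powRrM powR_inv1// ltW.
rewrite -powRM ?(ltW w0)// -powRM// !e ?mulr_ge0 ?(ltW w0)//.
by rewrite mulrACA mulfV ?gt_eqF// mulr1.
Qed.

Section bmo_bounds.
Context {R : realType} (n : nat) (alpha p q : R).
Local Notation Rn := (n.-tuple R).
Local Notation mu := (@leb R n).
Hypotheses (an : 0 < alpha < n%:R) (hp : 1 <= p < n%:R / alpha)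
  (hq : q^-1 = p^-1 - alpha / n%:R).
Hypothesis p1 : 1 < p.

Let n0 := natR_gt0 an.
Let p0 := p_gt0 hp.
Let q0 := q_gt0 an hp hq.

Lemma moment_const_gt0 (d g : R) : 0 < d <= 1 -> 0 < g -> 0 < moment_const n d g.
Proof.
move=> /andP[d0 _] g0; rewrite /moment_const mulr_gt0 ?powR_gt0//; last first.
  by rewrite mulr_gt0 ?divr_gt0 ?exprn_gt0 ?mulr_gt0 ?powR_gt0.
have l1 : 0 < ln (1 + d) by rewrite ln_gt0// ltrDl.
have b0 := bmo_cube_const_gt0 (R := R) n.
by rewrite divr_gt0// divr_gt0// mulr_gt0 ?exprn_gt0// mulr_gt0.
Qed.

Variables (w1 w2 : Rn -> R) (C1 C2 Kd : R).
Hypotheses (ww1 : is_weight w1) (ww2 : is_weight w2) (C10 : 0 < C1) (C20 : 0 < C2)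
  (pb1 : power_bound alpha p q C1 w1 w2) (pb2 : power_bound alpha p q C2 w2 w2)
  (Kd0 : 0 < Kd).
Local Notation U a r := (wmeas (wpow w2 q) (eball a r)).
Hypothesis doubling : forall a r, 0 < r ->
  (U a (2 * r)%R `^ q^-1 <= Kd%:E * U a r `^ q^-1)%E.

Lemma doubling_expn k a r : 0 < r ->
  (U a (2 ^+ k * r)%R `^ q^-1 <= (Kd ^+ k)%:E * U a r `^ q^-1)%E.
Proof.
move=> r0; elim: k => [|k IH]; first by rewrite !expr0 !mul1r mul1e.
have kr0 : 0 < 2 ^+ k * r by rewrite mulr_gt0// exprn_gt0.
rewrite [in leLHS]exprS -mulrA; apply: le_trans (doubling a kr0) _.
rewrite [in leRHS]exprS [in leRHS]EFinM -muleA; apply: lee_wpmul2l => //.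
by rewrite lee_fin ltW.
Qed.

Let U_mono a (r r' : R) : r <= r' -> (U a r `^ q^-1 <= U a r' `^ q^-1)%E.
Proof.
move=> rr; apply: lee_poweR.
- by rewrite invr_ge0 ltW.
- by apply: wmeas_ge0 => x; exact: powR_ge0.
apply: ge0_subset_integral; try exact: measurable_eball.
- by apply: measurable_funTS; apply/measurable_EFinP; exact: measurable_wpow.
- by move=> x _; rewrite lee_fin powR_ge0.
- exact: sub_eball.
Qed.

(** What the commutator estimate needs from b: the moment of b - c for the
density w2^q, a bound on the integral of |b - c| |f| of the same form as
dual_bound, and the slow drift of c. *)
Definition bmo_bound (Cb : R) (b : Rn -> R[i]) (A : R) (c : Rn -> R -> R[i]) := forall a r, 0 < r ->
  [/\ (Lp_norm q (wpow w2 q) (eball a r) (fun x => b x - c a r)%R <=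
        (Cb * A)%:E * U a r `^ q^-1)%E,
      (forall f : Rn -> R[i], cmeasurable setT f ->
       ((\int[mu]_(x in eball a r) (normc (b x - c a r)%R * normc (f x))%:E) * U a r `^ q^-1 <=
        (Cb * A * r `^ (n%:R - alpha))%:E * Lp_norm p (wpow w1 p) (eball a r) f)%E) &
      normc (c a (2 * r) - c a r) <= Cb * A].

(** The first bound is the moment of order q for w2^q, with doubling to return
from the circumscribed cube to the ball. The second is Hoelder with the factors
|f| w2 and |b - c| / w2, the moment of order p' for w2^(-p'), and w2 <= K w1.
The constant depends neither on b nor on A. *)
Lemma bmo_bounds : exists2 C : R, 0 < C & forall (b : Rn -> R[i]) (A : R), 0 < A ->
  cmeasurable setT b ->
  (forall a r, 0 < r -> (\int[mu]_(x in eball a r) (normc (b x))%:E < +oo)%E) ->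
  (forall a r, 0 < r ->
    (avg (eball a r) (fun x => normc (b x - cavg (eball a r) b)%R) <= A%:E)%E) ->
  exists c : Rn -> R -> R[i], bmo_bound C b A c.
Proof.
have p'0 := conj_exp_gt0 hp p1.
have qV0 : 0 < q^-1 by rewrite invr_gt0.
have pV0 : 0 < p^-1 by rewrite invr_gt0.
have p'V0 : 0 < (conj_exp p)^-1 by rewrite invr_gt0.
have [d d01 [weakU weakS]] := weights_weak_Ainfty an hp hq p1 ww2 C20 pb2.
have [K K0 w21] := weights_le an hp hq p1 ww1 ww2 C10 pb1.
(* c1, c2 and c3 serve the three bounds, in order *)
pose M1 := moment_const n d q; pose M2 := moment_const n d (conj_exp p).
have M10 : 0 < M1 by exact: moment_const_gt0.
have M20 : 0 < M2 by exact: moment_const_gt0.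
pose c1 := M1 * Kd ^+ n.+1; pose c2 := M2 * K * (C2 * n.+1%:R `^ (n%:R - alpha)).
pose c3 : R := 2 * (bmo_cube_const n * 2 ^+ n).
have c10 : 0 < c1 by apply: mulr_gt0; [exact: M10|exact: exprn_gt0].
have c20 : 0 < c2.
  by apply: mulr_gt0; [exact: mulr_gt0|apply: mulr_gt0 => //; exact: powR_gt0].
have c30 : 0 < c3 by rewrite !mulr_gt0 ?exprn_gt0// bmo_cube_const_gt0.
exists (c1 + c2 + c3); first by rewrite !addr_gt0.
move=> b A A0 mb lb bA; exists (ball_avg b) => a r r0.
have nr0 : 0 < n.+1%:R * r by rewrite mulr_gt0.
have sub1 : eball a r `<=` ball_cube a r by exact: eball_sub_cube.
have sub2 : ball_cube a r `<=` eball a (n.+1%:R * r) by exact: ball_cube_sub.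
have mB : measurable (eball a r) by exact: measurable_eball.
have mQ : measurable (ball_cube a r) by exact: measurable_cube.
have mB' : measurable (eball a (n.+1%:R * r)) by exact: measurable_eball.
have mbc : cmeasurable setT (fun x => b x - ball_avg b a r).
  exact: (cmeasurableB mb (cmeasurable_cst _ _)).
have mom (v : Rn -> R) g : 0 < g -> measurable_fun setT v ->
    (forall x, 0 <= v x) -> small_part_bound v d ->
    ((\int[mu]_(x in eball a r) (normc (b x - ball_avg b a r)%R `^ g * v x)%:E) `^ g^-1 <=
     (moment_const n d g * A)%:E * wmeas v (eball a (n.+1%:R * r)%R) `^ g^-1)%E.
  move=> g0 mv v0 wk; have gV0 : 0 <= g^-1 by rewrite invr_ge0 ltW.
  have MA0 : 0 <= moment_const n d g * A.
    exact: (mulr_ge0 (ltW (moment_const_gt0 d01 g0)) (ltW A0)).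
  have mF : measurable_fun setT (fun x => (normc (b x - ball_avg b a r) `^ g * v x)%:E).
    apply/measurable_EFinP; apply: measurable_funM => //.
    by apply: measurable_comp_powR; exact: measurable_normc.
  apply: (@le_trans _ _ ((((moment_const n d g * A) `^ g)%:E *
      wmeas v (eball a (n.+1%:R * r)%R)) `^ g^-1)%E).
    apply: lee_poweR => //.
      by apply: integral_ge0 => x _; rewrite lee_fin mulr_ge0 ?powR_ge0.
    apply: (@le_trans _ _ (((moment_const n d g * A) `^ g)%:E * wmeas v (ball_cube a r))%E).
      apply: le_trans (bmo_moment mb lb A0 bA mv v0 d01 g0 wk a r0).
      apply: ge0_subset_integral => //.
      - exact: measurable_funTS.
      - by move=> x _; rewrite lee_fin mulr_ge0 ?powR_ge0.
    apply: lee_wpmul2l; first by rewrite lee_fin powR_ge0.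
    apply: ge0_subset_integral => //.
    - by apply: measurable_funTS; exact/measurable_EFinP.
    - by move=> x _; rewrite lee_fin.
  rewrite poweRM ?lee_fin ?powR_ge0 ?wmeas_ge0// poweR_EFin -powRrM mulfV ?gt_eqF//.
  by rewrite powRr1.
split.
- have := mom (wpow w2 q) q q0 (measurable_wpow _ ww2) (fun x => powR_ge0 _ _) weakU.
  move=> /le_trans; apply; rewrite -/M1.
  have hU : (U a (n.+1%:R * r)%R `^ q^-1 <= (Kd ^+ n.+1)%:E * U a r `^ q^-1)%E.
    apply: le_trans (doubling_expn n.+1 a r0); apply: U_mono; apply: ler_wpM2r; first exact: ltW.
    by rewrite -natrX ler_nat ltnW// ltn_expl.
  have M1A : (0 <= (M1 * A)%:E :> \bar R)%E := ltW (mulr_gt0 M10 A0).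
  apply: (le_trans (lee_wpmul2l M1A hU)); rewrite muleA -EFinM.
  apply: lee_wpmul2r; first exact: poweR_ge0.
  rewrite lee_fin mulrAC; apply: ler_wpM2r; first exact: ltW.
  by rewrite -/c1 -addrA lerDl addr_ge0// ltW.
- move=> f mf.
  have hS := mom (wpow w2 (- conj_exp p)) (conj_exp p) p'0 (measurable_wpow _ ww2)
    (fun x => powR_ge0 _ _) weakS; rewrite -/M2 in hS.
  set I := (\int[mu]_(x in _) _)%E in hS.
  set S' := wmeas _ _ in hS.
  have mnf : measurable_fun setT (fun x => normc (f x)) by exact: measurable_normc.
  have mnb : measurable_fun setT (fun x => normc (b x - ball_avg b a r)) by exact: measurable_normc.
  pose g1 x := normc (f x) `^ p * wpow w2 p x.
  pose g2 x := normc (b x - ball_avg b a r) `^ conj_exp p * wpow w2 (- conj_exp p) x.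
  have mg1 : measurable_fun setT g1.
    by apply: measurable_funM; [exact: measurable_comp_powR|exact: measurable_wpow].
  have mg2 : measurable_fun setT g2.
    by apply: measurable_funM; [exact: measurable_comp_powR|exact: measurable_wpow].
  have g10 x : 0 <= g1 x by rewrite mulr_ge0 ?powR_ge0.
  have g20 x : 0 <= g2 x by rewrite mulr_ge0 ?powR_ge0.
  have [_ _ _ w2pos] := ww2; have [_ w10 _ _] := ww1.
  have hold : (\int[mu]_(x in eball a r) (normc (b x - ball_avg b a r)%R * normc (f x))%:E <=
      (\int[mu]_(x in eball a r) (g1 x)%:E) `^ p^-1 * I `^ (conj_exp p)^-1)%E.
    have sum1 : p^-1 + (conj_exp p)^-1 = 1 by rewrite conj_expV; ring.
    apply: (le_trans _ (hoelder_powR mu mB mg1 mg2 g10 g20 pV0 p'V0 sum1)).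
    have mG : measurable_fun setT (fun x => g1 x `^ p^-1 * g2 x `^ (conj_exp p)^-1).
      by apply: measurable_funM; exact: measurable_comp_powR.
    apply: ae_ge0_le_integral.
    - exact: mB.
    - by move=> x _; rewrite lee_fin mulr_ge0 ?normc_ge0.
    - by apply: measurable_funTS; apply/measurable_EFinP; exact: measurable_funM.
    - by move=> x _; rewrite lee_fin mulr_ge0 ?powR_ge0.
    - by apply: measurable_funTS; exact/measurable_EFinP.
    apply: filterS w2pos => x wx _; rewrite lee_fin.
    rewrite [leRHS](powR_dual (normc_ge0 (f x)) (normc_ge0 (b x - ball_avg b a r)) wx p0 p'0).
    by rewrite mulrC.
  have hF : ((\int[mu]_(x in eball a r) (g1 x)%:E) `^ p^-1 <=
      K%:E * Lp_norm p (wpow w1 p) (eball a r) f)%E.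
    have mw1 : measurable_fun setT (fun x => normc (f x) `^ p * wpow w1 p x).
      by apply: measurable_funM; [exact: measurable_comp_powR|exact: measurable_wpow].
    have Kp0 : 0 < K `^ p by rewrite powR_gt0.
    have pos x : (0 <= (normc (f x) `^ p * wpow w1 p x)%:E :> \bar R)%E.
      by rewrite lee_fin mulr_ge0 ?powR_ge0.
    apply: (@le_trans _ _ (((K `^ p)%:E * \int[mu]_(x in eball a r)
        (normc (f x) `^ p * wpow w1 p x)%:E) `^ p^-1)%E).
      apply: lee_poweR; first exact: ltW.
        by apply: integral_ge0 => x _; rewrite lee_fin.
      have mwB : measurable_fun (eball a r) (fun x => (normc (f x) `^ p * wpow w1 p x)%:E).
        by apply: measurable_funTS; exact/measurable_EFinP.
      rewrite -(@ge0_integralZl_EFin _ _ _ mu _ mB _ (fun x _ => pos x) mwB _ (ltW Kp0)).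
      apply: ae_ge0_le_integral.
      - exact: mB.
      - by move=> x _; rewrite lee_fin.
      - by apply: measurable_funTS; exact/measurable_EFinP.
      - by move=> x _; apply: mule_ge0; [rewrite lee_fin (ltW Kp0)|exact: pos].
      - exact: measurable_funeM.
      apply: filterS2 w2pos w21 => x wx ww _; rewrite -EFinM lee_fin /g1 mulrCA.
      apply: ler_wpM2l; first exact: powR_ge0.
      rewrite /wpow -powRM ?(ltW K0)//; apply: ge0_ler_powR; rewrite ?nnegrE ?(ltW wx) ?(ltW p0)//.
      by rewrite mulr_ge0// ltW.
    rewrite poweRM ?lee_fin ?powR_ge0//; last by apply: integral_ge0.
    by rewrite poweR_EFin -powRrM mulfV ?gt_eqF// powRr1 ?(ltW K0).
  have [_ [_ hC2]] := pb2 a nr0.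
  have hU : (U a r `^ q^-1 <= U a (n.+1%:R * r)%R `^ q^-1)%E.
    by apply: U_mono; rewrite ler_peMl ?(ltW r0)// ler1n.
  have L0 : (0 <= Lp_norm p (wpow w1 p) (eball a r) f)%E by exact: poweR_ge0.
  have K0e : (0 <= K%:E :> \bar R)%E by rewrite lee_fin ltW.
  have M2A : (0 <= (M2 * A)%:E :> \bar R)%E := ltW (mulr_gt0 M20 A0).
  apply: (le_trans (lee_wpmul2r (poweR_ge0 _ _) hold)).
  apply: (@le_trans _ _ ((K%:E * Lp_norm p (wpow w1 p) (eball a r) f) *
      ((M2 * A)%:E * S' `^ (conj_exp p)^-1) * U a (n.+1%:R * r)%R `^ q^-1)%E).
    apply: (lee_pmul _ (poweR_ge0 _ _) _ hU).
      by apply: mule_ge0; exact: poweR_ge0.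
    exact: (lee_pmul (poweR_ge0 _ _) (poweR_ge0 _ _) hF hS).
  apply: (@le_trans _ _ (K%:E * (M2 * A)%:E *
      (C2 * (n.+1%:R * r) `^ (n%:R - alpha))%:E * Lp_norm p (wpow w1 p) (eball a r) f)%E).
    rewrite -!muleA; apply: lee_wpmul2l => //.
    rewrite muleC -!muleA; apply: lee_wpmul2l => //.
    rewrite muleA; apply: lee_wpmul2r => //.
    by rewrite muleC; exact: hC2.
  rewrite -!EFinM; apply: lee_wpmul2r => //; rewrite lee_fin powRM ?(ltW r0)//.
  have rr := powR_ge0 r (n%:R - alpha).
  have -> : K * (M2 * A) * (C2 * (n.+1%:R `^ (n%:R - alpha) * r `^ (n%:R - alpha))) =
    c2 * A * r `^ (n%:R - alpha) by rewrite /c2; ring.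
  apply: ler_wpM2r => //; apply: ler_wpM2r; first exact: ltW.
  by rewrite -addrA addrCA lerDl addr_ge0// ltW.
- apply: le_trans (ball_avg_double mb lb A0 bA a r0) _; apply: ler_wpM2r; first exact: ltW.
  by rewrite lerDr addr_ge0// ltW.
Qed.

End bmo_bounds.

(** * The commutator on a time slice *)

Section commutator_slice.
Context {R : realType} (n : nat) (alpha p q : R).
Local Notation Rn := (n.-tuple R).
Local Notation Fn := (Rn -> R[i]).
Local Notation mu := (@leb R n).
Hypotheses (an : 0 < alpha < n%:R) (hp : 1 <= p < n%:R / alpha)
  (hq : q^-1 = p^-1 - alpha / n%:R).

Let n0 := natR_gt0 an.
Let p0 := p_gt0 hp.
Let q0 := q_gt0 an hp hq.
Let qV0 : 0 < q^-1. Proof. by rewrite invr_gt0. Qed.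

Lemma Lp_scale (w : Rn -> R) (E : set Rn) (h : Rn -> R) (t : R) : measurable E ->
  measurable_fun setT w -> (forall x, 0 <= w x) ->
  measurable_fun setT h -> (forall x, 0 <= h x) -> 0 <= t ->
  ((\int[mu]_(x in E) ((h x * t) `^ q * w x)%:E) `^ q^-1 =
   t%:E * (\int[mu]_(x in E) (h x `^ q * w x)%:E) `^ q^-1)%E.
Proof.
move=> mE mw w0 mh h0 t0; have tq0 : 0 <= t `^ q by exact: powR_ge0.
have pos x : E x -> (0 <= (h x `^ q * w x)%:E)%E by rewrite lee_fin mulr_ge0 ?powR_ge0.
have mhw : measurable_fun E (fun x => (h x `^ q * w x)%:E).
  apply: measurable_funTS; apply/measurable_EFinP; apply: measurable_funM => //.
  exact: measurable_comp_powR.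
have -> : (\int[mu]_(x in E) ((h x * t) `^ q * w x)%:E =
    (t `^ q)%:E * \int[mu]_(x in E) (h x `^ q * w x)%:E)%E.
  rewrite -(@ge0_integralZl_EFin _ _ _ mu _ mE _ pos mhw _ tq0).
  by apply: eq_integral => x _; rewrite -EFinM powRM//; congr EFin; ring.
rewrite poweRM ?lee_fin//; last by apply: integral_ge0 => x Ex; exact: pos.
by rewrite poweR_EFin -powRrM mulfV ?gt_eqF// powRr1.
Qed.

Variable P : R -> Rn -> Rn -> R[i].
Hypothesis mP : cmeasurable [set u : R * (Rn * Rn) | 0 < u.1]
  (fun u : R * (Rn * Rn) => P u.1 u.2.1 u.2.2).
Hypothesis gaussP : gaussian_bound P.
Local Notation N := (fractional_power alpha P).
Local Notation abs := (abs_integral alpha P).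

Lemma abs_integralD_fin (f g : Fn) x : cmeasurable setT f -> cmeasurable setT g ->
  (abs f x < +oo)%E -> (abs g x < +oo)%E -> (abs (fun y => f y + g y)%R x < +oo)%E.
Proof.
move=> mf mg ff gf.
apply: (@le_lt_trans _ _ (abs f x + abs g x)%E); last by rewrite lte_add_pinfty.
have mF := cmeasurable_integrand alpha mP x mf.
have mG := cmeasurable_integrand alpha mP x mg.
rewrite /abs_integral -(@ge0_integralD _ _ _ _ _ measurableT).
- apply: le_integral_ge0 => z _; first by rewrite lee_fin normc_ge0.
  rewrite -EFinD lee_fin; apply: le_trans (normcD_le _ _).
  by rewrite /integrand mulrDr mulrDl.
- by move=> z _; rewrite lee_fin normc_ge0.
- by apply/measurable_EFinP; exact: measurable_normc.
- by move=> z _; rewrite lee_fin normc_ge0.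
- by apply/measurable_EFinP; exact: measurable_normc.
Qed.

Lemma cmeasurable_commutator (b f : Fn) : cmeasurable setT b -> cmeasurable setT f ->
  cmeasurable setT (commutator b N f).
Proof.
move=> mb mf; apply: cmeasurableB.
  by apply: cmeasurableM => //; exact: cmeasurable_fractional_power.
by apply: cmeasurable_fractional_power => //; exact: cmeasurableM.
Qed.

(** With h = (b - c) f, linearity gives N(b g) = N((b - c) g) + c N g for g equal
to f or to its near part; the near terms cancel. Linearity is available because
the four integrals converge absolutely at x. *)
Lemma commutator_split (b f : Fn) (c : R[i]) (E : set Rn) x : measurable E ->
  cmeasurable setT b -> cmeasurable setT f ->
  let h y := (b y - c) * f y in
  (abs (cut E f) x < +oo)%E -> (abs (cut (~` E) f) x < +oo)%E ->
  (abs (cut E h) x < +oo)%E -> (abs (cut (~` E) h) x < +oo)%E ->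
  commutator b N f x = commutator b N (cut E f) x +
    ((b x - c) * N (cut (~` E) f) x - N (cut (~` E) h) x).
Proof.
move=> mE mb mf h f1 f2 h1 h2.
have mh : cmeasurable setT h.
  by apply: cmeasurableM => //; exact: (cmeasurableB mb (cmeasurable_cst _ c)).
have mEc : measurable (~` E) by exact: measurableC.
have mf1 := cmeasurable_cut mE mf; have mf2 := cmeasurable_cut mEc mf.
have mh1 := cmeasurable_cut mE mh; have mh2 := cmeasurable_cut mEc mh.
have cZ (g : Fn) : cmeasurable setT g -> cmeasurable setT (fun y => c * g y).
  by move=> mg; apply: cmeasurableM => //; exact: cmeasurable_cst.
have aZ (g : Fn) : cmeasurable setT g -> (abs g x < +oo)%E -> (abs (fun y => c * g y)%R x < +oo)%E.
  move=> mg gf; rewrite (abs_integralZ _ mP)//.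
  by apply: lte_mul_pinfty => //; rewrite lee_fin normc_ge0.
have ff : (abs f x < +oo)%E by rewrite (cutD E f); exact: abs_integralD_fin.
have hf : (abs h x < +oo)%E by rewrite (cutD E h); exact: abs_integralD_fin.
have e0 : (fun y => b y * f y) = (fun y => h y + c * f y).
  by apply/funext => y; rewrite /h; ring.
have e1 : (fun y => b y * cut E f y) = (fun y => cut E h y + c * cut E f y).
  by apply/funext => y; rewrite /cut /h; case: ifP => _; ring.
rewrite /commutator e0 e1.
rewrite (fractional_powerD mP mh (cZ _ mf) hf (aZ _ mf ff)).
rewrite (fractional_powerD mP mh1 (cZ _ mf1) h1 (aZ _ mf1 f1)).
rewrite (fractional_powerZ mP c mf ff) (fractional_powerZ mP c mf1 f1).
rewrite [in N f x](cutD E f) (fractional_powerD mP mf1 mf2 f1 f2).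
rewrite [in N h x](cutD E h) (fractional_powerD mP mh1 mh2 h1 h2).
move: (N (cut E f) x) (N (cut (~` E) f) x) (N (cut E h) x) (N (cut (~` E) h) x) (b x).
by move=> u1 u2 u3 u4 u5; ring.
Qed.

Variables (w1 w2 : Rn -> R) (psi1 psi2 : Rn -> R -> R).
Hypotheses (ww1 : is_weight w1) (ww2 : is_weight w2).
Hypotheses (hpsi1 : forall a r, 0 < r -> 0 < psi1 a r)
  (hpsi2 : forall a r, 0 < r -> 0 < psi2 a r).
Local Notation U a r := (wmeas (wpow w2 q) (eball a r)).
Local Notation W a r := (wmeas (wpow w1 p) (eball a r)).
Local Notation MX := (Morrey p (wpow w1 p) psi1).
Local Notation F := (Fball p w1).
Local Notation Ub := (Uball q w2).
Variables (Cd Kd Ct Cb : R).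
Hypotheses (Cd0 : 0 < Cd) (hCd : dual_bound alpha p q Cd w1 w2).
Hypotheses (Kd0 : 0 < Kd)
  (hKd : forall a r, 0 < r -> (U a (2 * r)%R `^ q^-1 <= Kd%:E * U a r `^ q^-1)%E).
Hypothesis fW : forall a r, W a r \is a fin_num.
Hypotheses (Ct0 : 0 < Ct) (tail2 : forall f M a r, cmeasurable setT f -> 0 < M ->
  (fnorm MX f <= M%:E)%E -> 0 < r ->
  (\sum_(0 <= k <oo) (k.+1%:R * (F f a (r * 2 ^+ k) / Ub a (r * 2 ^+ k)))%:E
   <= (Ct * M * psi2 a r)%:E)%E).

Let fU a r (r0 : 0 < r) : U a r \is a fin_num := (hCd a r0).1.
Let Uball_dual' := Uball_dual hCd.
Let Uball_dual_gt0' := Uball_dual_gt0 ww2 hCd.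

Lemma weighted_tail f M a r : cmeasurable setT f -> 0 < M ->
  (fnorm MX f <= M%:E)%E -> 0 < r ->
  (\sum_(0 <= k <oo) (F f a (r * 2 ^+ k) / Ub a (r * 2 ^+ k))%:E
   <= (Ct * M * psi2 a r)%:E)%E.
Proof.
move=> mf M0 hM r0; apply: le_trans (tail2 a mf M0 hM r0).
have G0 k : 0 <= F f a (r * 2 ^+ k) / Ub a (r * 2 ^+ k).
  apply: divr_ge0; first exact: Fball_ge0.
  by apply/ltW/Uball_dual_gt0'; rewrite mulr_gt0 ?exprn_gt0.
apply: lee_nneseries => k _; first by move=> _; rewrite lee_fin.
by rewrite lee_fin ler_peMl// ler1n.
Qed.

Hypothesis Cb0 : 0 < Cb.
Local Notation bmo_bound := (bmo_bound alpha p q w1 w2 Cb).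

Lemma bmo_bound_chain b A c a r k : bmo_bound b A c -> 0 < r ->
  normc (c a (r * 2 ^+ k) - c a r) <= k%:R * (Cb * A).
Proof.
move=> hc r0; elim: k => [|k IH]; first by rewrite expr0 mulr1 subrr normcx0 mul0r.
have rk : 0 < r * 2 ^+ k by rewrite mulr_gt0// exprn_gt0.
have [_ _ h] := hc a _ rk.
have -> : c a (r * 2 ^+ k.+1) - c a r =
    (c a (2 * (r * 2 ^+ k)) - c a (r * 2 ^+ k)) + (c a (r * 2 ^+ k) - c a r).
  have -> : r * 2 ^+ k.+1 = 2 * (r * 2 ^+ k) by rewrite exprS; ring.
  by rewrite addrA subrK.
apply: le_trans (normcD_le _ _) _; rewrite [leRHS](_ : _ = Cb * A + k%:R * (Cb * A)); last by rewrite -[k.+1%:R]natr1; ring.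
exact: lerD.
Qed.

(** Replacing c(a, r) by c(a, 2^k r) costs k times the drift of c, hence the
factor k + 1. *)
Lemma bmo_L1_ball b A c f M a r k : cmeasurable setT b -> 0 < A -> bmo_bound b A c ->
  cmeasurable setT f -> (fnorm MX f <= M%:E)%E -> 0 < r ->
  (\int[mu]_(y in eball a (r * 2 ^+ k)) (normc ((b y - c a r) * f y)%R)%:E <=
   ((r * 2 ^+ k) `^ (n%:R - alpha) *
     (Cb * A * (1 + Cd) * (k.+1%:R * (F f a (r * 2 ^+ k) / Ub a (r * 2 ^+ k)))))%:E)%E.
Proof.
move=> mb A0 hc mf hM r0.
have rk : 0 < r * 2 ^+ k by rewrite mulr_gt0// exprn_gt0.
set rho := r * 2 ^+ k in rk *.
have [_ h2 _] := hc a _ rk; have {}h2 := h2 f mf.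
have h3 := L1_ball_le ww1 ww2 hpsi1 hCd fW a mf hM rk.
have chain : normc (c a rho - c a r) <= k%:R * (Cb * A) by exact: (bmo_bound_chain a k hc r0).
have mB := @measurable_eball R n a rho.
have mbc : cmeasurable setT (fun x => b x - c a rho).
  exact: (cmeasurableB mb (cmeasurable_cst _ _)).
have u0 := Uball_dual_gt0' a rk.
have F0 : 0 <= F f a rho by exact: Fball_ge0.
have G0 : 0 <= F f a rho / Ub a rho by rewrite divr_ge0// ltW.
have P0 := powR_ge0 rho (n%:R - alpha).
have CA0 : 0 < Cb * A by rewrite mulr_gt0.
rewrite Uball_dual'// (Lp_norm_fin ww1 hpsi1 fW a hM rk) in h2.
have {}h2 : (\int[mu]_(x in eball a rho) (normc (b x - c a rho)%R * normc (f x))%:E <=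
    (Cb * A * rho `^ (n%:R - alpha) * (F f a rho / Ub a rho))%:E)%E.
  move: h2; rewrite muleC -EFinM -lee_pdivlMl// -EFinM => /le_trans; apply.
  by rewrite lee_fin le_eqVlt; apply/orP; left; apply/eqP; field; rewrite gt_eqF.
have p1' x : eball a rho x -> (0 <= (normc (b x - c a rho)%R * normc (f x))%:E)%E.
  by rewrite lee_fin mulr_ge0 ?normc_ge0.
have p2' x : eball a rho x -> (0 <= (normc (c a rho - c a r)%R * normc (f x))%:E)%E.
  by rewrite lee_fin mulr_ge0 ?normc_ge0.
have m1 : measurable_fun (eball a rho) (fun x => (normc (b x - c a rho)%R * normc (f x))%:E).
  apply: measurable_funTS; apply/measurable_EFinP; apply: measurable_funM; exact: measurable_normc.
have m2 : measurable_fun (eball a rho) (fun x => (normc (c a rho - c a r)%R * normc (f x))%:E).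
  apply: measurable_funTS; apply/measurable_EFinP; apply: measurable_funM => //.
  exact: measurable_normc.
have mf' : measurable_fun (eball a rho) (fun x => (normc (f x))%:E).
  by apply: measurable_funTS; apply/measurable_EFinP; exact: measurable_normc.
have f0' x : eball a rho x -> (0 <= (normc (f x))%:E)%E by rewrite lee_fin normc_ge0.
apply: (@le_trans _ _ (\int[mu]_(x in eball a rho) (normc (b x - c a rho)%R * normc (f x))%:E +
   \int[mu]_(x in eball a rho) (normc (c a rho - c a r)%R * normc (f x))%:E)%E).
  rewrite -(ge0_integralD mu mB p1' m1 p2' m2).
  apply: le_integral_ge0 => y _; first by rewrite lee_fin normc_ge0.
  rewrite -EFinD lee_fin normcMx -mulrDl; apply: ler_wpM2r; first exact: normc_ge0.
  rewrite (_ : b y - c a r = (b y - c a rho) + (c a rho - c a r)); first exact: normcD_le.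
  by rewrite addrA subrK.
apply: (@le_trans _ _ ((Cb * A * rho `^ (n%:R - alpha) * (F f a rho / Ub a rho))%:E +
   (k%:R * (Cb * A))%:E * (rho `^ (n%:R - alpha) * (Cd * (F f a rho / Ub a rho)))%:E)%E).
  apply: leeD => //.
  under eq_integral do rewrite EFinM.
  rewrite (@ge0_integralZl_EFin _ _ _ mu _ mB _ f0' mf' _ (normc_ge0 _)).
  apply: lee_pmul => //; first by rewrite lee_fin normc_ge0.
  by apply: integral_ge0.
rewrite -EFinM -EFinD lee_fin -natr1.
move: G0; move: (F f a rho / Ub a rho) => G G0.
move: P0; move: (rho `^ _) => X X0; have Cd0' := ltW Cd0; have k0 : 0 <= k%:R :> R by [].
have : 0 <= (Cb * A) * (X * G) by rewrite mulr_ge0 ?(ltW CA0)// mulr_ge0.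
have : 0 <= Cd * ((Cb * A) * (X * G)) by rewrite mulr_ge0// mulr_ge0 ?(ltW CA0)// mulr_ge0.
have : 0 <= k%:R * ((Cb * A) * (X * G)) by rewrite mulr_ge0// mulr_ge0 ?(ltW CA0)// mulr_ge0.
move: k%:R => kk; nra.
Qed.

Lemma commutator_decomposition : exists2 C : R, 0 < C &
  forall (b f : Fn) (A : R) c M a r, cmeasurable setT b -> 0 < A -> bmo_bound b A c ->
    cmeasurable setT f -> 0 < M -> (fnorm MX f <= M%:E)%E -> 0 < r ->
    {ae mu, forall x, eball a r x ->
      normc (commutator b N f x) <= normc (commutator b N (cut (eball a (2 * r)) f) x) +
        (normc (b x - c a r) * (C * M * psi2 a r) + C * A * M * psi2 a r)}.
Proof.
have [C1 C10 split] := fractional_power_split an mP gaussP.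
have D0 : 0 < C1 * Cd * Ct by rewrite !mulr_gt0.
have E0 : 0 < C1 * (Cb * (1 + Cd)) * Ct by rewrite !mulr_gt0// addr_gt0.
exists (C1 * Cd * Ct + C1 * (Cb * (1 + Cd)) * Ct); first exact: addr_gt0.
move=> b f A c M a r mb A0 hc mf M0 hM r0.
have r2 k : 0 < r * 2 ^+ k by rewrite mulr_gt0 ?exprn_gt0.
have ps0 := hpsi2 a r0.
pose h y := (b y - c a r) * f y.
have mh : cmeasurable setT h.
  by apply: cmeasurableM => //; exact: (cmeasurableB mb (cmeasurable_cst _ _)).
pose G k := F f a (r * 2 ^+ k) / Ub a (r * 2 ^+ k).
have G0 k : 0 <= G k by apply: divr_ge0; [exact: Fball_ge0|exact: (ltW (Uball_dual_gt0' a (r2 k)))].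
have kG0 k : 0 <= k.+1%:R * G k by exact: mulr_ge0.
have series_scale (t : R) (g : nat -> R) (s : R) : 0 < t -> (forall k, 0 <= g k) ->
    (\sum_(0 <= k <oo) (g k)%:E <= s%:E)%E -> (\sum_(0 <= k <oo) (t * g k)%:E <= (t * s)%:E)%E.
  move=> t0 g0 hg; under eq_eseriesr do rewrite EFinM.
  rewrite nneseriesZl; last by move=> k _; rewrite lee_fin.
  by rewrite EFinM; apply: lee_wpmul2l; [rewrite lee_fin ltW|exact: hg].
have hD1 := series_scale Cd G _ Cd0 G0 (weighted_tail a mf M0 hM r0).
have CA0 : 0 < Cb * A * (1 + Cd) by rewrite !mulr_gt0// addr_gt0.
have hD2 := series_scale _ (fun k => k.+1%:R * G k) _ CA0 kG0 (tail2 a mf M0 hM r0).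
have [near1 far1] := split f a r _ (fun k => Cd * G k) mf r0
  (fun k => mulr_ge0 (ltW Cd0) (G0 k))
  (fun k => L1_ball_le ww1 ww2 hpsi1 hCd fW a mf hM (r2 k)) hD1.
have [near2 far2] := split h a r _ (fun k => Cb * A * (1 + Cd) * (k.+1%:R * G k)) mh r0
  (fun k => mulr_ge0 (ltW CA0) (kG0 k))
  (fun k => bmo_L1_ball a k mb A0 hc mf hM r0) hD2.
have mB := @measurable_eball R n a (2 * r).
apply: filterS2 near1 near2 => x hx1 hx2 ax.
have [fin1 le1] := far1 x ax; have [fin2 le2] := far2 x ax.
rewrite (commutator_split mB mb mf (hx1 ax) fin1 (hx2 ax) fin2).
apply: le_trans (normcD_le _ _) _; rewrite lerD2l.
apply: le_trans (normcD_le _ _) _; rewrite normc_opp normcMx.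
have MP0 : 0 < M * psi2 a r by rewrite mulr_gt0.
apply: lerD.
  apply: ler_wpM2l; first exact: normc_ge0.
  apply: le_trans le1 _; rewrite -[leRHS]mulrA.
  have -> : C1 * (Cd * (Ct * M * psi2 a r)) = C1 * Cd * Ct * (M * psi2 a r) by ring.
  by apply: (ler_wpM2r (ltW MP0)); rewrite lerDl ltW.
apply: le_trans le2 _.
have -> : C1 * (Cb * A * (1 + Cd) * (Ct * M * psi2 a r)) =
  C1 * (Cb * (1 + Cd)) * Ct * (A * M * psi2 a r) by ring.
rewrite -!(mulrA _ A) -!(mulrA _ M) [leRHS](_ : _ = (C1 * Cd * Ct + C1 * (Cb * (1 + Cd)) * Ct) * (A * M * psi2 a r)); last by ring.
rewrite -(mulrA A); apply: ler_wpM2r; first by rewrite mulr_ge0 ?(ltW MP0) ?(ltW A0).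
by rewrite lerDr ltW.
Qed.

Lemma slice_commutator (K0 : R) : 0 < K0 -> exists2 K : R, 0 < K &
  forall (b : Fn) (A : R) c, cmeasurable setT b -> 0 < A -> bmo_bound b A c ->
    bounded_by (K0 * A) (Lp p (wpow w1 p)) (Lp q (wpow w2 q)) (commutator b N) ->
    forall f, cmeasurable setT f ->
    (fnorm (Morrey q (wpow w2 q) psi2) (commutator b N f) <= (K * A)%:E * fnorm MX f)%E.
Proof.
move=> K00; have [C C0 dec] := commutator_decomposition.
have [C' C'0 dec'] := slice_decomposition an ww1 ww2 hpsi1 hpsi2 mP gaussP Cd0 hCd Kd0 hKd
  fW Ct0 weighted_tail.
pose k2 : R := 2 * 2 `^ q^-1.
have k20 : 0 < k2 by rewrite mulr_gt0// powR_gt0.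
pose K := k2 * (K0 * C' + k2 * (C * Cb + C)).
have Kgt0 : 0 < K.
  apply: mulr_gt0 => //; apply: addr_gt0; first exact: mulr_gt0.
  by apply: mulr_gt0 => //; apply: addr_gt0 => //; exact: mulr_gt0.
exists K => // b A c mb A0 hc bN f mf.
have KA0 : 0 < K * A by exact: mulr_gt0.
apply: le_norm_scale => //; first exact: Morrey_norm_ge0.
move=> M M0 hM; apply: sup_balls_le => a r r0; apply: (ball_normalize ww2 hpsi2 hCd) => //.
have [F2 _] := dec' f M a r mf M0 hM r0.
have hae := dec b f A c M a r mb A0 hc mf M0 hM r0.
have r20 : 0 < 2 * r by rewrite mulr_gt0.
have [in1 E1] := cut_in_Lp hp ww1 hpsi1 fW a mf hM r20.
have [[mN1 _] b1] := bN _ in1; rewrite E1 in b1.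
set f1 := cut _ f in mN1 b1 hae.
have mB := @measurable_eball R n a r.
have ps0 := hpsi2 a r0; have u0 := Uball_dual_gt0' a r0.
have mNf : cmeasurable setT (commutator b N f) by exact: cmeasurable_commutator.
pose T := C * M * psi2 a r; pose T' := C * A * M * psi2 a r.
have T0 : 0 <= T by exact: (ltW (mulr_gt0 (mulr_gt0 C0 M0) ps0)).
have T'0 : 0 <= T' by exact: (ltW (mulr_gt0 (mulr_gt0 (mulr_gt0 C0 A0) M0) ps0)).
have mw2 := measurable_wpow q ww2.
have w20 x : 0 <= wpow w2 q x by exact: powR_ge0.
have mbc : measurable_fun setT (fun x => normc (b x - c a r)).
  by apply: measurable_normc; exact: (cmeasurableB mb (cmeasurable_cst _ _)).
pose bT x := normc (b x - c a r) * T.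
have mbT : measurable_fun setT bT by exact: measurable_funM.
have bT0 x : 0 <= bT x by rewrite mulr_ge0 ?normc_ge0.
pose G x := bT x + cst T' x.
have mG : measurable_fun setT G by exact: measurable_funD.
have G0 x : 0 <= G x by rewrite addr_ge0.
have := @Lp_norm_add_le R n q (wpow w2 q) (eball a r) q0 mB mw2 w20
  (commutator b N f) (fun x => normc (commutator b N f1 x)) G mNf
  (measurable_normc mN1) mG (fun x => normc_ge0 _) G0 hae.
move=> /le_trans; apply; rewrite -/k2.
have le1 : ((\int[mu]_(x in eball a r) (normc (commutator b N f1 x) `^ q * wpow w2 q x)%:E) `^ q^-1 <=
    (K0 * A * (C' * M * psi2 a r * Ub a r))%:E)%E.
  apply: (@le_trans _ _ (fnorm (Lp q (wpow w2 q)) (commutator b N f1))).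
    exact: (Lp_norm_mono q0 mB measurableT mw2 w20 mN1 (@subsetT _ _)).
  apply: (le_trans b1); rewrite -EFinM lee_fin.
  by apply: ler_wpM2l => //; exact: (ltW (mulr_gt0 K00 A0)).
have leb : ((\int[mu]_(x in eball a r) (bT x `^ q * wpow w2 q x)%:E) `^ q^-1 <=
    (T * (Cb * A * Ub a r))%:E)%E.
  rewrite (Lp_scale mB mw2 w20 mbc (fun x => normc_ge0 _) T0) [leRHS]EFinM.
  apply: lee_wpmul2l; first by rewrite lee_fin.
  have [h _ _] := hc a r r0; apply: le_trans h _.
  by rewrite Uball_dual'// -EFinM lexx.
have lec : ((\int[mu]_(x in eball a r) (cst T' x `^ q * wpow w2 q x)%:E) `^ q^-1 =
    (T' * Ub a r)%:E)%E.
  have m1 : measurable_fun setT (fun _ : Rn => 1 : R) by exact: measurable_cst.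
  have E : (\int[mu]_(x in eball a r) (cst T' x `^ q * wpow w2 q x)%:E =
      \int[mu]_(x in eball a r) ((1 * T') `^ q * wpow w2 q x)%:E)%E.
    by apply: eq_integral => x _; rewrite mul1r.
  rewrite E (Lp_scale mB mw2 w20 m1 (fun _ => ler01) T'0) [RHS]EFinM -(Uball_dual' a r0).
  congr (_ * _ `^ _)%E; rewrite /wmeas.
  by apply: eq_integral => x _; rewrite powR1 mul1r.
have leG : ((\int[mu]_(x in eball a r) (G x `^ q * wpow w2 q x)%:E) `^ q^-1 <=
    (k2 * (T * (Cb * A * Ub a r) + T' * Ub a r))%:E)%E.
  have nG x : normc (G x)%:C%C = G x by rewrite normc_real ger0_norm.
  have := @Lp_norm_add_le R n q (wpow w2 q) (eball a r) q0 mB mw2 w20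
    (fun x => (G x)%:C%C) bT (cst T') (cmeasurable_real mG) mbT (measurable_cst _)
    bT0 (fun x => T'0).
  rewrite /Lp_norm -/k2; under eq_integral do rewrite nG.
  have hG : {ae mu, forall x, eball a r x -> normc (G x)%:C%C <= bT x + cst T' x}.
    by apply: aeW => x _; rewrite nG.
  move=> /(_ hG)/le_trans; apply; rewrite lec [leRHS]EFinM [in leRHS]EFinD.
  apply: lee_wpmul2l; first by rewrite lee_fin ltW.
  exact: leeD2r.
apply: (@le_trans _ _ (k2%:E * ((K0 * A * (C' * M * psi2 a r * Ub a r))%:E +
    (k2 * (T * (Cb * A * Ub a r) + T' * Ub a r))%:E))%E).
  by apply: lee_wpmul2l; [rewrite lee_fin ltW|exact: leeD].
rewrite -EFinD -EFinM lee_fin /K /T /T' le_eqVlt; apply/orP; left; apply/eqP; ring.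
Qed.

End commutator_slice.

(** * The theorem *)

Section constants.
Context {R : realType} (n : nat).
Local Notation Rn := (n.-tuple R).
Local Notation Fn := (Rn -> R[i]).
Local Notation mu := (@leb R n).

Lemma sup_balls_real_bound (G : Rn -> R -> \bar R) : (sup_balls G < +oo)%E ->
  exists2 A : R, 0 < A & forall a r, 0 < r -> (G a r <= A%:E)%E.
Proof.
move=> h; exists (`|fine (sup_balls G)| + 1); first by rewrite ltr_wpDl.
move=> a r r0; have : (G a r <= sup_balls G)%E by apply: ereal_sup_ubound; exists (a, r).
move: h; case: (sup_balls G) => [x _| |_]//=.
  by move=> /le_trans; apply; rewrite lee_fin (le_trans (ler_norm _))// lerDl.
by rewrite leeNy_eq => /eqP ->; rewrite leNye.
Qed.

Lemma bmo_avg_le (b : Fn) : BMO b -> 0 <= fine (bmo_seminorm b) /\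
  forall a r, 0 < r -> (avg (eball a r) (fun x => normc (b x - cavg (eball a r) b)%R) <=
    (fine (bmo_seminorm b))%:E)%E.
Proof.
move=> [mb lb bfin].
have le a r : 0 < r -> (avg (eball a r) (fun x => normc (b x - cavg (eball a r) b)%R) <=
    bmo_seminorm b)%E by move=> r0; apply: ereal_sup_ubound; exists (a, r).
have b0 : (0 <= bmo_seminorm b)%E.
  apply: le_trans (le [tuple of nseq n 0] 1 ltr01); apply: mule_ge0.
    by rewrite inve_ge0 measure_ge0.
  by apply: integral_ge0 => x _; rewrite lee_fin normc_ge0.
split; first exact: fine_ge0.
by move=> a r r0; rewrite fineK; [exact: le|rewrite ge0_fin_numE].
Qed.

Lemma bounded_by_le (X Y : fspace R Fn) (N : Fn -> Fn) (K K' : R) : K <= K' ->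
  (forall f, (0 <= fnorm X f)%E) -> bounded_by K X Y N -> bounded_by K' X Y N.
Proof.
move=> KK X0 h f Xf; have [Yf le] := h f Xf; split => //.
by apply: le_trans le _; apply: lee_wpmul2r; rewrite ?lee_fin.
Qed.

Lemma weight_pow1 (w : Rn -> R) : is_weight w -> wpow w 1 = w.
Proof. by move=> [_ w0 _ _]; apply/funext => x; rewrite /wpow powRr1. Qed.

(** The number of dyadic scales between r and t is of order 1 + ln(t / r). *)
Lemma succn_le_ln (k : nat) (x : R) : 2 ^+ k <= x ->
  k.+1%:R <= ((ln 2)^-1 + 1) * (1 + ln x).
Proof.
move=> kx; have l2 : 0 < ln 2 :> R by rewrite ln_gt0// ltr1n.
have p2 : 0 < 2 ^+ k :> R by rewrite exprn_gt0.
have h : k%:R * ln 2 <= ln x.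
  rewrite mulr_natl -lnXn//; rewrite ler_ln ?posrE//; exact: lt_le_trans kx.
have lx : 0 <= ln x by apply: le_trans h; rewrite mulr_ge0// ltW.
have : k%:R <= (ln 2)^-1 * ln x by rewrite mulrC ler_pdivlMr.
have : 0 <= (ln 2)^-1 :> R by rewrite invr_ge0 ltW.
by rewrite -natr1; nra.
Qed.

End constants.

Section tail.
Context {R : realType} (n : nat) (alpha p q s : R).
Local Notation Rn := (n.-tuple R).
Local Notation Fn := (Rn -> R[i]).
Local Notation mu := (@leb R n).
Local Notation leb1 := (@lebesgue_measure R).
Hypotheses (an : 0 < alpha < n%:R) (hp : 1 <= p < n%:R / alpha)
  (hq : q^-1 = p^-1 - alpha / n%:R)
  (hs : 1 < p -> 1 <= s < p) (hs1 : p = 1 -> s = 1).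
Variables (w1 w2 : Rn -> R) (psi1 psi2 : Rn -> R -> R).
Hypotheses (ww1 : is_weight w1) (ww2 : is_weight w2).
Hypotheses (hpsi1 : forall a r, 0 < r -> 0 < psi1 a r)
  (hpsi2 : forall a r, 0 < r -> 0 < psi2 a r).
Hypotheses (hw12 : Apq (p / s) (q / s) (wpow w1 s) (wpow w2 s))
  (hw22 : Apq (p / s) (q / s) (wpow w2 s) (wpow w2 s)).

Lemma dual_bound_Apq (v1 v2 : Rn -> R) : is_weight v1 -> is_weight v2 ->
  Apq (p / s) (q / s) (wpow v1 s) (wpow v2 s) ->
  exists2 C : R, 0 < C & dual_bound alpha p q C v1 v2.
Proof.
move=> wv1 wv2 hv; have /andP[p1 _] := hp.
move: p1; rewrite le_eqVlt => /predU1P[E|p1]; last exact: dual_bound_gt1 p1 (hs p1) hv.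
have Es := hs1 (esym E); apply: dual_bound_1 => //.
by move: hv; rewrite Es -E !divr1.
Qed.

Lemma doubling_Apq : exists2 K : R, 0 < K & forall a r, 0 < r ->
  (wmeas (wpow w2 q) (eball a (2 * r)) `^ q^-1 <=
   K%:E * wmeas (wpow w2 q) (eball a r) `^ q^-1)%E.
Proof.
have [C C0 hC] := dual_bound_Apq ww2 ww2 hw22.
exact: wmeas_doubling ww2 C0 hC.
Qed.

(** A weight phi >= 1 gives in particular the finiteness of the unweighted
integral at radius 1, which makes the balls have finite w1^p-mass. *)
Lemma weighted_tail_series (phi : R -> R) (c : nat -> R) (K : R) :
  (forall k, 0 <= c k) -> 0 < K -> (forall x, 1 <= x -> 1 <= phi x) ->
  (forall k x, 2 ^+ k <= x -> c k <= K * phi x) ->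
  (sup_balls (fun a r => (psi2 a r)^-1%:E * \int[leb1]_(t in `]r, +oo[)
    ((phi (t / r))%:E * inf_ratio p q w1 w2 psi1 a t * (t^-1)%:E)) < +oo)%E ->
  (forall a r, wmeas (wpow w1 p) (eball a r) \is a fin_num) /\
  exists2 Ct : R, 0 < Ct & forall f M a r, cmeasurable setT f -> 0 < M ->
    (fnorm (Morrey p (wpow w1 p) psi1) f <= M%:E)%E -> 0 < r ->
    (\sum_(0 <= k <oo) (c k * (Fball p w1 f a (r * 2 ^+ k) / Uball q w2 a (r * 2 ^+ k)))%:E
     <= (Ct * M * psi2 a r)%:E)%E.
Proof.
move=> c0 K0 phi1 cphi /sup_balls_real_bound[A A0 hA].
have [Cd Cd0 hCd] := dual_bound_Apq ww1 ww2 hw12.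
have [Kd Kd0 hKd] := doubling_Apq.
have fU a r : 0 < r -> wmeas (wpow w2 q) (eball a r) \is a fin_num by move=> r0; exact: (hCd a r r0).1.
have phi0 x : 1 <= x -> 0 <= phi x by move=> x1; apply: le_trans (phi1 x x1).
have {}hA a r : 0 < r -> (\int[leb1]_(t in `]r, +oo[)
    ((phi (t / r))%:E * inf_ratio p q w1 w2 psi1 a t * (t^-1)%:E) <= (A * psi2 a r)%:E)%E.
  move=> r0; have := hA a r r0; have ps := hpsi2 a r0.
  by rewrite lee_pdivrMl// mulrC -EFinM.
have fW a r : wmeas (wpow w1 p) (eball a r) \is a fin_num.
  apply: (wmeas_fin_of_tail hp ww1 ww2 hpsi1 fU) => {r}.
  apply: le_lt_trans (le_lt_trans (hA a 1 ltr01) (ltry _)).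
  apply: le_integral_ge0 => t; rewrite /= in_itv/= andbT => t1.
    have t0 : 0 < t by exact: lt_trans t1.
    by apply: mule_ge0; [exact: inf_ratio_ge0|rewrite lee_fin invr_ge0 ltW].
  have t0 : 0 < t by exact: lt_trans t1.
  apply: lee_wpmul2r; first by rewrite lee_fin invr_ge0 ltW.
  rewrite -[leLHS]mul1e; apply: lee_wpmul2r; first exact: inf_ratio_ge0.
  by rewrite lee_fin divr1 phi1// ltW.
split; first exact: fW.
exists (2 * K * Kd * A); first by rewrite !mulr_gt0.
move=> f M a r mf M0 hM r0.
exact: (tail_series an hp hq ww1 ww2 hpsi1 fU fW Kd0 hKd c0 K0 phi0 cphi hA).
Qed.

End tail.

Theorem theorem5p5 (R : realType) (n : nat) (alpha p q s p0 T : R)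
    (w1 w2 w : n.-tuple R -> R) (psi psi1 psi2 : n.-tuple R -> R -> R)
    (D : set (n.-tuple R -> R[i]))
    (L : (n.-tuple R -> R[i]) -> n.-tuple R -> R[i])
    (S : R[i] -> (n.-tuple R -> R[i]) -> n.-tuple R -> R[i])
    (P : R -> n.-tuple R -> n.-tuple R -> R[i])
    (halpha : 0 < alpha < n%:R) (hp : 1 <= p < n%:R / alpha)
    (hq : q^-1 = p^-1 - alpha / n%:R)
    (hs : 1 < p -> 1 <= s < p) (hs1 : p = 1 -> s = 1)
    (hw1 : is_weight w1) (hw2 : is_weight w2)
    (hw12 : Apq (p / s) (q / s) (wpow w1 s) (wpow w2 s))
    (hw22 : Apq (p / s) (q / s) (wpow w2 s) (wpow w2 s))
    (hp0 : 1 < p0) (hT : 0 < T)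
    (hpsi : forall a r, 0 < r -> 0 < psi a r) (hw : is_weight w)
    (hL : generates_analytic_semigroup D L S)
    (hP : semigroup_kernel S P) (hgauss : gaussian_bound P)
    (hpsi1 : forall a r, 0 < r -> 0 < psi1 a r)
    (hpsi2 : forall a r, 0 < r -> 0 < psi2 a r) :
  let N := fractional_power alpha P in
  let Mt := time_Morrey p0 w psi T in
  ((sup_balls (fun a r => (psi2 a r)^-1%:E *
       \int[lebesgue_measure]_(t in `]r, +oo[)
         (inf_ratio p q w1 w2 psi1 a t * (t^-1)%:E)) < +oo)%E ->
    (1 < p ->
       bounded_op (Lp p (wpow w1 p)) (Lp q (wpow w2 q)) N ->
       bounded_op (Mt (Morrey p (wpow w1 p) psi1))
         (Mt (Morrey q (wpow w2 q) psi2)) (act_slices N)) /\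
    (p = 1 ->
       bounded_op (Lp 1 w1) (WLp q (wpow w2 q)) N ->
       bounded_op (Mt (Morrey 1 w1 psi1))
         (Mt (WMorrey q (wpow w2 q) psi2)) (act_slices N)))
  /\
  (1 < p -> Ainfty w1 ->
    (sup_balls (fun a r => (psi2 a r)^-1%:E *
       \int[lebesgue_measure]_(t in `]r, +oo[)
         ((1 + ln (t / r))%:E * inf_ratio p q w1 w2 psi1 a t * (t^-1)%:E))
       < +oo)%E ->
    forall C0 : R, 0 < C0 -> exists2 C : R, 0 < C &
    forall b : n.-tuple R -> R[i], BMO b ->
      bounded_by (C0 * fine (bmo_seminorm b))
        (Lp p (wpow w1 p)) (Lp q (wpow w2 q)) (commutator b N) ->
      bounded_by (C * fine (bmo_seminorm b))
        (Mt (Morrey p (wpow w1 p) psi1)) (Mt (Morrey q (wpow w2 q) psi2))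
        (act_slices (commutator b N))).
Proof.
move=> N Mt; have [mP _] := hP.
have p00 : 0 < p0 by exact: lt_trans hp0.
have [Cd Cd0 hCd] := dual_bound_Apq halpha hp hq hs hs1 hw1 hw2 hw12.
have [Kd Kd0 hKd] := doubling_Apq halpha hp hq hs hs1 hw2 hw22.
split.
  move=> htail.
  have htail1 : (sup_balls (fun a r => (psi2 a r)^-1%:E *
       \int[lebesgue_measure]_(t in `]r, +oo[)
         (1%:E * inf_ratio p q w1 w2 psi1 a t * (t^-1)%:E)) < +oo)%E.
    apply: le_lt_trans htail; rewrite le_eqVlt; apply/orP; left; apply/eqP; congr sup_balls.
    apply/funext => a; apply/funext => r; congr (_ * _)%E.
    by apply: eq_integral => t _; rewrite mul1e.
  have le1 : forall (k : nat) (x : R), 2 ^+ k <= x -> 1 <= 1 * (1 : R) by move=> *; rewrite mulr1.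
  have [fW [Ct Ct0 tail]] := @weighted_tail_series R n alpha p q s halpha hp hq hs hs1 w1 w2
    psi1 psi2 hw1 hw2 hpsi1 hpsi2 hw12 hw22 (fun=> 1) (fun=> 1) 1 (fun=> ler01) ltr01
    (fun _ _ => lexx 1) le1 htail1.
  have tail1 f M a r : cmeasurable setT f -> 0 < M ->
      (fnorm (Morrey p (wpow w1 p) psi1) f <= M%:E)%E -> 0 < r ->
      (\sum_(0 <= k <oo) (Fball p w1 f a (r * 2 ^+ k) / Uball q w2 a (r * 2 ^+ k))%:E
       <= (Ct * M * psi2 a r)%:E)%E.
    move=> mf M0 hM r0; apply: le_trans (tail f M a r mf M0 hM r0).
    by rewrite le_eqVlt; apply/orP; left; apply/eqP; apply: eq_eseriesr => k _; rewrite mul1r.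
  have lift (Y : fspace R (n.-tuple R -> R[i])) (K : R) : 0 < K ->
      fmeas Y = cmeasurable setT -> (forall f, (0 <= fnorm Y f)%E) ->
      (forall f, cmeasurable setT f ->
        (fnorm Y (N f) <= K%:E * fnorm (Morrey p (wpow w1 p) psi1) f)%E) ->
      bounded_op (Mt (Morrey p (wpow w1 p) psi1)) (Mt Y) (act_slices N).
    move=> K0 mY Y0 hK; exists K; first exact: K0.
    apply: (bounded_by_time_Morrey p00 (ltW K0) hpsi hT).
    - by move=> f; exact: Morrey_norm_ge0.
    - exact: Y0.
    - by move=> f mf; rewrite mY; exact: (cmeasurable_fractional_power alpha mP mf).
    - move=> f K' mf KK'; apply: le_trans (hK f mf) _; apply: lee_wpmul2r.
        exact: Morrey_norm_ge0.
      by rewrite lee_fin ltW.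
  split.
    move=> p1 [K0 K00 bN].
    have [K Kgt0 hK] := slice_strong halpha hp hq hw1 hw2 hpsi1 hpsi2 mP hgauss Cd0 hCd Kd0 hKd
      fW Ct0 tail1 K00 bN.
    apply: (lift _ K Kgt0) => // f; exact: Morrey_norm_ge0.
  move=> p1 [K0 K00 bN].
  have bN' : bounded_by K0 (Lp p (wpow w1 p)) (WLp q (wpow w2 q)) N.
    by rewrite p1 weight_pow1.
  have [K Kgt0 hK] := slice_weak halpha hp hq hw1 hw2 hpsi1 hpsi2 mP hgauss Cd0 hCd Kd0 hKd
    fW Ct0 tail1 K00 bN'.
  have := lift (WMorrey q (wpow w2 q) psi2) K Kgt0 erefl _ hK.
  rewrite p1 weight_pow1//; apply=> f; exact: WMorrey_norm_ge0.
move=> p1 _ htail C0 C00.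
have ln2V : 0 < (ln 2)^-1 + 1 :> R by rewrite ltr_wpDl// invr_ge0 ln_ge0// ler1n.
have phi1 (x : R) : 1 <= x -> 1 <= 1 + ln x by move=> x1; rewrite lerDl ln_ge0.
have [fW [Ct Ct0 tail2]] := @weighted_tail_series R n alpha p q s halpha hp hq hs hs1 w1 w2
  psi1 psi2 hw1 hw2 hpsi1 hpsi2 hw12 hw22 (fun x => 1 + ln x) (fun k => k.+1%:R) _
  (fun k => ler0n _ _) ln2V phi1 (@succn_le_ln R) htail.
have [C1 C10 pb1] := Apq_power_bound halpha hp hq hw1 hw2 p1 (hs p1) hw12.
have [C2 C20 pb2] := Apq_power_bound halpha hp hq hw2 hw2 p1 (hs p1) hw22.
have [Cb Cb0 hb] := bmo_bounds halpha hp hq p1 hw1 hw2 C10 C20 pb1 pb2 Kd0 hKd.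
have [K Kgt0 hK] := slice_commutator halpha hp hq mP hgauss hw1 hw2 hpsi1 hpsi2 Cd0 hCd Kd0 hKd
  fW Ct0 tail2 Cb0 C00.
exists K; first exact: Kgt0.
move=> b bmo_b bN; have [beta0 hbeta] := bmo_avg_le bmo_b.
have [mb lb _] := bmo_b.
set beta := fine (bmo_seminorm b) in beta0 hbeta bN *.
apply: (bounded_by_time_Morrey p00 (mulr_ge0 (ltW Kgt0) beta0) hpsi hT).
- by move=> f; exact: Morrey_norm_ge0.
- by move=> f; exact: Morrey_norm_ge0.
- by move=> f mf; exact: (cmeasurable_commutator alpha mP mb mf).
(* A bounds the seminorm and is positive even when the seminorm is 0 *)
move=> f K' mf hK'; pose A := K' / K.
have bA : beta < A by rewrite /A ltr_pdivlMr// mulrC.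
have A0 : 0 < A by exact: le_lt_trans bA.
have hbA a r : 0 < r -> (avg (eball a r) (fun x => normc (b x - cavg (eball a r) b)%R) <= A%:E)%E.
  by move=> r0; apply: le_trans (hbeta a r r0) _; rewrite lee_fin ltW.
have [c hc] := hb b A A0 mb lb hbA.
have -> : K' = K * A by rewrite /A mulrC divfK// gt_eqF.
apply: (hK b A c mb A0 hc _ f mf); apply: bounded_by_le bN.
  by apply: ler_wpM2l; [exact: ltW|exact: ltW].
by move=> g; exact: poweR_ge0.
Qed.
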